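(* Let $n\ge 3$. If $\Phi: \mathcal{K}^n \rightarrow \mathcal{K}^n$ is a monotone Minkowski endomorphism such that $\Phi B^n = B^n$, and $K \in \mathcal{K}^n$ has non-empty interior, then $$|B^n|\left(\frac{w(K)}{2} \right)^{-n} \leq |\Phi^\circ K| \leq | K^{\mathbf{s}}|.$$ There is equality in the left hand inequality if and only if $\Phi K$ is a Euclidean ball. Equality in the right hand inequality holds if and only if either $K$ is centrally-symmetric and $\Phi = \Delta$, or $K$ is a Euclidean ball.
   Context: $\mathcal{K}^n$ is the space of convex bodies (non-empty compact convex sets) in $\mathbb{R}^n$ with the Hausdorff metric; $|A|$ denotes volume; $B^n$ is the Euclidean unit ball; $h(K,u)=\max\{u\cdot x: x\in K\}$ is the support function. A Minkowski endomorphism is a continuous map $\Phi: \mathcal{K}^n \rightarrow \mathcal{K}^n$ which is Minkowski additive ($\Phi(K+L)=\Phi K+\Phi L$), translation invariant ($\Phi(K+x)=\Phi K$), and commutes with $\mathrm{SO}(n)$ ($\Phi(\vartheta K)=\vartheta\Phi K$). It is monotone if $K\subseteq L$ implies $\Phi K\subseteq\Phi L$ for all $K, L \in \mathcal{K}^n$. The mean width is $w(K)=\frac{2}{n|B^n|}\int_{\mathbb{S}^{n-1}}h(K,u)\,du$ (integration with respect to spherical Lebesgue measure). $\Delta K=\frac12(K+(-K))$. $\Phi^\circ K:=(\Phi K)^\circ=\{x: x\cdot y\le1\text{ for all }y\in\Phi K\}$ is the polar body of $\Phi K$ with respect to the origin (which lies in the interior of $\Phi K$ here). For $z\in\mathrm{int}\,K$,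 $K^z=\{x: x\cdot y\le1\text{ for all }y\in K-z\}$; the Santaló point $\mathbf{s}=\mathbf{s}(K)$ is the unique point of $\mathrm{int}\,K$ with $|K^{\mathbf{s}}|=\min\{|K^z|: z\in\mathrm{int}\,K\}$. Centrally-symmetric means symmetric about some point, i.e. a translate of $K$ is invariant under $x\mapsto -x$. *)

(* Defs.v *)
(* Points of R^n are row vectors 'rV[R]_n with R : realType.
   The library norm `|x| on 'rV[R]_n is the sup norm (same topology), so the
   Euclidean norm is introduced separately as enorm. *)
From HB Require Import structures.
From mathcomp Require Import all_boot all_order all_algebra.
From mathcomp Require Import all_classical all_reals all_analysis.
From mathcomp Require Import measurable_realfun ring lra.
Set Implicit Arguments.
Unset Strict Implicit.
Unset Printing Implicit Defensive.
Import Order.TTheory GRing.Theory Num.Theory.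
Import numFieldNormedType.Exports.
Local Open Scope classical_set_scope.
Local Open Scope ring_scope.

(* The product sigma-algebra on T^n, generated by the coordinate maps as for
   n.-tuple T in the library; for T = R it is the Borel sigma-algebra. *)
Definition measure_rV_display : measure_display -> measure_display.
Proof. exact. Qed.

Section measurable_rV.
Context {d} {T : sigmaRingType d} (n : nat).

Let coords (i : 'I_n) (x : 'rV[T]_n) : T := x ord0 i.

Let rV_set0 : g_sigma_preimage coords set0.
Proof. exact: sigma_algebra0. Qed.

Let rV_setC A : g_sigma_preimage coords A -> g_sigma_preimage coords (~` A).
Proof. exact: sigma_algebraC. Qed.

Let rV_bigcup (F : _^nat) : (forall i, g_sigma_preimage coords (F i)) ->
  g_sigma_preimage coords (\bigcup_i (F i)).
Proof. exact: sigma_algebra_bigcup. Qed.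

HB.instance Definition _ := @isMeasurable.Build (measure_rV_display d)
  'rV[T]_n (g_sigma_preimage coords) rV_set0 rV_setC rV_bigcup.

End measurable_rV.

Lemma measurable_coord d (T : sigmaRingType d) n (i : 'I_n) :
  measurable_fun [set: 'rV[T]_n] (fun x => x ord0 i).
Proof.
move=> _ Y mY; rewrite setTI; apply: sub_sigma_algebra => /=.
rewrite -bigcup_seq/=; exists i => /=; first by rewrite mem_index_enum.
by exists Y => //; rewrite setTI.
Qed.

Lemma measurable_fun_rVP d1 d2 (T1 : measurableType d1)
    (T2 : measurableType d2) n (f : T1 -> 'rV[T2]_n) :
  (forall i, measurable_fun [set: T1] (fun x => f x ord0 i)) ->
  measurable_fun [set: T1] f.
Proof.
move=> mf.
pose G : set (set 'rV[T2]_n) := \big[setU/set0]_(i < n)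
  preimage_set_system setT (fun x : 'rV[T2]_n => x ord0 i) measurable.
apply: (@measurability _ _ _ _ _ _ G) => //= _ [C GC <-].
move: GC; rewrite /G -bigcup_seq => -[i _ [A mA <-]].
by rewrite !setTI; have := mf i measurableT A mA; rewrite setTI.
Qed.

Fact pushforward_product_sigma_finite d1 d2 d3 (T1 : measurableType d1)
    (T2 : measurableType d2) (T3 : measurableType d3) (R : realType)
    (m1 : {sigma_finite_measure set T1 -> \bar R})
    (m2 : {sigma_finite_measure set T2 -> \bar R})
    (f : T1 * T2 -> T3) (g : T3 -> T1 * T2) :
  measurable_fun setT f -> measurable_fun setT g -> cancel f g ->
  {mu : {sigma_finite_measure set T3 -> \bar R} |
    pushforward (m1 \x m2)%E f = mu}.
Proof.
move=> mf mg fK.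
pose m : {measure set (T1 * T2)%type -> \bar R} := (m1 \x m2)%E.
pose nu0 : {measure set T3 -> \bar R} :=
  measure_function_pushforward__canonical__measure_function_Measure m mf.
have sf : sigma_finite setT nu0.
  have /sigma_finiteP[F [FT ndF Foo]] := sigma_finiteT m1.
  have /sigma_finiteP[G [GT ndG Goo]] := sigma_finiteT m2.
  exists (fun k => g @^-1` (F k `*` G k)).
    rewrite -preimage_bigcup (_ : \bigcup_k _ = setT) ?preimage_setT//.
    rewrite -subTset => -[x y] _.
    have [i _ Fx] : (\bigcup_i F i) x by rewrite -FT.
    have [j _ Gy] : (\bigcup_j G j) y by rewrite -GT.
    exists (maxn i j) => //; split => /=.
      by move: x Fx; exact/subsetPset/ndF/leq_maxl.
    by move: y Gy; exact/subsetPset/ndG/leq_maxr.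
  move=> k; have [mF Fk] := Foo k; have [mG Gk] := Goo k; split.
    by rewrite -[X in measurable X]setTI; apply: mg => //; exact: measurableX.
  rewrite /nu0/= /pushforward -comp_preimage (_ : g \o f = id); last first.
    by apply/funext => p /=; rewrite fK.
  by rewrite /m/= product_measure1E// lte_mul_pinfty// ge0_fin_numE.
pose H := @Measure_isSigmaFinite.Build _ _ _ nu0 sf.
pose nu : {sigma_finite_measure set T3 -> \bar R} :=
  HB.pack (Measure.sort nu0) (Measure.class nu0) H.
by exists nu.
Qed.

Section lebesgue_rV.
Context {R : realType}.
Local Open Scope ereal_scope.

Definition row_cons n (p : measurableTypeR R * 'rV[R]_n) : 'rV[R]_n.+1 :=
  (row_mx (const_mx p.1 : 'rV_1) p.2 : 'rV_(1 + n)).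

(* n-dimensional Lebesgue measure on Borel sets: the image of the product measure
   on R * R^k under (t, v) |-> (t, v_1, ..., v_k). *)
Fixpoint lebesgue_rV n : set 'rV[R]_n -> \bar R :=
  match n with
  | 0%N => \d_(0%R : 'rV[R]_0)
  | k.+1 => pushforward (@lebesgue_measure R \x @lebesgue_rV k) (@row_cons k)
  end.

Lemma measurable_row_cons n : measurable_fun setT (@row_cons n).
Proof.
apply: measurable_fun_rVP => i; rewrite /row_cons.
case: (@splitP 1 n i) => j ij.
  have -> : i = lshift n j by exact: val_inj.
  rewrite (_ : (fun x => _) = fst)//; apply/funext => x.
  by rewrite [LHS]row_mxEl mxE.
have -> : i = rshift 1 j by exact: val_inj.
rewrite (_ : (fun x => _) = (fun v : 'rV[R]_n => v ord0 j) \o snd).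
  by apply: measurableT_comp => //; exact: measurable_coord.
by apply/funext => x; rewrite [LHS]row_mxEr.
Qed.

Fact lebesgue_rV_sigma_finite n :
  {mu : {sigma_finite_measure set 'rV[R]_n -> \bar R} | @lebesgue_rV n = mu}.
Proof.
elim: n => [|n [mu IH]]; first by exists (\d_(0%R : 'rV[R]_0)).
pose un (v : 'rV[R]_n.+1) : measurableTypeR R * 'rV[R]_n :=
  (v ord0 ord0, rsubmx (v : 'rV_(1 + n))).
have mun : measurable_fun setT un.
  apply: measurable_fun_pair; first exact: measurable_coord.
  apply: measurable_fun_rVP => i.
  rewrite (_ : (fun x => _) = (fun x : 'rV[R]_n.+1 => x ord0 (rshift 1 i))).
    exact: measurable_coord.
  by apply/funext => x; rewrite mxE.
have unK : cancel (@row_cons n) un.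
  case=> x v; rewrite /un /row_cons/= row_mxKr; congr pair.
  have -> : ord0 = lshift n (ord0 : 'I_1) :> 'I_n.+1 by exact: val_inj.
  by rewrite [LHS]row_mxEl mxE.
have [nu e] := pushforward_product_sigma_finite (@lebesgue_measure R) mu
  (@measurable_row_cons n) mun unK.
by exists nu; rewrite /= IH; exact: e.
Qed.

Let lebesgue_rV0 n : @lebesgue_rV n set0 = 0.
Proof. by case: (lebesgue_rV_sigma_finite n) => mu ->; exact: measure0. Qed.

Let lebesgue_rV_ge0 n A : 0 <= @lebesgue_rV n A.
Proof. by case: (lebesgue_rV_sigma_finite n) => mu ->; exact: measure_ge0. Qed.

Let lebesgue_rV_semi_sigma_additive n : semi_sigma_additive (@lebesgue_rV n).
Proof.
case: (lebesgue_rV_sigma_finite n) => mu ->.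
exact: measure_semi_sigma_additive.
Qed.

HB.instance Definition _ n := isMeasure.Build _ _ _ (@lebesgue_rV n)
  (lebesgue_rV0 n) (@lebesgue_rV_ge0 n) (@lebesgue_rV_semi_sigma_additive n).

Let lebesgue_rV_sigma_finiteT n : sigma_finite setT (@lebesgue_rV n).
Proof. by case: (lebesgue_rV_sigma_finite n) => mu ->; exact: sigma_finiteT. Qed.

HB.instance Definition _ n := Measure_isSigmaFinite.Build _ _ _ (@lebesgue_rV n)
  (lebesgue_rV_sigma_finiteT n).

End lebesgue_rV.

Section euclidean.
Context {R : realType} {n : nat}.
Implicit Types (x y z : 'rV[R]_n) (a r : R) (A B : set 'rV[R]_n).

Definition dot x y : R := \sum_i x ord0 i * y ord0 i.

Definition enorm x : R := Num.sqrt (dot x x).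

Lemma dotC x y : dot x y = dot y x.
Proof. by apply: eq_bigr => i _; rewrite mulrC. Qed.

Lemma dotDl x y z : dot (x + y) z = dot x z + dot y z.
Proof. by rewrite -big_split; apply: eq_bigr => i _; rewrite !mxE mulrDl. Qed.

Lemma dotZl a x y : dot (a *: x) y = a * dot x y.
Proof. by rewrite mulr_sumr; apply: eq_bigr => i _; rewrite !mxE mulrA. Qed.

Lemma dotDr x y z : dot x (y + z) = dot x y + dot x z.
Proof. by rewrite !(dotC x) dotDl. Qed.

Lemma dotZr a x y : dot x (a *: y) = a * dot x y.
Proof. by rewrite !(dotC x) dotZl. Qed.

Lemma dot0l x : dot 0 x = 0.
Proof. by apply: big1 => i _; rewrite mxE mul0r. Qed.

Lemma dot0r x : dot x 0 = 0.
Proof. by rewrite dotC dot0l. Qed.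

Lemma dot_ge0 x : 0 <= dot x x.
Proof. by apply: sumr_ge0 => i _; rewrite -expr2 sqr_ge0. Qed.

Lemma sqr_enorm x : enorm x ^+ 2 = dot x x.
Proof. by rewrite sqr_sqrtr ?dot_ge0. Qed.

Lemma enorm_ge0 x : 0 <= enorm x.
Proof. exact: sqrtr_ge0. Qed.

Lemma normr_coord_le_enorm x i : `|x ord0 i| <= enorm x.
Proof.
rewrite -(@ler_pXn2r _ 2) ?nnegrE ?enorm_ge0// sqr_enorm real_normK ?num_real//.
rewrite /dot (bigD1 i)//= expr2 lerDl.
by apply: sumr_ge0 => j _; rewrite -expr2 sqr_ge0.
Qed.

Lemma enorm_eq0 x : enorm x = 0 -> x = 0.
Proof.
move=> x0; apply/rowP => i; rewrite mxE.
by apply/normr0_eq0/le_anti; rewrite normr_ge0 -x0 normr_coord_le_enorm.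
Qed.

Lemma enormZ a x : enorm (a *: x) = `|a| * enorm x.
Proof.
by rewrite /enorm dotZl dotZr mulrA -expr2 sqrtrM ?sqr_ge0// sqrtr_sqr.
Qed.

Lemma enorm0 : enorm 0 = 0.
Proof. by rewrite /enorm dot0l sqrtr0. Qed.

Lemma enormN x : enorm (- x) = enorm x.
Proof. by rewrite -scaleN1r enormZ normrN1 mul1r. Qed.

Lemma enormB x y : enorm (x - y) = enorm (y - x).
Proof. by rewrite -enormN opprB. Qed.

Lemma dot_le_enorm x y : dot x y <= enorm x * enorm y.
Proof.
have [/enorm_eq0->|y0] := eqVneq (enorm y) 0.
  by rewrite enorm0 mulr0 dot0r.
have yp : 0 < enorm y by rewrite lt_neqAle eq_sym y0 enorm_ge0.
have := dot_ge0 (enorm y *: x - enorm x *: y).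
have [/enorm_eq0->|x0] := eqVneq (enorm x) 0.
  by rewrite enorm0 mul0r dot0l.
have xp : 0 < enorm x by rewrite lt_neqAle eq_sym x0 enorm_ge0.
rewrite -scaleNr dotDl !dotDr !dotZl !dotZr -!sqr_enorm (dotC y x) => h.
have := mulr_gt0 xp yp; set p := enorm x in h *; set q := enorm y in h *.
move=> pq; rewrite -(ler_pM2l pq); lra.
Qed.

Lemma ler_enormD x y : enorm (x + y) <= enorm x + enorm y.
Proof.
rewrite -(@ler_pXn2r _ 2) ?nnegrE ?addr_ge0 ?enorm_ge0// sqr_enorm sqrrD.
rewrite dotDl !dotDr -!sqr_enorm (dotC y x).
have := dot_le_enorm x y; lra.
Qed.

Lemma continuous_rV (T : topologicalType) (f : T -> 'rV[R]_n) :
  (forall i, continuous (fun t => f t ord0 i)) -> continuous f.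
Proof.
move=> cf t A [P fP PA].
apply: (@filterS _ _ _ (fun s => forall i j, P i j (f s i j))); first by move=> s; exact: PA.
apply: filter_forall => i; apply: filter_forall => j.
rewrite (ord1 i); apply: cf; exact: fP.
Qed.

Lemma dot_continuous : continuous (fun x => dot x x).
Proof.
have h := (@continuous_big _ _ _ 0 xpredT (@add_continuous R) 'rV[R]_n (index_enum 'I_n) (fun i (x : 'rV[R]_n) => x ord0 i * x ord0 i)).
by apply: h => i _ x; apply: continuousM; exact: (@coord_continuous R 1 n).
Qed.

Lemma enorm_continuous : continuous enorm.
Proof.
move=> x; apply: continuous_comp; last exact: sqrt_continuous.
exact: dot_continuous.
Qed.

Definition unit_ball : set 'rV[R]_n := [set x | enorm x <= 1].

Definition unit_sphere : set 'rV[R]_n := [set x | enorm x = 1].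

Definition euclidean_ball A := exists (c : 'rV[R]_n) (r : R),
  0 < r /\ A = [set x | enorm (x - c) <= r].

Lemma closed_unit_ball : closed unit_ball.
Proof.
rewrite (_ : unit_ball = enorm @^-1` [set r | r <= 1])//.
apply: closed_comp => [x _|]; [exact: enorm_continuous|exact: closed_le].
Qed.

Lemma compact_unit_ball : compact unit_ball.
Proof.
apply: bounded_closed_compact; last exact: closed_unit_ball.
exists 1; split; first exact: num_real.
move=> M M1 x /= x1; rewrite [leLHS]/Num.norm/= mx_normrE.
apply: bigmax_le => [|[i j] _ /=]; first by rewrite ltW// (lt_trans _ M1).
by rewrite (ord1 i) (le_trans (normr_coord_le_enorm x j))// (le_trans x1)// ltW.
Qed.

Lemma convex_setP A : convex_set A <-> forall x y (t : R),
  A x -> A y -> 0 <= t -> t <= 1 -> A (t *: x + (1 - t) *: y).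
Proof.
split=> [cA x y t Ax Ay t0 t1|cA x y t].
  have := cA x y (Itv01 t0 t1); rewrite !inE; exact.
rewrite !inE => Ax Ay; apply: cA => //.
Qed.

End euclidean.
Arguments unit_ball {R n}.
Arguments unit_sphere {R n}.

Section convex_body.
Context {R : realType} {n : nat}.
Implicit Types (x y z v : 'rV[R]_n) (a r : R) (A B : set 'rV[R]_n).

Record convex_body : Type := ConvexBody {
  body_set :> set 'rV[R]_n ;
  body_nonempty : body_set !=set0 ;
  body_compact : compact body_set ;
  body_convex : convex_set body_set }.

Lemma convex_body_inj (K L : convex_body) :
  body_set K = body_set L -> K = L.
Proof.
case: K L => [A A0 cA vA] [B B0 cB vB] /= AB; subst B.
by congr ConvexBody; exact: Prop_irrelevance.
Qed.

HB.instance Definition _ := gen_eqMixin convex_body.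
HB.instance Definition _ := gen_choiceMixin convex_body.

Implicit Types K L M : convex_body.

(* A + r B^n for r >= 0. *)
Definition parallel_set A r : set 'rV[R]_n :=
  [set x | exists2 y, A y & enorm (x - y) <= r].

Definition hausdorff_bounds K L : set R := [set r | [/\ 0 <= r,
  body_set K `<=` parallel_set L r & body_set L `<=` parallel_set K r]].

Definition hausdorff_dist K L : R := inf (hausdorff_bounds K L).

Lemma convex_body_bounded K : exists r : R, forall x, body_set K x -> enorm x <= r.
Proof.
have : compact [set enorm x | x in body_set K].
  apply: continuous_compact (body_compact (c := K)).
  exact/continuous_subspaceT/enorm_continuous.
move=> /compact_bounded[r [_ Kr]]; exists (r + 1) => x Kx.
have := Kr (r + 1); rewrite ltrDl ltr01 => /(_ isT (enorm x)).
move=> /(_ (ex_intro2 _ _ _ Kx erefl)) /=.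
by rewrite ger0_norm ?enorm_ge0.
Qed.

Let hb_nonempty K L : hausdorff_bounds K L !=set0.
Proof.
have [r Kr] := convex_body_bounded K; have [s Ls] := convex_body_bounded L.
have [x Kx] := body_nonempty K; have [y Ly] := body_nonempty L.
have dist u v : enorm (u - v) <= enorm u + enorm v.
  by rewrite (le_trans (ler_enormD _ _))// enormN.
exists (r + s); split.
- by rewrite addr_ge0// (le_trans (enorm_ge0 _) (Kr _ Kx), le_trans (enorm_ge0 _) (Ls _ Ly)).
- by move=> u Ku; exists y => //; rewrite (le_trans (dist _ _))// lerD// ?Kr// Ls.
- by move=> u Lu; exists x => //; rewrite (le_trans (dist _ _))// addrC lerD// ?Kr// Ls.
Qed.

Let hb_lbound K L : lbound (hausdorff_bounds K L) 0.
Proof. by move=> r []. Qed.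

Let hb_has_inf K L : has_inf (hausdorff_bounds K L).
Proof. by split; [exact: hb_nonempty|exists 0; exact: hb_lbound]. Qed.

Let hausdorff_dist_ge0 K L : 0 <= hausdorff_dist K L.
Proof. by apply: lb_le_inf; [exact: hb_nonempty|exact: hb_lbound]. Qed.

Let hausdorff_distxx K : hausdorff_dist K K = 0.
Proof.
apply/le_anti; rewrite hausdorff_dist_ge0 andbT.
apply: ge_inf; first by exists 0; exact: hb_lbound.
by split=> // x Kx; exists x; rewrite // subrr enorm0.
Qed.

Let hausdorff_dist_sym K L : hausdorff_dist K L = hausdorff_dist L K.
Proof.
by rewrite /hausdorff_dist; congr inf; apply/seteqP; split => r [].
Qed.

Lemma parallel_set_trans A B r s t :
  A `<=` parallel_set B r -> s + r <= t -> parallel_set A s `<=` parallel_set B t.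
Proof.
move=> AB st x [y Ay xy]; have [z Bz yz] := AB _ Ay; exists z => //.
rewrite -(subrKA y) (le_trans (ler_enormD _ _))// (le_trans _ st)//.
exact: lerD.
Qed.

Let hausdorff_dist_triangle L K M :
  hausdorff_dist K M <= hausdorff_dist K L + hausdorff_dist L M.
Proof.
apply/ler_addgt0Pl => e e0; have e2 : 0 < e / 2 by rewrite divr_gt0.
have [r [r0 KL LK] rd] := inf_adherent e2 (hb_has_inf K L).
have [s [s0 LM ML] sd] := inf_adherent e2 (hb_has_inf L M).
apply: (@le_trans _ _ (r + s)).
  apply: ge_inf; first by exists 0; exact: hb_lbound.
  split; first exact: addr_ge0.
    by move=> x /KL; apply: parallel_set_trans LM _ _.
  by move=> x /ML; apply: (parallel_set_trans LK); rewrite addrC.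
rewrite -/(hausdorff_dist K L) in rd; rewrite -/(hausdorff_dist L M) in sd.
lra.
Qed.

Lemma closed_convex_body K : closed (body_set K).
Proof. by apply: compact_closed; [exact: norm_hausdorff|exact: body_compact]. Qed.

Let hausdorff_dist_sub K L : hausdorff_dist K L = 0 -> body_set K `<=` L.
Proof.
move=> KL0 x Kx; apply: closed_convex_body => B /nbhs_ballP[e /= e0 xeB].
have [r [r0 KL _]] := inf_adherent e0 (hb_has_inf K L).
rewrite -/(hausdorff_dist K L) KL0 add0r => re.
have [y Ly xy] := KL _ Kx; exists y; split => //; apply: xeB; split => // i j.
rewrite /ball/= (ord1 i) (le_lt_trans _ re)// (le_trans _ xy)//.
by rewrite (_ : x _ _ - _ = (x - y) ord0 j) ?normr_coord_le_enorm// !mxE.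
Qed.

Let hausdorff_dist_positivity K L : hausdorff_dist K L = 0 -> K = L.
Proof.
move=> KL0; apply/convex_body_inj/seteqP.
by split; apply: hausdorff_dist_sub => //; rewrite hausdorff_dist_sym.
Qed.

HB.instance Definition _ := @isMetric.Build R convex_body hausdorff_dist
  hausdorff_distxx hausdorff_dist_positivity hausdorff_dist_sym
  hausdorff_dist_triangle.

Fact unit_ball_nonempty : (@unit_ball R n) !=set0.
Proof. by exists 0; rewrite /unit_ball/= enorm0 ler01. Qed.

Fact unit_ball_convex : convex_set (@unit_ball R n).
Proof.
apply/convex_setP => x y t; rewrite /unit_ball/= => x1 y1 t0 t1.
rewrite (le_trans (ler_enormD _ _))// !enormZ !ger0_norm ?subr_ge0//.
have t1' : 0 <= 1 - t by rewrite subr_ge0.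
by rewrite -[leRHS](subrKC t) lerD// ler_piMr.
Qed.

Definition unit_ball_body : convex_body :=
  ConvexBody unit_ball_nonempty compact_unit_ball unit_ball_convex.

Fact image_nonempty K (f : 'rV[R]_n -> 'rV[R]_n) : [set f x | x in body_set K] !=set0.
Proof. by have [x Kx] := body_nonempty K; exists (f x), x. Qed.

Fact image_compact K (f : 'rV[R]_n -> 'rV[R]_n) :
  continuous f -> compact [set f x | x in body_set K].
Proof.
by move=> cf; apply: continuous_compact (body_compact (c := K)); exact: continuous_subspaceT.
Qed.

Fact image_convex K (f : 'rV[R]_n -> 'rV[R]_n) :
  (forall x y t, f (t *: x + (1 - t) *: y) = t *: f x + (1 - t) *: f y) ->
  convex_set [set f x | x in body_set K].
Proof.
move=> ft; apply/convex_setP => _ _ t [x Kx <-] [y Ky <-] t0 t1.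
exists (t *: x + (1 - t) *: y) => //.
by have /convex_setP cK := body_convex (c := K); exact: cK.
Qed.

Fact add_nonempty K L :
  [set x + y | x in body_set K & y in body_set L] !=set0.
Proof.
have [x Kx] := body_nonempty K; have [y Ly] := body_nonempty L.
by exists (x + y), x => //; exists y.
Qed.

Fact add_compact K L :
  compact [set x + y | x in body_set K & y in body_set L].
Proof.
rewrite (_ : [set _ | _ in _ & _ in _] =
    (fun z : 'rV[R]_n * 'rV[R]_n => z.1 + z.2) @` (body_set K `*` body_set L)).
  apply: continuous_compact; last first.
    by apply: compact_setX; exact: body_compact.
  by apply: continuous_subspaceT; exact: add_continuous.
apply/seteqP; split => [_ [x Kx [y Ly <-]]|_ [[x y] [/= Kx Ly] <-]].
  by exists (x, y).
by exists x => //; exists y.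
Qed.

Fact add_convex K L :
  convex_set [set x + y | x in body_set K & y in body_set L].
Proof.
apply/convex_setP => _ _ t [x Kx [y Ly <-]] [x' Kx' [y' Ly' <-]] t0 t1.
have /convex_setP cK := body_convex (c := K).
have /convex_setP cL := body_convex (c := L).
exists (t *: x + (1 - t) *: x'); first exact: cK.
exists (t *: y + (1 - t) *: y'); first exact: cL.
by rewrite !scalerDr addrACA.
Qed.

Definition minkowski_add K L : convex_body :=
  ConvexBody (add_nonempty K L) (@add_compact K L) (@add_convex K L).

Fact dilate_convex K a : convex_set [set a *: x | x in body_set K].
Proof.
apply: image_convex => x y t.
by rewrite scalerDr !scalerA mulrC (mulrC a).
Qed.

Definition dilate a K : convex_body :=
  ConvexBody (image_nonempty K _) (image_compact (@scaler_continuous _ _ a))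
    (@dilate_convex K a).

Fact rotate_continuous (Q : 'M[R]_n) :
  continuous (fun x : 'rV[R]_n => x *m Q^T).
Proof.
apply: continuous_rV => i.
rewrite (_ : (fun _ => _) = fun x : 'rV[R]_n => \sum_k x ord0 k * Q^T k i).
  have h := @continuous_big _ _ _ 0 xpredT (@add_continuous R) 'rV[R]_n
    (index_enum 'I_n) (fun k x => x ord0 k * Q^T k i).
  apply: h => k _ x; apply: continuousM; first exact: (@coord_continuous R 1 n).
  exact: cst_continuous.
by apply/funext => x; rewrite mxE.
Qed.

Fact rotate_convex K (Q : 'M[R]_n) :
  convex_set [set x *m Q^T | x in body_set K].
Proof. by apply: image_convex => x y t; rewrite mulmxDl !scalemxAl. Qed.

(* Row-vector form of x |-> Q x. *)
Definition rotate (Q : 'M[R]_n) K : convex_body :=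
  ConvexBody (image_nonempty K _) (image_compact (@rotate_continuous Q))
    (@rotate_convex K Q).

Fact translate_convex K v : convex_set [set x + v | x in body_set K].
Proof.
apply: image_convex => x y t.
by rewrite !scalerDr addrACA -scalerDl subrKC scale1r.
Qed.

Fact translate_continuous v : continuous (fun x : 'rV[R]_n => x + v).
Proof.
apply: continuous_rV => i.
rewrite (_ : (fun _ => _) = fun x : 'rV[R]_n => x ord0 i + v ord0 i).
  move=> x; apply: continuousD; first exact: (@coord_continuous R 1 n).
  exact: cst_continuous.
by apply/funext => x; rewrite mxE.
Qed.

Definition translate K v : convex_body :=
  ConvexBody (image_nonempty K _) (image_compact (@translate_continuous v))
    (@translate_convex K v).

End convex_body.
Arguments convex_body : clear implicits.
Arguments unit_ball_body {R n}.

Section spherical_measure.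
Context {R : realType} {n : nat}.
Local Open Scope ereal_scope.

(* Spherical Lebesgue measure as the cone measure
     A |-> n |{t u : 0 <= t <= 1, u in A}|   (A a Borel subset of the sphere),
   carried by the unit sphere: the origin, where 0^-1 = 0, is a null set. *)
Definition spherical_measure (A : set 'rV[R]_n) : \bar R :=
  n%:R%:E * lebesgue_rV
    (unit_ball `&` (fun x : 'rV[R]_n => (enorm x)^-1 *: x) @^-1` A).

Lemma measurable_enorm : measurable_fun [set: 'rV[R]_n] (@enorm R n).
Proof.
apply: (@measurableT_comp _ _ _ _ _ _ (@Num.sqrt R)).
  apply: continuous_measurable_fun; exact: sqrt_continuous.
by apply: measurable_sum => i; apply: measurable_funM; exact: measurable_coord.
Qed.

Lemma measurable_unit_ball : measurable (@unit_ball R n).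
Proof.
rewrite (_ : unit_ball = setT `&` @enorm R n @^-1` `]-oo, 1%R]%classic).
  by apply: measurable_enorm.
by apply/seteqP; split => x /=; rewrite in_itv/=; [|case].
Qed.

Let dir (x : 'rV[R]_n) := ((enorm x)^-1 *: x)%R.

Let mdir : measurable_fun setT dir.
Proof.
apply: measurable_fun_rVP => i.
rewrite (_ : (fun _ => _) = fun x => (enorm x `^ (-1) * x ord0 i)%R).
  apply: measurable_funM; last exact: measurable_coord.
  apply: (@measurableT_comp _ _ _ _ _ _ (@powR R ^~ (-1)%R)) => //.
  exact: measurable_enorm.
by apply/funext => x; rewrite mxE powR_inv1 ?enorm_ge0.
Qed.

Let mu : {measure set 'rV[R]_n -> \bar R} :=
  mrestr (@lebesgue_rV R n) measurable_unit_ball.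

Let nu : {measure set 'rV[R]_n -> \bar R} :=
  measure_function_pushforward__canonical__measure_function_Measure mu mdir.

Let n_ge0 : (0 <= n%:R :> R)%R := ler0n R n.

Let nu' : {measure set 'rV[R]_n -> \bar R} := mscale (NngNum n_ge0) nu.

Let nuE : spherical_measure = nu'.
Proof. by apply/funext => A; rewrite /spherical_measure setIC. Qed.

Let spherical_measure0 : spherical_measure set0 = 0.
Proof. by rewrite nuE measure0. Qed.

Let spherical_measure_ge0 A : 0 <= spherical_measure A.
Proof. by rewrite nuE measure_ge0. Qed.

Let spherical_measure_sigma_additive : semi_sigma_additive spherical_measure.
Proof. by rewrite nuE; exact: measure_semi_sigma_additive. Qed.

HB.instance Definition _ := isMeasure.Build _ _ _ spherical_measure
  spherical_measure0 spherical_measure_ge0 spherical_measure_sigma_additive.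

End spherical_measure.

Section functionals.
Context {R : realType} {n : nat}.
Implicit Types (x y z u v : 'rV[R]_n) (A : set 'rV[R]_n).
Implicit Types K L : convex_body R n.

(* The supremum is a maximum since K is non-empty and compact. *)
Definition support_fun K u : R := sup [set dot u x | x in body_set K].

Definition mean_width K : R :=
  2 / (n%:R * fine (lebesgue_rV (@unit_ball R n))) *
  \int[spherical_measure]_(u in unit_sphere) support_fun K u.

Definition polar A : set 'rV[R]_n := [set x | forall y, A y -> dot x y <= 1].

Definition polar_about A z : set 'rV[R]_n := polar [set y - z | y in A].

Definition is_santalo_point A z := A° z /\
  forall z', A° z' ->
  (lebesgue_rV (polar_about A z) <= lebesgue_rV (polar_about A z'))%E.

(* A convex body with interior points has exactly one Santalo point, which is
   then the one selected; the default value 0 is irrelevant for such bodies. *)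
Definition santalo_point A : 'rV[R]_n := xget 0 [set z | is_santalo_point A z].

Definition centrally_symmetric K :=
  exists v, dilate (-1) (translate K v) = translate K v.

Definition difference_body K : convex_body R n :=
  dilate 2^-1 (minkowski_add K (dilate (-1) K)).

Definition special_orthogonal (Q : 'M[R]_n) := Q *m Q^T = 1%:M /\ \det Q = 1.

(* continuous refers to the topology of the Hausdorff metric on convex_body R n. *)
Definition minkowski_endomorphism (Phi : convex_body R n -> convex_body R n) :=
  [/\ continuous Phi,
      forall K L, Phi (minkowski_add K L) = minkowski_add (Phi K) (Phi L),
      forall K v, Phi (translate K v) = Phi K
    & forall Q K, special_orthogonal Q -> Phi (rotate Q K) = rotate Q (Phi K)].

Definition monotone_endomorphism (Phi : convex_body R n -> convex_body R n) :=
  forall K L, body_set K `<=` body_set L -> body_set (Phi K) `<=` body_set (Phi L).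

End functionals.

(* Main.v *)
(* On the span D of the support functions, h_K |-> h_{Phi K} extends to a positive
   linear operator T that commutes with rotations, fixes constants and kills
   linear functions; this replaces the representation of Phi by a zonal measure.
   D contains h_K^-n when 0 is interior to K, because the convex function x^-n is
   the supremum of its tangents.  Hence Jensen's inequality
   (T h_K)^-n <= T (h_K^-n) holds pointwise on the sphere.  T preserves integrals
   over the sphere, since suitable averages of rotated copies of K are almost
   balls, so integrating the inequality in polar coordinates bounds the volume of
   the polar body of Phi K by that of the polar body of K - z for every interior
   point z.  The lower bound is Jensen's inequality for the mean over the sphere.

   If equality holds on the right, T |h_K - h_{Phi K}(u)| vanishes at u for every
   u: the functional g |-> T g u lives on latitudes about u where h_K is constant.
   If K is not a ball, every latitude other than the poles is excluded, and what
   remains is g |-> (g u + g (-u)) / 2, so that Phi is the difference body. *)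
Require Import Defs.
From mathcomp Require Import all_boot all_order all_algebra.
From mathcomp Require Import all_classical all_reals all_analysis.
From mathcomp Require Import measurable_realfun ring lra.
Set Implicit Arguments.
Unset Strict Implicit.
Unset Printing Implicit Defensive.
Import Order.TTheory GRing.Theory Num.Theory.
Import numFieldNormedType.Exports.
Local Open Scope classical_set_scope.
Local Open Scope ring_scope.

(** Averages over SO(n) are finite throughout: some finite family of rotations makes the mean of a
    Lipschitz function constant up to eps, and each conclusion is first an inequality up to a
    multiple of eps. The hypothesis n >= 3 enters through rotations with prescribed images of two
    vectors: a wrong determinant is corrected by reflecting along a third, orthogonal direction.
    Rotations therefore act transitively on pairs of unit vectors with given inner product, that is,
    on latitudes. T is available only on D, so each function fed to it has to be exhibited as a
    difference of support functions. This is why, in the equality case, the quadratic gap above a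
    tangent is bounded below by lines in |h_K - a|. Equality on the left forces h_{Phi K} to be
    constant, a ball about the origin, whereas the theorem speaks of any ball; hence a lemma that
    Phi never produces an off-centre ball. On the right, the polar volume about a point that is not
    interior is infinite, so the bound holds at whatever point [santalo_point] selects; in the
    equality cases the bound itself shows that the centre of K is a minimiser. *)

Local Notation h := support_fun.

(** * Support functions *)

Section support_function.
Context {R : realType} {n : nat}.
Implicit Types (x y z u v : 'rV[R]_n) (K L : convex_body R n).

Lemma dotNl x y : dot (- x) y = - dot x y.
Proof. by rewrite -scaleN1r dotZl mulN1r. Qed.

Lemma dotNr x y : dot x (- y) = - dot x y.
Proof. by rewrite dotC dotNl dotC. Qed.

Lemma dotBl x y z : dot (x - y) z = dot x z - dot y z.
Proof. by rewrite dotDl dotNl. Qed.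

Lemma dotBr x y z : dot x (y - z) = dot x y - dot x z.
Proof. by rewrite dotDr dotNr. Qed.

Lemma dot_enorm x : dot x x = enorm x ^+ 2.
Proof. by rewrite sqr_enorm. Qed.

Lemma dot_mulmx x y (Q : 'M[R]_n) : dot (x *m Q) y = dot x (y *m Q^T).
Proof.
have dotE a b : dot a b = (a *m b^T) ord0 ord0.
  by rewrite mxE; apply: eq_bigr => i _; rewrite mxE.
by rewrite !dotE trmx_mul trmxK mulmxA.
Qed.

Lemma dot_delta i x : dot (delta_mx ord0 i) x = x ord0 i.
Proof.
rewrite /dot (bigD1 i)//= big1 ?mxE ?eqxx ?mul1r ?addr0//.
by move=> j ji; rewrite mxE (negbTE ji) andbF mul0r.
Qed.

Lemma enorm_delta i : enorm (delta_mx ord0 i : 'rV[R]_n) = 1.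
Proof. by rewrite /enorm dot_delta mxE !eqxx sqrtr1. Qed.

Lemma dot_linear_continuous u : continuous (dot u).
Proof.
have H := @continuous_big _ _ _ 0 xpredT (@add_continuous R) 'rV[R]_n
  (index_enum 'I_n) (fun i (x : 'rV[R]_n) => u ord0 i * x ord0 i).
apply: H => i _ x; apply: continuousM; first exact: cst_continuous.
exact: (@coord_continuous R 1 n).
Qed.

Lemma support_attained K u : exists2 x, body_set K x & h K u = dot u x.
Proof.
have [c cK cmax] := EVT_max_rV (body_nonempty K) (@body_compact _ _ K)
  (continuous_subspaceT (@dot_linear_continuous u)).
move: cK; rewrite inE => cK; exists c => //; apply/le_anti/andP; split.
  apply: ge_sup; first by exists (dot u c), c.
  by move=> _ [y Ky <-]; apply: cmax; rewrite inE.
apply: ub_le_sup; last by exists c.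
by exists (dot u c) => _ [y Ky <-]; apply: cmax; rewrite inE.
Qed.

Lemma support_ge K u x : body_set K x -> dot u x <= h K u.
Proof.
move=> Kx; apply: ub_le_sup; last by exists x.
have [r Kr] := convex_body_bounded K.
exists (enorm u * r) => _ [y Ky <-].
by rewrite (le_trans (dot_le_enorm _ _))// ler_wpM2l ?enorm_ge0// Kr.
Qed.

Lemma support_le K u (a : R) : (forall x, body_set K x -> dot u x <= a) -> h K u <= a.
Proof. by move=> Ka; have [x Kx ->] := support_attained K u; exact: Ka. Qed.

Lemma support_mono K L u : body_set K `<=` body_set L -> h K u <= h L u.
Proof. by move=> KL; apply: support_le => x /KL; exact: support_ge. Qed.

Lemma support_add K L u : h (minkowski_add K L) u = h K u + h L u.
Proof.
apply/le_anti/andP; split.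
  by apply: support_le => _ [x Kx [y Ly <-]]; rewrite dotDr lerD// support_ge.
have [x Kx ->] := support_attained K u; have [y Ly ->] := support_attained L u.
by rewrite -dotDr; apply: support_ge; exists x => //; exists y.
Qed.

Lemma support_image (f : 'rV[R]_n -> 'rV[R]_n) K L u v :
  body_set L = [set f x | x in body_set K] -> (forall x, dot u (f x) = dot v x) ->
  h L u = h K v.
Proof.
move=> LE ufv; rewrite /support_fun LE; congr (sup _); apply/seteqP; split.
  by move=> _ [_ [x Kx <-] <-]; exists x.
by move=> _ [x Kx <-]; exists (f x) => //; exists x.
Qed.

Lemma support_dilate a K u : h (dilate a K) u = h K (a *: u).
Proof. by apply: support_image => // x; rewrite dotZl dotZr. Qed.

Lemma support_rotate Q K u : h (rotate Q K) u = h K (u *m Q).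
Proof. by apply: support_image => // x; rewrite dot_mulmx. Qed.

Lemma support_translate K v u : h (translate K v) u = h K u + dot u v.
Proof.
apply/le_anti/andP; split.
  by apply: support_le => _ [x Kx <-]; rewrite dotDr lerD// support_ge.
have [x Kx ->] := support_attained K u.
by rewrite -dotDr; apply: support_ge; exists x.
Qed.

Lemma supportZ K a u : 0 <= a -> h K (a *: u) = a * h K u.
Proof.
move=> a0; apply/le_anti/andP; split.
  by apply: support_le => x Kx; rewrite dotZl ler_wpM2l// support_ge.
have [x Kx ->] := support_attained K u.
by rewrite -dotZl; exact: support_ge.
Qed.

Lemma support0 K : h K 0 = 0.
Proof. by rewrite -[0 : 'rV__](scale0r 0) supportZ// mul0r. Qed.

Lemma support_dilate_ge0 a K u : 0 <= a -> h (dilate a K) u = a * h K u.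
Proof. by move=> a0; rewrite support_dilate supportZ. Qed.

Lemma support_subadd K u v : h K (u + v) <= h K u + h K v.
Proof. by apply: support_le => x Kx; rewrite dotDl lerD// support_ge. Qed.

Lemma support_ball u : h unit_ball_body u = enorm u.
Proof.
apply/le_anti/andP; split.
  apply: support_le => x x1; rewrite (le_trans (dot_le_enorm _ _))//.
  by rewrite ler_piMr ?enorm_ge0.
have [/enorm_eq0->|u0] := eqVneq (enorm u) 0; first by rewrite enorm0 support0.
have -> : enorm u = dot u ((enorm u)^-1 *: u).
  by rewrite dotZr -sqr_enorm expr2 mulKf.
apply: support_ge; rewrite /= /unit_ball /= enormZ ger0_norm ?invr_ge0 ?enorm_ge0//.
by rewrite mulVf.
Qed.

Lemma support_le_enorm K (r : R) u :
  (forall x, body_set K x -> enorm x <= r) -> h K u <= r * enorm u.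
Proof.
move=> Kr; apply: support_le => x Kx.
by rewrite (le_trans (dot_le_enorm _ _))// mulrC ler_wpM2r ?enorm_ge0// Kr.
Qed.

Lemma polarE K : polar K = [set x | h K x <= 1].
Proof.
apply/seteqP; split => x /=; first exact: support_le.
by move=> Kx y Ky; rewrite (le_trans (support_ge _ Ky)).
Qed.

Lemma support_lipschitz K : exists2 r : R, 0 <= r &
  forall u v, `|h K u - h K v| <= r * enorm (u - v).
Proof.
have [r Kr] := convex_body_bounded K; exists r.
  by have [x /Kr] := body_nonempty K; apply: le_trans; exact: enorm_ge0.
move=> u v; have := support_subadd K (u - v) v; have := support_subadd K (v - u) u.
rewrite !subrK => h1 h2.
have := support_le_enorm (u - v) Kr; have := support_le_enorm (v - u) Kr.
rewrite (enormB v) ler_distl => h3 h4; apply/andP; split; lra.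
Qed.

Lemma nearest_point K z : exists2 y, body_set K y &
  forall x, body_set K x -> dot (z - y) (x - y) <= 0.
Proof.
have cf : continuous (fun x => dot (x - z) (x - z)).
  move=> x; apply: (@continuous_comp _ _ _ (fun x => x - z) (fun y => dot y y)).
    exact: translate_continuous.
  exact: dot_continuous.
have [y yK ymin] := EVT_min_rV (body_nonempty K) (@body_compact _ _ K)
  (continuous_subspaceT cf).
move: yK; rewrite inE => Ky; exists y => // x Kx.
have /convex_setP cK := @body_convex _ _ K.
(* Minimality along the segment from y to x. *)
have H t : 0 <= t <= 1 ->
    0 <= t * (- 2 * dot (z - y) (x - y) + t * dot (x - y) (x - y)).
  case/andP=> t0 t1; have := ymin (t *: x + (1 - t) *: y).
  rewrite inE => /(_ (cK _ _ _ Kx Ky t0 t1)).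
  have -> : t *: x + (1 - t) *: y - z = t *: (x - y) - (z - y).
    by apply/rowP => i; rewrite !mxE; ring.
  have -> : y - z = - (z - y) by rewrite opprB.
  rewrite dotNl dotNr opprK !(dotBl (t *: _)) !(dotBr _ (t *: _)) !dotZl !dotZr.
  rewrite (dotC (x - y) (z - y)); lra.
rewrite leNgt; apply/negP => p0.
set p := dot (z - y) (x - y) in p0 H; set q := dot _ _ in H.
have q0 : 0 <= q by exact: dot_ge0.
have pq : 0 < p + q by lra.
(* For this [t] the bracket in [H] is [- 2 * p + p * q / (p + q) <= - p < 0]. Dividing by [p + q]
   keeps [t <= 1] and allows [q = 0]. *)
have t0 : 0 < p / (p + q) by rewrite divr_gt0.
have t1 : 0 <= p / (p + q) <= 1.
  by rewrite (ltW t0)/= ler_pdivrMr// mul1r lerDl.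
have := H _ t1; rewrite pmulr_rge0// [_ * q]mulrAC => H'.
have : p * q / (p + q) <= p.
  by rewrite ler_pdivrMr// ler_wpM2l ?lerDr// ltW.
lra.
Qed.

(** A point outside [K] is separated from [K] by the direction leading to it from its nearest
    point. *)
Lemma body_set_support K x :
  body_set K x <-> forall u, enorm u = 1 -> dot u x <= h K u.
Proof.
split=> [Kx u _|Kx]; first exact: support_ge.
have [y Ky yP] := nearest_point K x.
have [/eqP|xy] := eqVneq (enorm (x - y)) 0.
  by move=> /eqP /enorm_eq0/eqP; rewrite subr_eq0 => /eqP ->.
have xy0 : 0 < enorm (x - y) by rewrite lt_neqAle eq_sym xy enorm_ge0.
have := Kx ((enorm (x - y))^-1 *: (x - y)).
rewrite enormZ ger0_norm ?invr_ge0 ?enorm_ge0// mulVf// => /(_ erefl).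
rewrite supportZ ?dotZl ?invr_ge0 ?enorm_ge0// ler_pM2l ?invr_gt0// => H.
have : h K (x - y) <= dot (x - y) y.
  by apply: support_le => z /yP; rewrite dotBr subr_le0.
move=> H2; have : dot (x - y) (x - y) <= 0 by rewrite dotBr; lra.
by rewrite dot_enorm leNgt exprn_gt0.
Qed.

Lemma support_subset K L :
  (forall u, enorm u = 1 -> h K u <= h L u) -> body_set K `<=` body_set L.
Proof.
move=> KL x Kx; apply/body_set_support => u u1.
by rewrite (le_trans (support_ge _ Kx))// KL.
Qed.

Lemma support_inj K L : (forall u, enorm u = 1 -> h K u = h L u) -> K = L.
Proof.
move=> KL; apply/convex_body_inj/seteqP.
by split; apply: support_subset => u /KL ->.
Qed.

End support_function.

(** Additivity settles integer multiples; monotonicity traps [N.+1%:R * f t] between consecutive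
    multiples of [f 1], so the deviation from linearity is at most [f 1 / N.+1%:R]. It serves to
    show that [Phi] commutes with dilations. *)
Lemma additive_nondecreasing_linear (R : realType) (f : R -> R) :
  (forall s t, 0 <= s -> 0 <= t -> f (s + t) = f s + f t) ->
  (forall s t, 0 <= s -> s <= t -> f s <= f t) ->
  forall t, 0 <= t -> f t = t * f 1.
Proof.
move=> fD fM t t0.
have f0 : f 0 = 0 by have := fD 0 0 (lexx _) (lexx _); rewrite addr0; lra.
have fn s (k : nat) : 0 <= s -> f (k%:R * s) = k%:R * f s.
  move=> s0; elim: k => [|k IH]; first by rewrite !mul0r.
  by rewrite -natr1 mulrDl mul1r fD ?mulr_ge0 ?ler0n// IH; ring.
have f1 : 0 <= f 1 by rewrite -f0 fM.
have key N : `|N.+1%:R * (f t - t * f 1)| <= f 1.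
  have tN : 0 <= N.+1%:R * t by rewrite mulr_ge0.
  have /andP[k1 k2] := Num.Theory.truncn_itv tN; set k := Num.truncn _ in k1 k2.
  have h1 : k%:R * f 1 <= N.+1%:R * f t.
    by rewrite -!fn// mulr1 fM// ler0n.
  have h2 : N.+1%:R * f t <= k.+1%:R * f 1.
    by rewrite -!fn// mulr1 fM// ltW.
  have h3 : k%:R * f 1 <= N.+1%:R * t * f 1 by rewrite ler_wpM2r.
  have h4 : N.+1%:R * t * f 1 <= k.+1%:R * f 1 by rewrite ler_wpM2r// ltW.
  move: h2 h4; rewrite -(natr1 k) ler_norml => h2 h4; apply/andP; split; lra.
apply/eqP; rewrite -subr_eq0 -normr_le0 leNgt; apply/negP => d0.
set d := `|_| in d0.
have [N NP] : exists N : nat, f 1 / d < N.+1%:R.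
  by exists (Num.truncn (f 1 / d)); exact: Num.Theory.truncnS_gt.
have := key N; rewrite normrM ger0_norm// -/d leNgt.
by rewrite ltr_pdivrMr// in NP; rewrite NP.
Qed.

Lemma le_of_forall_scaled_eps (R : realType) (x c : R) :
  (forall e, 0 < e -> x <= e * c) -> x <= 0.
Proof.
move=> xe; apply/ler_addgt0Pl => e e0; rewrite addr0.
have := xe (e / (`|c| + 1)); rewrite divr_gt0 ?ltr_wpDl// => /(_ isT) H.
rewrite (le_trans H)// mulrAC ler_pdivrMr ?ltr_wpDl// ler_wpM2l ?(ltW e0)//.
by have := ler_norm c; lra.
Qed.

(** * Bodies with a prescribed support function; differences of support functions *)

Section sup_body.
Context {R : realType} {n : nat}.

(* The body with support function p is the intersection of the halfspaces
   {x | u.x <= p u}; no separation argument is needed because p is a pointwise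
   maximum of support functions of bodies inscribed in it. *)
Lemma body_of_support (p : 'rV[R]_n -> R) : (0 < n)%N ->
  (forall u, enorm u = 1 -> exists N : convex_body R n,
    (forall v, enorm v = 1 -> h N v <= p v) /\ h N u = p u) ->
  exists M : convex_body R n, forall u, enorm u = 1 -> h M u = p u.
Proof.
move=> n0 pP.
pose M := [set x : 'rV[R]_n | forall u, enorm u = 1 -> dot u x <= p u].
have sub N : (forall v, enorm v = 1 -> h N v <= p v) -> body_set N `<=` M.
  by move=> Np x Nx u u1; rewrite (le_trans (support_ge _ Nx))// Np.
have M0 : M !=set0.
  have [N [Np _]] := pP _ (enorm_delta (Ordinal n0)).
  by have [x Nx] := body_nonempty N; exists x; exact: sub Np _ Nx.
have Mc : compact M.
  apply: bounded_closed_compact.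
    (* The half-spaces whose normals are plus and minus the basis vectors bound every coordinate. *)
    exists (\sum_i (`|p (delta_mx ord0 i)| + `|p (- delta_mx ord0 i)|)).
    split; first exact: num_real.
    move=> r rP x Mx /=; rewrite [leLHS]/Num.norm/= mx_normrE.
    have r0 : 0 <= r.
      by rewrite (le_trans _ (ltW rP))// sumr_ge0// => i _; rewrite addr_ge0.
    apply: bigmax_le => // -[i j] _ /=; rewrite (ord1 i).
    apply: le_trans (ltW rP); rewrite (bigD1 j)//=.
    have : 0 <= \sum_(i < n | i != j)
        (`|p (delta_mx ord0 i)| + `|p (- delta_mx ord0 i)|).
      by rewrite sumr_ge0// => k _; rewrite addr_ge0.
    have := Mx _ (enorm_delta j); have := Mx (- delta_mx ord0 j).
    rewrite enormN enorm_delta dotNl dot_delta => /(_ erefl).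
    have := ler_norm (p (delta_mx ord0 j)); have := ler_norm (p (- delta_mx ord0 j)).
    have := normr_ge0 (p (delta_mx ord0 j)); have := normr_ge0 (p (- delta_mx ord0 j)).
    rewrite ler_norml => *; apply/andP; split; lra.
  rewrite (_ : M = \bigcap_(u in [set u | enorm u = 1]) dot u @^-1` [set r | r <= p u]).
    apply: closed_bigI => u _; apply: closed_comp; last exact: closed_le.
    by move=> x _; exact: dot_linear_continuous.
  by apply/seteqP; split.
have Mv : convex_set M.
  apply/convex_setP => x y t Mx My t0 t1 u u1.
  rewrite dotDr !dotZr -[leRHS](subrKC t) -[X in _ <= X]addrC.
  have := Mx _ u1; have := My _ u1 => h1 h2.
  have : t * dot u x <= t * p u by rewrite ler_wpM2l.
  have : (1 - t) * dot u y <= (1 - t) * p u by rewrite ler_wpM2l// subr_ge0.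
  lra.
exists (ConvexBody M0 Mc Mv) => u u1; apply/le_anti/andP; split.
  by apply: support_le => x /=; exact.
have [N [Np <-]] := pP _ u1.
by apply: support_mono; exact: sub.
Qed.

End sup_body.

Section support_differences.
Context {R : realType} {n : nat}.
Implicit Types (g f : 'rV[R]_n -> R) (K L A B : convex_body R n).

(** Only values on the unit sphere count; this admits constants and negative powers of support
    functions, which are not homogeneous of degree 1. *)
Definition support_diff_of A B g :=
  forall u, enorm u = 1 -> g u = h A u - h B u.

Definition support_diff g := exists A B, support_diff_of A B g.

Lemma support_diff_ext g f : (forall u, enorm u = 1 -> g u = f u) ->
  support_diff g -> support_diff f.
Proof. by move=> gf [A [B AB]]; exists A, B => u u1; rewrite -gf// AB. Qed.

Definition origin_body : convex_body R n := dilate 0 unit_ball_body.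

Lemma support_origin u : h origin_body u = 0.
Proof. by rewrite support_dilate scale0r support0. Qed.

Lemma support_diff_support K : support_diff (h K).
Proof. by exists K, origin_body => u _; rewrite support_origin subr0. Qed.

Lemma support_diffD g f : support_diff g -> support_diff f ->
  support_diff (fun u => g u + f u).
Proof.
move=> [A [B AB]] [C [D CD]]; exists (minkowski_add A C), (minkowski_add B D).
by move=> u u1; rewrite AB// CD// !support_add; ring.
Qed.

Lemma support_diffN g : support_diff g -> support_diff (fun u => - g u).
Proof. by move=> [A [B AB]]; exists B, A => u u1; rewrite AB// opprB. Qed.

Lemma support_diffB g f : support_diff g -> support_diff f ->
  support_diff (fun u => g u - f u).
Proof. by move=> gd fd; apply: support_diffD => //; exact: support_diffN. Qed.

Lemma support_diffZ a g : support_diff g -> support_diff (fun u => a * g u).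
Proof.
wlog a0 : a / 0 <= a => [H gd|[A [B AB]]].
  have [a0|/ltW a0] := leP 0 a; first exact: H.
  apply: (@support_diff_ext (fun u => - ((- a) * g u))) => [u _|]; first ring.
  by apply: support_diffN; apply: H => //; rewrite oppr_ge0.
by exists (dilate a A), (dilate a B) => u u1; rewrite AB// !support_dilate_ge0//; ring.
Qed.

Lemma support_diff_cst (c : R) : support_diff (fun=> c).
Proof.
apply: (@support_diff_ext (fun u => c * h unit_ball_body u)).
  by move=> u u1; rewrite support_ball u1 mulr1.
by apply: support_diffZ; exact: support_diff_support.
Qed.

Lemma support_diff_dot w : support_diff (dot w).
Proof.
apply: (@support_diff_ext (h (translate origin_body w))).
  by move=> u _; rewrite support_translate support_origin add0r dotC.
exact: support_diff_support.
Qed.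

Lemma support_diff_sum (I : Type) (s : seq I) (G : I -> 'rV[R]_n -> R) :
  (forall i, support_diff (G i)) -> support_diff (fun u => \sum_(i <- s) G i u).
Proof.
move=> Gd; elim: s => [|i s IH].
  by apply: support_diff_ext (support_diff_cst 0) => u _; rewrite big_nil.
apply: support_diff_ext (support_diffD (Gd i) IH) => u _.
by rewrite big_cons.
Qed.

Lemma support_diff_rot (Q : 'M[R]_n) g : Q *m Q^T = 1%:M ->
  support_diff g -> support_diff (fun u => g (u *m Q)).
Proof.
move=> QQ [A [B AB]]; exists (rotate Q A), (rotate Q B) => u u1.
rewrite !support_rotate AB//; rewrite -u1 /enorm dot_mulmx -mulmxA QQ mulmx1//.
Qed.

(** [|a - b| = 2 max(a, b) - (a + b)], and a maximum of two support functions is again a support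
    function: at each [u] it is realised by [A] or by [B]. *)
Lemma support_diff_norm g : (0 < n)%N -> support_diff g ->
  support_diff (fun u => `|g u|).
Proof.
move=> n0 [A [B AB]].
have [u u1|M MP] := @body_of_support R n
    (fun u => 2 * Num.max (h A u) (h B u)) n0.
  have [BA|AB'] := leP (h B u) (h A u).
    exists (dilate 2 A); split => [v v1|]; rewrite support_dilate_ge0//.
    by rewrite ler_pM2l// le_max lexx.
  exists (dilate 2 B); split => [v v1|]; rewrite support_dilate_ge0//.
  by rewrite ler_pM2l// le_max lexx orbT.
exists M, (minkowski_add A B) => u u1.
rewrite MP// AB// support_add; have [BA|BA] := leP (h B u) (h A u).
  by rewrite ger0_norm ?subr_ge0//; ring.
by rewrite ltr0_norm ?subr_lt0//; ring.
Qed.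

Lemma support_diff_lipschitz g : support_diff g -> exists2 r : R, 0 <= r &
  forall u v, enorm u = 1 -> enorm v = 1 -> `|g u - g v| <= r * enorm (u - v).
Proof.
move=> [A [B AB]]; have [r r0 rP] := support_lipschitz A.
have [s s0 sP] := support_lipschitz B; exists (r + s); first exact: addr_ge0.
move=> u v u1 v1; rewrite !AB//.
have -> : h A u - h B u - (h A v - h B v) = (h A u - h A v) - (h B u - h B v).
  by ring.
by rewrite (le_trans (ler_normB _ _))// mulrDl lerD.
Qed.

End support_differences.

Lemma minkowski_add_subset (R : realType) (n : nat) (A B C D : convex_body R n) :
  (forall u, enorm u = 1 -> h A u + h B u <= h C u + h D u) ->
  body_set (minkowski_add A B) `<=` body_set (minkowski_add C D).
Proof.
by move=> H; apply: support_subset => u u1; rewrite !support_add H.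
Qed.

(** * The linear extension of a Minkowski endomorphism *)

Section endomorphism.
Context {R : realType} {n : nat} (Phi : convex_body R n -> convex_body R n).
Implicit Types (g f : 'rV[R]_n -> R) (K L A B : convex_body R n).
Context (PhiD : forall K L,
  Phi (minkowski_add K L) = minkowski_add (Phi K) (Phi L)).
Context (PhiT : forall K v, Phi (translate K v) = Phi K).
Context (PhiR : forall Q K,
  special_orthogonal Q -> Phi (rotate Q K) = rotate Q (Phi K)).
Context (Phi_mono : monotone_endomorphism Phi).
Context (PhiB : Phi unit_ball_body = unit_ball_body).

(** A translate [L] of [K] that contains the origin has nested dilates, so
    [t |-> h (Phi (dilate t L)) u] is additive and nondecreasing, hence linear. *)
Lemma support_endo_dilate a K u : 0 <= a ->
  h (Phi (dilate a K)) u = a * h (Phi K) u.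
Proof.
move=> a0; have [x Kx] := body_nonempty K.
have K0 v : 0 <= h (translate K (- x)) v.
  by rewrite support_translate dotNr subr_ge0 support_ge.
rewrite -(PhiT K (- x)) -(PhiT (dilate a K) (a *: - x)).
have -> : translate (dilate a K) (a *: - x) = dilate a (translate K (- x)).
  apply: support_inj => v v1.
  rewrite !(support_translate, support_dilate_ge0)// dotZr; ring.
set L := translate _ _ in K0 *.
have dilate1 : dilate 1 L = L.
  by apply: support_inj => v v1; rewrite support_dilate scale1r.
rewrite -[in RHS]dilate1.
apply: (@additive_nondecreasing_linear R (fun t => h (Phi (dilate t L)) u)) => //.
  move=> s t s0 t0; rewrite -support_add -PhiD; congr (h (Phi _) u).
  apply: support_inj => v v1.
  by rewrite support_add !support_dilate_ge0 ?addr_ge0// mulrDl.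
move=> s t s0 st; apply: support_mono; apply: Phi_mono; apply: support_subset => v v1.
by rewrite !support_dilate_ge0 ?(le_trans s0 st)// ler_wpM2r.
Qed.

(* The linear extension of h_K |-> h_{Phi K} to differences of support functions,
   where the value does not depend on the representation g = h_A - h_B; for any
   other g the value is the meaningless 0. *)
Definition endo_fun g u : R := xget 0 [set x | exists A B,
  support_diff_of A B g /\ x = h (Phi A) u - h (Phi B) u].

Lemma endo_funE A B g u : support_diff_of A B g ->
  endo_fun g u = h (Phi A) u - h (Phi B) u.
Proof.
move=> AB; rewrite /endo_fun; case: xgetP => [_ _ /= [C [D [CD ->]]]|H].
  have : minkowski_add A D = minkowski_add C B.
    apply: support_inj => v v1; have := AB v v1; rewrite CD// !support_add; lra.
  move=> /(congr1 (fun K => h (Phi K) u)); rewrite !PhiD !support_add; lra.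
by exfalso; apply: (H (h (Phi A) u - h (Phi B) u)); exists A, B.
Qed.

Lemma support_endo_origin u : h (Phi origin_body) u = 0.
Proof. by rewrite support_endo_dilate// mul0r. Qed.

Lemma endo_fun_support K u : endo_fun (h K) u = h (Phi K) u.
Proof.
rewrite (@endo_funE K origin_body) ?support_endo_origin ?subr0//.
by move=> v _; rewrite support_origin subr0.
Qed.

Lemma support_diff_endo g : support_diff g -> support_diff (endo_fun g).
Proof.
by move=> [A [B AB]]; exists (Phi A), (Phi B) => u _; exact: endo_funE.
Qed.

(** Moving the subtracted terms across turns [g <= f] into an inclusion of Minkowski sums, to which
    monotonicity of [Phi] applies. *)
Lemma le_endo_fun g f u : support_diff g -> support_diff f ->
  (forall v, enorm v = 1 -> g v <= f v) -> endo_fun g u <= endo_fun f u.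
Proof.
move=> [A [B AB]] [C [D CD]] gf; rewrite (endo_funE u AB) (endo_funE u CD).
have : body_set (minkowski_add A D) `<=` body_set (minkowski_add C B).
  apply: minkowski_add_subset => v v1; have := gf v v1; rewrite AB// CD//; lra.
move=> /Phi_mono/(support_mono u); rewrite !PhiD !support_add; lra.
Qed.

Lemma eq_endo_fun g f u : support_diff g ->
  (forall v, enorm v = 1 -> g v = f v) -> endo_fun g u = endo_fun f u.
Proof.
move=> gd gf; have fd := support_diff_ext gf gd.
by apply/le_anti/andP; split; apply: le_endo_fun => // v v1; rewrite gf.
Qed.

Lemma endo_funD g f u : support_diff g -> support_diff f ->
  endo_fun (fun v => g v + f v) u = endo_fun g u + endo_fun f u.
Proof.
move=> [A [B AB]] [C [D CD]].
rewrite (@endo_funE (minkowski_add A C) (minkowski_add B D)).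
  by rewrite (endo_funE u AB) (endo_funE u CD) !PhiD !support_add; ring.
by move=> v v1; rewrite AB// CD// !support_add; ring.
Qed.

Lemma endo_funN g u : support_diff g ->
  endo_fun (fun v => - g v) u = - endo_fun g u.
Proof.
move=> [A [B AB]]; rewrite (@endo_funE B A) ?(endo_funE u AB) ?opprB//.
by move=> v v1; rewrite AB// opprB.
Qed.

Lemma endo_funB g f u : support_diff g -> support_diff f ->
  endo_fun (fun v => g v - f v) u = endo_fun g u - endo_fun f u.
Proof.
move=> gd fd; rewrite endo_funD//; last exact: support_diffN.
by rewrite endo_funN.
Qed.

Lemma endo_funZ a g u : support_diff g ->
  endo_fun (fun v => a * g v) u = a * endo_fun g u.
Proof.
wlog a0 : a / 0 <= a => [H gd|[A [B AB]]].
  have [a0|/ltW a0] := leP 0 a; first exact: H.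
  rewrite -[a in RHS]opprK mulNr -H ?oppr_ge0// -endo_funN; last exact: support_diffZ.
  apply: eq_endo_fun; first exact: support_diffZ.
  by move=> v v1; rewrite mulNr opprK.
rewrite (@endo_funE (dilate a A) (dilate a B)).
  by rewrite (endo_funE u AB) !support_endo_dilate//; ring.
by move=> v v1; rewrite AB// !support_dilate_ge0//; ring.
Qed.

(** On the sphere, [c] agrees with [c] times the support function of the unit ball. The factor
    [enorm u] appears because [endo_fun g] is homogeneous in [u] even when [g] is not. *)
Lemma endo_fun_cst (c : R) u : endo_fun (fun=> c) u = c * enorm u.
Proof.
rewrite -support_ball -PhiB -endo_fun_support.
rewrite -endo_funZ; last exact: support_diff_support.
apply: eq_endo_fun; first exact: support_diff_cst.
by move=> v v1; rewrite support_ball v1 mulr1.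
Qed.

Lemma endo_fun_dot w u : endo_fun (dot w) u = 0.
Proof.
rewrite -(support_endo_origin u) -(PhiT _ w) -endo_fun_support.
apply: eq_endo_fun; first exact: support_diff_dot.
by move=> v _; rewrite support_translate support_origin add0r dotC.
Qed.

Lemma endo_fun_sum (I : Type) (s : seq I) (G : I -> 'rV[R]_n -> R) u :
  (forall i, support_diff (G i)) ->
  endo_fun (fun v => \sum_(i <- s) G i v) u = \sum_(i <- s) endo_fun (G i) u.
Proof.
move=> Gd; elim: s => [|i s IH].
  rewrite big_nil -[RHS](mul0r (enorm u)) -endo_fun_cst.
  apply: eq_endo_fun; first exact: support_diff_sum.
  by move=> v _; rewrite big_nil.
rewrite big_cons -IH -endo_funD//; last exact: support_diff_sum.
apply: eq_endo_fun; first exact: support_diff_sum.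
by move=> v _; rewrite big_cons.
Qed.

Lemma endo_fun_rot Q g u : special_orthogonal Q -> support_diff g ->
  endo_fun (fun v => g (v *m Q)) u = endo_fun g (u *m Q).
Proof.
move=> SQ [A [B AB]]; rewrite (@endo_funE (rotate Q A) (rotate Q B)).
  by rewrite (endo_funE _ AB) !PhiR// !support_rotate.
move=> v v1; rewrite AB ?support_rotate//.
by rewrite -v1 /enorm dot_mulmx -mulmxA; case: SQ => -> _; rewrite mulmx1.
Qed.

End endomorphism.

(** * Rotations *)

(** Sylvester's determinant identity, from two block triangular factorisations of one matrix; it
    reduces the determinant of a reflection to a 1 by 1 determinant. *)
Lemma det_1_sub_mulmx (R : comUnitRingType) m n (b : 'M[R]_(m, n)) (a : 'M[R]_(n, m)) :
  \det (1%:M - b *m a) = \det (1%:M - a *m b).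
Proof.
transitivity (\det (block_mx 1%:M b a 1%:M : 'M[R]_(m + n))).
  have -> : block_mx 1%:M b a 1%:M =
      block_mx 1%:M b 0 1%:M *m block_mx (1%:M - b *m a) 0 a 1%:M :> 'M[R]_(m + n).
    rewrite mulmx_block !(mul0mx, mulmx0, mul1mx, mulmx1, add0r, addr0).
    by rewrite subrK.
  by rewrite det_mulmx det_ublock det_lblock !det1 !mul1r mulr1.
have -> : block_mx 1%:M b a 1%:M =
    block_mx 1%:M 0 a 1%:M *m block_mx 1%:M b 0 (1%:M - a *m b) :> 'M[R]_(m + n).
  rewrite mulmx_block !(mul0mx, mulmx0, mul1mx, mulmx1, add0r, addr0).
  by rewrite addrC subrK.
by rewrite det_mulmx det_ublock det_lblock !det1 !mul1r.
Qed.

Section rotations.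
Context {R : realType} {n : nat}.
Implicit Types (x y z u v w : 'rV[R]_n) (Q P S : 'M[R]_n).

Lemma dotE x y : dot x y = (x *m y^T) ord0 ord0.
Proof. by rewrite mxE; apply: eq_bigr => i _; rewrite mxE. Qed.

Lemma dot_isometry Q x y : Q *m Q^T = 1%:M -> dot (x *m Q) (y *m Q) = dot x y.
Proof. by move=> QQ; rewrite dot_mulmx -mulmxA QQ mulmx1. Qed.

Lemma enorm_isometry Q x : Q *m Q^T = 1%:M -> enorm (x *m Q) = enorm x.
Proof. by move=> QQ; rewrite /enorm dot_isometry. Qed.

Lemma special_orthogonal1 : special_orthogonal (1%:M : 'M[R]_n).
Proof. by split; rewrite ?det1// trmx1 mulmx1. Qed.

Lemma special_orthogonalM Q P : special_orthogonal Q -> special_orthogonal P ->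
  special_orthogonal (Q *m P).
Proof.
move=> [QQ dQ] [PP dP]; split; last by rewrite det_mulmx dQ dP mulr1.
by rewrite trmx_mul mulmxA -(mulmxA Q) PP mulmx1.
Qed.

Lemma special_orthogonalV Q : special_orthogonal Q -> special_orthogonal Q^T.
Proof.
by move=> [QQ dQ]; split; rewrite ?det_tr// trmxK; exact: mulmx1C.
Qed.

Definition reflection w : 'M[R]_n := 1%:M - (2 / dot w w) *: (w^T *m w).

Lemma mul_reflection w x : x *m reflection w = x - (2 * dot x w / dot w w) *: w.
Proof.
rewrite mulmxBr mulmx1 -scalemxAr mulmxA [x *m w^T]mx11_scalar -dotE.
by rewrite mul_scalar_mx scalerA; congr (_ - _ *: _); ring.
Qed.

Lemma dot_eq0 w : (dot w w == 0) = (w == 0).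
Proof.
apply/eqP/eqP => [|->]; last exact: dot0l.
by move=> w0; apply: enorm_eq0; rewrite /enorm w0 sqrtr0.
Qed.

Lemma reflection_orthogonal w : w != 0 -> reflection w *m (reflection w)^T = 1%:M.
Proof.
move=> w0; have ww : dot w w != 0 by rewrite dot_eq0.
have -> : (reflection w)^T = reflection w.
  by rewrite /reflection linearB/= linearZ/= trmx1 trmx_mul trmxK.
apply/row_matrixP => i; rewrite row_mul [row i (reflection w)]rowE !mul_reflection row1.
set d := delta_mx _ _; rewrite dotBl dotZl -addrA -opprD -scalerDl -[RHS]subr0.
congr (_ - _); apply/eqP; rewrite scaler_eq0; apply/orP; left; apply/eqP.
by field.
Qed.

Lemma det_reflection w : w != 0 -> \det (reflection w) = -1.
Proof.
move=> w0; have ww : dot w w != 0 by rewrite dot_eq0.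
rewrite /reflection scalemxAl det_1_sub_mulmx det_mx11 -scalemxAr.
by rewrite [w *m w^T]mx11_scalar -dotE !mxE eqxx !mulr1n mulfVK//; ring.
Qed.

(** The reflection in the hyperplane orthogonal to [x - y], or the identity if [x = y]. *)
Lemma orthogonal_swap x y : enorm x = enorm y -> exists Q, [/\ Q *m Q^T = 1%:M,
  x *m Q = y & forall z, dot z (x - y) = 0 -> z *m Q = z].
Proof.
move=> xy; have [<-|nxy] := eqVneq x y.
  by exists 1%:M; split; rewrite ?trmx1 ?mulmx1// => z _; rewrite mulmx1.
have w0 : x - y != 0 by rewrite subr_eq0.
have ww : dot (x - y) (x - y) != 0 by rewrite dot_eq0.
exists (reflection (x - y)); split; first exact: reflection_orthogonal.
  rewrite mul_reflection (_ : 2 * _ / _ = 1) ?scale1r; first by rewrite opprB addrC subrK.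
  have -> : 2 * dot x (x - y) = dot (x - y) (x - y); last by rewrite divff.
  rewrite !(dotBl, dotBr) (dotC y x) !dot_enorm xy; ring.
by move=> z z0; rewrite mul_reflection z0 mulr0 mul0r scale0r subr0.
Qed.

Lemma exists_orthogonal x y : (3 <= n)%N -> exists2 w, enorm w = 1 &
  dot w x = 0 /\ dot w y = 0.
Proof.
move=> n3; pose A : 'M[R]_(n, 1 + 1) := row_mx x^T y^T.
have kA : kermx A != 0.
  rewrite -mxrank_eq0 mxrank_ker -lt0n subn_gt0.
  by rewrite (leq_ltn_trans (rank_leq_col _)).
have /rowV0Pn[w /sub_kermxP wA w0] := kA.
have w1 : enorm w != 0 by apply: contra_neq w0 => /enorm_eq0.
move: wA; rewrite /A mul_mx_row -row_mx0 => /eq_row_mx[wx wy].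
exists ((enorm w)^-1 *: w).
  by rewrite enormZ ger0_norm ?invr_ge0 ?enorm_ge0// mulVf.
by rewrite !dotZl !dotE wx wy !mxE mulr0.
Qed.

(** One swap takes [x] to [u]; a second takes the image of [y] to [v] and fixes [u], which is
    orthogonal to the difference because the inner products agree. If the product has determinant
    -1, a reflection along a vector orthogonal to [u] and [v] corrects it; such a vector exists by
    [3 <= n]. *)
Lemma rotation_pair x y u v : (3 <= n)%N ->
  enorm x = enorm u -> enorm y = enorm v -> dot x y = dot u v ->
  exists Q, [/\ special_orthogonal Q, x *m Q = u & y *m Q = v].
Proof.
move=> n3 xu yv xyuv.
have [Q [QQ Qx _]] := orthogonal_swap xu.
have yQ : enorm (y *m Q) = enorm v by rewrite enorm_isometry.
have [P [PP Py Pf]] := orthogonal_swap yQ.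
have Pu : u *m P = u.
  by apply: Pf; rewrite dotBr -[in X in X - _]Qx dot_isometry// xyuv subrr.
have QP : (Q *m P) *m (Q *m P)^T = 1%:M.
  by rewrite trmx_mul mulmxA -(mulmxA Q) PP mulmx1.
have dx : x *m (Q *m P) = u by rewrite mulmxA Qx Pu.
have dy : y *m (Q *m P) = v by rewrite mulmxA Py.
have : \det (Q *m P) ^+ 2 = 1.
  by have := congr1 determinant QP; rewrite det_mulmx det_tr det1 -expr2.
move=> /eqP; rewrite sqrf_eq1 => /orP[/eqP d1|/eqP d1].
  by exists (Q *m P).
have [w w1 [wu wv]] := exists_orthogonal u v n3.
have w0 : w != 0.
  by apply/eqP => w0; move: w1; rewrite w0 enorm0 => /eqP; rewrite eq_sym oner_eq0.
exists (Q *m P *m reflection w); split.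
- split; last by rewrite det_mulmx d1 det_reflection// mulrNN mulr1.
  by rewrite trmx_mul mulmxA -(mulmxA (Q *m P)) reflection_orthogonal// mulmx1.
- by rewrite mulmxA dx mul_reflection dotC wu mulr0 mul0r scale0r subr0.
- by rewrite mulmxA dy mul_reflection dotC wv mulr0 mul0r scale0r subr0.
Qed.

Lemma rotation_transitive x y : (3 <= n)%N -> enorm x = enorm y ->
  exists2 Q, special_orthogonal Q & x *m Q = y.
Proof.
move=> n3 xy; have dxy : dot x x = dot y y by rewrite !dot_enorm xy.
by have [Q [SQ Qx _]] := rotation_pair n3 xy xy dxy; exists Q.
Qed.

End rotations.

(** * Nets of rotations and finite averages over them *)

Section averaging.
Context {R : realType} {n : nat}.
Implicit Types (x y z u v w : 'rV[R]_n) (Q P S D : 'M[R]_n) (G : 'M[R]_n -> R).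

(** Right multiplication by an orthogonal matrix leaves this norm unchanged, so right translates of
    a Lipschitz function keep its constant; left multiplication costs a factor [n]. *)
Definition row_norm D : R := \sum_i enorm (row i D).

Lemma ler_enorm_sum (I : Type) (s : seq I) (F : I -> 'rV[R]_n) :
  enorm (\sum_(i <- s) F i) <= \sum_(i <- s) enorm (F i).
Proof.
elim: s => [|i s IH]; first by rewrite !big_nil enorm0.
by rewrite !big_cons (le_trans (ler_enormD _ _))// lerD2l.
Qed.

Lemma enorm_mulmx v D : enorm (v *m D) <= enorm v * row_norm D.
Proof.
rewrite mulmx_sum_row (le_trans (ler_enorm_sum _ _))// mulr_sumr ler_sum// => i _.
by rewrite enormZ ler_wpM2r ?enorm_ge0// normr_coord_le_enorm.
Qed.

Lemma row_norm_mulr D Q : Q *m Q^T = 1%:M -> row_norm (D *m Q) = row_norm D.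
Proof. by move=> QQ; apply: eq_bigr => i _; rewrite row_mul enorm_isometry. Qed.

Lemma enorm_row Q i : Q *m Q^T = 1%:M -> enorm (row i Q) = 1.
Proof.
by move=> QQ; rewrite rowE enorm_isometry// enorm_delta.
Qed.

Lemma ler_sum_cst (F : 'I_n -> R) (d : R) : (forall i, F i <= d) ->
  \sum_i F i <= n%:R * d.
Proof.
move=> Fd; rewrite (le_trans (ler_sum _ (fun i _ => Fd i)))//.
by rewrite sumr_const card_ord mulr_natl.
Qed.

Lemma row_norm_mull D Q : Q *m Q^T = 1%:M -> row_norm (Q *m D) <= n%:R * row_norm D.
Proof.
move=> QQ; apply: ler_sum_cst => i.
by rewrite row_mul (le_trans (enorm_mulmx _ _))// enorm_row// mul1r.
Qed.

Lemma row_norm_le_entries D (d : R) : (forall i j, `|D i j| <= d) ->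
  row_norm D <= n%:R * (n%:R * d).
Proof.
move=> Dd; apply: ler_sum_cst => i.
rewrite [row i D]row_sum_delta (le_trans (ler_enorm_sum _ _))//.
apply: ler_sum_cst => j.
by rewrite enormZ enorm_delta mulr1 mxE.
Qed.

End averaging.

Section averaging_over_rotations.
Context {R : realType} {n : nat}.
Implicit Types (x y z u v w : 'rV[R]_n) (Q P T D : 'M[R]_n) (G : 'M[R]_n -> R).

Lemma sumr_const_seq (I : Type) (s : seq I) (x : R) :
  \sum_(i <- s) x = x * (size s)%:R.
Proof.
by elim: s => [|i s IH]; rewrite ?big_nil ?mulr0// big_cons IH -natr1; ring.
Qed.

Lemma rotation_entry_le Q i j : special_orthogonal Q -> `|Q i j| <= 1.
Proof.
move=> [QQ _]; rewrite -(enorm_row i QQ).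
by have := normr_coord_le_enorm (row i Q) j; rewrite mxE.
Qed.

Lemma truncn_dist (a b : R) : 0 <= a -> 0 <= b ->
  Num.truncn a = Num.truncn b -> `|a - b| <= 1.
Proof.
move=> a0 b0 ab; have /andP[a1 a2] := Num.Theory.truncn_itv a0.
have /andP[b1 b2] := Num.Theory.truncn_itv b0.
move: a1 a2; rewrite ab -natr1 => a1 a2; move: b2; rewrite -natr1 => b2.
by rewrite ler_norml; apply/andP; split; lra.
Qed.

(** Rotations are coded by their entries rounded to a grid of mesh [e]. There are finitely many
    codes, and equal codes mean entries within [e] of each other. One rotation is picked per code,
    the identity for a code that no rotation has. *)
Lemma rotation_net (d : R) : 0 < d -> exists F : seq 'M[R]_n,
  [/\ F != [::], forall Q, Q \in F -> special_orthogonal Q &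
    forall Q, special_orthogonal Q -> exists2 P, P \in F & row_norm (P - Q) <= d].
Proof.
move=> d0; pose e := d / (n.+1%:R * n.+1%:R).
have n10 : 0 < n.+1%:R :> R by rewrite ltr0Sn.
have e0 : 0 < e by rewrite divr_gt0// mulr_gt0.
pose N := Num.truncn (2 / e).
pose code Q : 'M['I_N.+1]_n := \matrix_(i, j) inord (Num.truncn ((Q i j + 1) / e)).
pose f (c : 'M['I_N.+1]_n) := xget 1%:M [set Q | special_orthogonal Q /\ code Q = c].
exists [seq f c | c <- enum 'M['I_N.+1]_n]; split.
- have : f (code 0) \in [seq f c | c <- enum 'M['I_N.+1]_n].
    by apply: map_f; rewrite mem_enum.
  by case: [seq _ | _ <- _].
- move=> Q /mapP[c _ ->]; rewrite /f.
  by case: xgetP => [P _ []//|_]; exact: special_orthogonal1.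
move=> Q SQ; exists (f (code Q)); first by apply: map_f; rewrite mem_enum.
rewrite /f; case: xgetP => [P _ [SP cPQ]|/(_ Q)]; last by case.
have pe (U : 'M[R]_n) i j : special_orthogonal U -> 0 <= (U i j + 1) / e <= 2 / e.
  move=> ST; have := rotation_entry_le i j ST; rewrite ler_norml => /andP[h1 h2].
  by rewrite divr_ge0 ?(ltW e0)//= ?ler_pM2r ?invr_gt0//; lra.
have entry i j : `|(P - Q) i j| <= e.
  have /andP[p1 p2] := pe _ i j SP; have /andP[q1 q2] := pe _ i j SQ.
  have := congr1 (fun c : 'M['I_N.+1]_n => val (c i j)) cPQ; rewrite /= !mxE !inordK.
  - move=> /(truncn_dist p1 q1); rewrite -mulrBl opprD addrACA subrr addr0.
    by rewrite normrM (ger0_norm (_ : 0 <= e^-1)) ?invr_ge0 ?(ltW e0)// ler_pdivrMr// mul1r.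
  - by rewrite ltnS; apply: Num.Theory.le_truncn.
  - by rewrite ltnS; apply: Num.Theory.le_truncn.
apply: (le_trans (row_norm_le_entries entry)).
rewrite /e mulrA -natrM mulrCA ler_piMr ?(ltW d0)// -natrM.
by rewrite ler_pdivrMr ?ltr0n ?muln_gt0// mul1r ler_nat leq_mul.
Qed.

Definition rotation_lipschitz G := exists2 c : R, 0 <= c &
  forall Q P, special_orthogonal Q -> special_orthogonal P ->
    `|G Q - G P| <= c * row_norm (Q - P).

Lemma rotation_lipschitz_bounded G : rotation_lipschitz G ->
  exists2 b, 0 <= b & forall Q, special_orthogonal Q -> `|G Q| <= b.
Proof.
move=> [c c0 Gc]; exists (`|G 1%:M| + c * (n%:R * (n%:R * 2))).
  by rewrite addr_ge0// !mulr_ge0.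
move=> Q SQ; rewrite -lerBlDl (le_trans (lerB_dist _ _))//.
rewrite (le_trans (Gc _ _ SQ special_orthogonal1))// ler_wpM2l//.
apply: row_norm_le_entries => i j; rewrite !mxE (le_trans (ler_normB _ _))//.
have -> : 2 = 1 + 1 :> R by rewrite -natr1.
by rewrite lerD ?rotation_entry_le//; case: eqP; rewrite ?normr1 ?normr0.
Qed.

Definition rotations (s : seq 'M[R]_n) :=
  s != [::] /\ forall Q, Q \in s -> special_orthogonal Q.

Definition rotation_mean (s : seq 'M[R]_n) G Q : R :=
  (\sum_(T <- s) G (Q *m T)) / (size s)%:R.

Lemma rotations_size_gt0 s : rotations s -> 0 < (size s)%:R :> R.
Proof. by case; case: s. Qed.

Lemma rotationsM s t : rotations s -> rotations t ->
  rotations [seq Q *m P | Q <- t, P <- s].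
Proof.
move=> [s0 sS] [t0 tS]; split.
  by rewrite -size_eq0 size_allpairs muln_eq0 !size_eq0 negb_or t0.
by move=> _ /allpairsP[[Q P] /= [Qt Ps ->]]; apply: special_orthogonalM; [exact: tS|exact: sS].
Qed.

Lemma rotation_meanM s t G Q :
  rotation_mean [seq T *m P | T <- t, P <- s] G Q =
  rotation_mean t (rotation_mean s G) Q.
Proof.
rewrite /rotation_mean big_allpairs_dep size_allpairs natrM invfM mulrA mulrAC.
congr (_ / _); rewrite mulr_suml; apply: eq_bigr => T _; congr (_ / _).
by apply: eq_bigr => P _; rewrite mulmxA.
Qed.

Lemma rotation_mean_le s G Q (M : R) : rotations s -> special_orthogonal Q ->
  (forall P, special_orthogonal P -> G P <= M) -> rotation_mean s G Q <= M.
Proof.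
move=> rs SQ GM; rewrite ler_pdivrMr ?rotations_size_gt0//.
rewrite -sumr_const_seq !big_seq ler_sum// => P Ps.
by apply: GM; apply: special_orthogonalM => //; exact: rs.2.
Qed.

Lemma rotation_meanN s G Q :
  rotation_mean s (fun P => - G P) Q = - rotation_mean s G Q.
Proof. by rewrite /rotation_mean sumrN mulNr. Qed.

Lemma rotation_mean_dist s G Q (m e : R) : rotations s -> special_orthogonal Q ->
  (forall P, special_orthogonal P -> `|G P - m| <= e) ->
  `|rotation_mean s G Q - m| <= e.
Proof.
move=> rs SQ GM; rewrite ler_distl; apply/andP; split.
  rewrite -[leRHS]opprK -rotation_meanN lerNr opprB.
  apply: rotation_mean_le => // P SP; have := GM _ SP; rewrite ler_distl => /andP[]; lra.
by apply: rotation_mean_le => // P SP; have := GM _ SP; rewrite ler_distl => /andP[].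
Qed.

Lemma rotation_lipschitz_mean s G : rotations s -> rotation_lipschitz G ->
  rotation_lipschitz (rotation_mean s G).
Proof.
move=> rs [c c0 Gc]; exists c => // Q P SQ SP.
rewrite /rotation_mean -mulrBl normrM [X in _ * X]ger0_norm ?invr_ge0//.
rewrite ler_pdivrMr ?rotations_size_gt0// -sumrB.
rewrite (le_trans (ler_norm_sum _ _ _))// -sumr_const_seq.
rewrite !big_seq ler_sum// => T Ss; have SS := rs.2 _ Ss.
rewrite (le_trans (Gc _ _ _ _)) ?ler_wpM2l//; try exact: special_orthogonalM.
by rewrite -mulmxBl row_norm_mulr//; case: SS.
Qed.

(* Among all averages of translates of G take one whose maximum is almost
   minimal.  Were its oscillation large, averaging it once more over a net of
   rotations would lower the maximum by a definite amount. *)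
Lemma rotation_mean_almost_constant G (e : R) : rotation_lipschitz G -> 0 < e ->
  exists s, rotations s /\ exists m, forall Q, special_orthogonal Q ->
    `|rotation_mean s G Q - m| <= e.
Proof.
move=> Glip e0; have [c c0 Gc] := Glip.
(* With this mesh the mean changes by at most [e / 2] between [Q] and a nearby [P *m T]: the
   Lipschitz constant costs [c] and left multiplication by [P] costs [n]. *)
have d0 : 0 < e / (2 * (c + 1) * n.+1%:R).
  by rewrite divr_gt0// mulr_gt0// mulr_gt0//; lra.
have [F [F0 FS Fnet]] := rotation_net d0.
have rF : rotations F by [].
pose N : R := (size F)%:R.
have N1 : 1 <= N by rewrite ler1n lt0n size_eq0.
have N0 : 0 < N by lra.
pose X := [set M | exists2 s, rotations s &
  forall Q, special_orthogonal Q -> rotation_mean s G Q <= M].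
have [b b0 Gb] := rotation_lipschitz_bounded Glip.
have infX : has_inf X.
  split.
    exists b, F => // Q SQ; apply: rotation_mean_le => // P SP.
    by have := Gb _ SP; rewrite ler_norml => /andP[].
  exists (- b) => M [s rs sM].
  have Gb0 P : special_orthogonal P -> `|G P - 0| <= b by move=> /Gb; rewrite subr0.
  have := rotation_mean_dist rs special_orthogonal1 Gb0.
  rewrite subr0 ler_norml => /andP[h1 _]; apply: (le_trans h1).
  by apply: sM; exact: special_orthogonal1.
(* If the mean at [Q] were below [m - e], then for each [P] one of the [N] terms of the net average
   would be at most [M - e / 2] and the others at most [M]. The average would be at most
   [M - e / (2 * N)], which is below the infimum once [M] is this close to it. *)
have eta0 : 0 < e / (2 * N) by rewrite divr_gt0// mulr_gt0.
have [M [s rs sM] Ms] := inf_adherent eta0 infX.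
set m := inf X in Ms; exists s; split => //; exists m => Q SQ.
have mM : m <= M by apply: ge_inf; [case: infX|exists s].
have etae : e / (2 * N) <= e / 2.
  by rewrite ler_pdivrMr ?mulr_gt0// mulrA divfK// ler_peMr// ltW.
rewrite ler_distl; apply/andP; split; last first.
  by rewrite (le_trans (sM _ SQ))//; lra.
rewrite leNgt; apply/negP => Qm.
suff : inf X <= M - e / (2 * N) by rewrite -/m; lra.
apply: ge_inf; first by case: infX.
exists [seq T *m P | T <- F, P <- s]; first exact: rotationsM.
move=> P SP; rewrite rotation_meanM.
have [T SF SQP] := Fnet _ (special_orthogonalM (special_orthogonalV SP) SQ).
have SS := FS _ SF.
have near : rotation_mean s G (P *m T) <= rotation_mean s G Q + e / 2.
  rewrite -lerBlDl.
  have SPS := special_orthogonalM SP SS.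
  have SPQ : special_orthogonal (P *m (P^T *m Q)).
    by rewrite mulmxA; case: SP => -> _; rewrite mul1mx.
  have PPQ : P *m (P^T *m Q) = Q by rewrite mulmxA; case: SP => -> _; rewrite mul1mx.
  have dist : row_norm (P *m T - Q) <= n%:R * (e / (2 * (c + 1) * n.+1%:R)).
    rewrite -PPQ -mulmxBr (le_trans (row_norm_mull _ _))//; first by case: SP.
    by rewrite ler_wpM2l.
  rewrite (le_trans (ler_norm _))// /rotation_mean -mulrBl normrM.
  rewrite [X in _ * X]ger0_norm ?invr_ge0//.
  rewrite ler_pdivrMr ?rotations_size_gt0// -sumrB.
  rewrite (le_trans (ler_norm_sum _ _ _))// -sumr_const_seq.
  rewrite !big_seq ler_sum// => U Ts; have ST := rs.2 _ Ts.
  rewrite (le_trans (Gc _ _ _ _)) //; try exact: special_orthogonalM.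
  rewrite -mulmxBl row_norm_mulr; last by case: ST.
  rewrite (le_trans (ler_wpM2l c0 dist))//.
  rewrite (_ : c * _ = (c / (c + 1)) * (n%:R / n.+1%:R) * (e / 2)); last first.
    by field; rewrite -?natr1; do ?[split]; rewrite gt_eqF//; have := ler0n R n; lra.
  rewrite ler_piMl//; first by lra.
  rewrite mulr_ile1 ?divr_ge0//; try lra.
    by rewrite ler_pdivrMr; lra.
  by rewrite ler_pdivrMr ?ltr0Sn// mul1r ler_nat.
rewrite /(rotation_mean F) ler_pdivrMr -/N//.
have -> : (M - e / (2 * N)) * N = (M - e / 2) + (N - 1) * M by field; rewrite gt_eqF.
rewrite (perm_big _ (perm_to_rem SF)) big_cons lerD//; first lra.
have -> : N - 1 = (size (rem T F))%:R.
  by rewrite size_rem// /N -subn1 natrB// lt0n size_eq0.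
rewrite mulrC -sumr_const_seq !big_seq ler_sum// => U /mem_rem TF.
by apply: sM; apply: special_orthogonalM => //; exact: FS.
Qed.

(** A further average cannot spoil a mean that is already constant up to [e], so the functions are
    treated one after the other. *)
Lemma rotation_means_almost_constant (Gs : seq ('M[R]_n -> R)) (e : R) :
  (forall G, G \in Gs -> rotation_lipschitz G) -> 0 < e ->
  exists s, rotations s /\ forall G, G \in Gs -> exists m, forall Q,
    special_orthogonal Q -> `|rotation_mean s G Q - m| <= e.
Proof.
move=> + e0; elim: Gs => [|G Gs IH] Glip.
  exists [:: 1%:M]; split => //; split => // Q; rewrite inE => /eqP ->.
  exact: special_orthogonal1.
have [|s [rs sP]] := IH; first by move=> H HG; apply: Glip; rewrite inE HG orbT.
have Gl : rotation_lipschitz (rotation_mean s G).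
  by apply: rotation_lipschitz_mean => //; apply: Glip; rewrite inE eqxx.
have [t [rt [m tP]]] := rotation_mean_almost_constant Gl e0.
exists [seq T *m P | T <- t, P <- s]; split; first exact: rotationsM.
move=> H; rewrite inE => /orP[/eqP ->|/sP[m' m'P]].
  by exists m => Q SQ; rewrite rotation_meanM tP.
by exists m' => Q SQ; rewrite rotation_meanM; exact: rotation_mean_dist.
Qed.

End averaging_over_rotations.

(** * Lebesgue measure under linear maps *)

Section lebesgue_invariance.
Context {R : realType}.

Lemma lebesgue_measure_shift (a : R) (A : set (measurableTypeR R)) :
  measurable A -> lebesgue_measure ((fun x => x + a) @^-1` A) = lebesgue_measure A.
Proof.
move=> mA; have mf : measurable_fun [set: measurableTypeR R]
    (fun x : R => x + a : measurableTypeR R).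
  exact: measurable_funD.
pose mu : {measure set (measurableTypeR R) -> \bar R} :=
  measure_function_pushforward__canonical__measure_function_Measure
    (@lebesgue_measure R) mf.
apply/esym; apply: (@lebesgue_measure_unique R mu) => // _ [[b c] _ <-].
rewrite /mu /= /pushforward.
rewrite (_ : (fun x => x + a) @^-1` _ = `]b - a, c - a]%classic); last first.
  by apply/seteqP; split => x /=; rewrite !in_itv/= ltrBlDr lerBrDr.
rewrite !lebesgue_measure_itv/= !lte_fin ltrD2r; case: ifP => // _.
by rewrite -!EFinB; congr EFin; ring.
Qed.

Lemma row_cons_add n (t s : R) (x y : 'rV[R]_n) :
  row_cons (t, x) + row_cons (s, y) = row_cons (t + s, x + y) :> 'rV[R]_n.+1.
Proof.
rewrite /row_cons/=; apply: (etrans (@add_row_mx _ 1 1 n _ _ _ _)).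
congr (@row_mx _ 1 1 n _ _); by apply/rowP => i; rewrite !mxE.
Qed.

Lemma row_cons_surj n (v : 'rV[R]_n.+1) :
  v = row_cons (v ord0 ord0, rsubmx (v : 'rV_(1 + n))).
Proof.
rewrite /row_cons/=; apply: (etrans (esym (@hsubmxK _ 1 1 n v))).
congr (@row_mx _ 1 1 n _ _).
by apply/rowP => i; rewrite !mxE (ord1 i); congr (v _ _); exact: val_inj.
Qed.

Lemma row_consP n (t : R) (x : 'rV[R]_n) (P : R -> Prop) :
  (forall i, P (row_cons (t, x) ord0 i)) <-> P t /\ forall i, P (x ord0 i).
Proof.
have E0 : row_cons (t, x) ord0 ord0 = t.
  rewrite /row_cons (_ : ord0 = lshift n (ord0 : 'I_1)); last exact: val_inj.
  by rewrite [LHS]row_mxEl mxE.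
have E1 i : row_cons (t, x) ord0 (rshift 1 i) = x ord0 i.
  by rewrite [LHS]row_mxEr.
split=> [H|[Pt Px] i].
  by split=> [|i]; [rewrite -E0|rewrite -E1].
case: (@splitP 1 n i) => j ij.
  have -> : i = ord0 by apply: val_inj; rewrite /= ij (ord1 j).
  by rewrite E0.
have -> : i = rshift 1 j by exact: val_inj.
by rewrite E1.
Qed.

Lemma measurable_add_rV n (v : 'rV[R]_n) :
  measurable_fun [set: 'rV[R]_n] (fun x => x + v).
Proof.
apply: measurable_fun_rVP => i.
rewrite (_ : (fun x => _) = fun x : 'rV[R]_n => x ord0 i + v ord0 i).
  by apply: measurable_funD => //; exact: measurable_coord.
by apply/funext => x; rewrite mxE.
Qed.

Lemma measurable_mulmx_rV n (P : 'M[R]_n) :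
  measurable_fun [set: 'rV[R]_n] (fun x => x *m P).
Proof.
apply: measurable_fun_rVP => i.
rewrite (_ : (fun x => _) = fun x : 'rV[R]_n => \sum_k x ord0 k * P k i).
  apply: measurable_sum => k; apply: measurable_funM => //; exact: measurable_coord.
by apply/funext => x; rewrite mxE.
Qed.

Lemma measurable_preimage d1 d2 (T1 : measurableType d1) (T2 : measurableType d2)
  (f : T1 -> T2) (A : set T2) : measurable_fun setT f -> measurable A ->
  measurable (f @^-1` A).
Proof. by move=> mf mA; rewrite -[X in measurable X]setTI; exact: mf. Qed.

Lemma lebesgue_rV_shift n (v : 'rV[R]_n) (A : set 'rV[R]_n) : measurable A ->
  lebesgue_rV ((fun x => x + v) @^-1` A) = lebesgue_rV A.
Proof.
elim: n v A => [|n IH] v A mA.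
  by congr (lebesgue_rV _); apply/seteqP; split => x; rewrite /= [x + v]thinmx0 [x]thinmx0.
rewrite /lebesgue_rV -/(@lebesgue_rV R n) /pushforward.
set m := (_ \x _)%E.
pose s := v ord0 ord0; pose w := rsubmx (v : 'rV_(1 + n)).
pose f (p : measurableTypeR R * 'rV[R]_n) := (p.1 + s : measurableTypeR R, p.2 + w).
have mf : measurable_fun [set: measurableTypeR R * 'rV[R]_n] f.
  apply: measurable_fun_pair.
    apply: (@measurableT_comp _ _ _ _ _ _
      (fun t : measurableTypeR R => t + s : measurableTypeR R) _ fst) => //.
    exact: measurable_funD.
  apply: (@measurableT_comp _ _ _ _ _ _ (fun x : 'rV[R]_n => x + w) _ snd) => //.
  exact: measurable_add_rV.
have -> : @row_cons R n @^-1` ((fun x => x + v) @^-1` A) =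
    f @^-1` (@row_cons R n @^-1` A).
  apply/seteqP; split => -[t x] /=; rewrite /f/= -row_cons_add -row_cons_surj//.
pose m' : {measure set (measurableTypeR R * 'rV[R]_n) -> \bar R} :=
  (@lebesgue_measure R \x @lebesgue_rV R n)%E.
pose mu : {measure set (measurableTypeR R * 'rV[R]_n) -> \bar R} :=
  measure_function_pushforward__canonical__measure_function_Measure m' mf.
apply/esym; apply: (@product_measure_unique _ _ _ _ R (@lebesgue_measure R)
  (@lebesgue_rV R n) mu).
  move=> B C mB mC; rewrite /mu /= /pushforward.
  rewrite (_ : f @^-1` _ =
    ((fun x => x + s) @^-1` B) `*` ((fun x => x + w) @^-1` C)); last first.
    by apply/seteqP; split => -[].
  rewrite /m' product_measure1E.
  - by congr (_ * _)%E; [exact: lebesgue_measure_shift|exact: IH].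
  - by apply: measurable_preimage => //; exact: measurable_funD.
  - by apply: measurable_preimage => //; exact: measurable_add_rV.
by apply: measurable_preimage => //; exact: measurable_row_cons.
Qed.

Definition box n (a b : R) : set 'rV[R]_n := [set x | forall i, a <= x ord0 i <= b].

Lemma measurable_box n (a b : R) : measurable (@box n a b).
Proof.
rewrite (_ : box a b = \bigcap_(i in [set: 'I_n])
    (fun x : 'rV[R]_n => x ord0 i) @^-1` `[a, b]%classic).
  apply: fin_bigcap_measurable => // i _.
  by apply: measurable_preimage => //; exact: measurable_coord.
by apply/seteqP; split => [x xab i _|x xab i]; have := xab i; rewrite /= in_itv/=; auto.
Qed.

Lemma lebesgue_box n (a b : R) : a <= b -> lebesgue_rV (@box n a b) = ((b - a) ^+ n)%:E.
Proof.
move=> ab; elim: n => [|n IH].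
  by rewrite /= diracE mem_set// => -[].
rewrite /lebesgue_rV -/(@lebesgue_rV R n) /pushforward.
rewrite (_ : _ @^-1` _ = `[a, b]%classic `*` @box n a b).
  transitivity (lebesgue_measure `[a, b]%classic * lebesgue_rV (@box n a b))%E.
    by apply: product_measure1E => //; exact: measurable_box.
  rewrite IH lebesgue_measure_itv/= lte_fin; case: ltP => [_|ba].
    by rewrite -EFinB -EFinM exprS.
  by rewrite (le_anti (introT andP (conj ab ba))) subrr mul0e expr0n.
apply/seteqP; split => -[t x] /=; rewrite /box /=.
  by move=> /(row_consP t x (fun z => a <= z <= b)) [].
by move=> ?; apply/(row_consP t x (fun z => a <= z <= b)).
Qed.

(* Tonelli's theorem for {(x, y) | x in A, x + yP in B}, whose sections in one
   direction are translates of the preimage of B, in the other of -A. *)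
Lemma lebesgue_rV_mulmx_exchange n (P Q : 'M[R]_n) (A B : set 'rV[R]_n) :
  Q *m P = 1%:M -> measurable A -> measurable B ->
  (lebesgue_rV A * lebesgue_rV [set y : 'rV[R]_n | B (y *m P)%R] =
   lebesgue_rV B * lebesgue_rV [set y : 'rV[R]_n | A (- (y *m P))%R])%E.
Proof.
move=> QP mA mB.
pose lam : {sigma_finite_measure set 'rV[R]_n -> \bar R} := @lebesgue_rV R n.
have mN : measurable_fun [set: 'rV[R]_n] (fun y : 'rV[R]_n => - (y *m P)).
  by under eq_fun do rewrite -mulmxN; exact: measurable_mulmx_rV.
have mBP : measurable [set y : 'rV[R]_n | B (y *m P)%R].
  by apply: (measurable_preimage _ mB); exact: measurable_mulmx_rV.
have mAP : measurable [set y : 'rV[R]_n | A (- (y *m P))%R].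
  exact: (measurable_preimage mN mA).
have madd (M : 'M[R]_n) : measurable_fun [set: 'rV[R]_n * 'rV[R]_n]
    (fun z => z.1 + z.2 *m M).
  apply: measurable_fun_rVP => i.
  rewrite (_ : (fun x => _) = fun x : 'rV[R]_n * 'rV[R]_n => x.1 ord0 i + (x.2 *m M) ord0 i).
    apply: measurable_funD.
      apply: (@measurableT_comp _ _ _ _ _ _ (fun x : 'rV[R]_n => x ord0 i)) => //.
      exact: measurable_coord.
    apply: (@measurableT_comp _ _ _ _ _ _ (fun x : 'rV[R]_n => (x *m M) ord0 i)) => //.
    exact: (measurableT_comp (measurable_coord i) (measurable_mulmx_rV M)).
  by apply/funext => x; rewrite mxE.
pose S : set ('rV[R]_n * 'rV[R]_n) := [set z | A z.1 /\ B (z.1 + z.2 *m P)].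
pose T : set ('rV[R]_n * 'rV[R]_n) := [set z | B z.1 /\ A (z.1 + z.2 *m (- P))].
have mS : measurable S.
  apply: measurableI; first exact: (measurable_preimage measurable_fst mA).
  exact: (measurable_preimage (madd P) mB).
have mT : measurable T.
  apply: measurableI; first exact: (measurable_preimage measurable_fst mB).
  exact: (measurable_preimage (madd (- P)) mA).
have QPK (x : 'rV[R]_n) : x *m Q *m P = x by rewrite -mulmxA QP mulmx1.
have int_sec (C : set 'rV[R]_n) (U : set ('rV[R]_n * 'rV[R]_n)) (c : \bar R) :
    measurable C -> (0 <= c)%E -> (forall x, C x -> lam (xsection U x) = c) ->
    (forall x, ~ C x -> xsection U x = set0) ->
    (\int[lam]_x lam (xsection U x) = lam C * c)%E.
  move=> mC c0 UC UNC; rewrite (eq_integral (fun x => (\1_C x)%:E * c)%E); last first.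
    move=> x _; rewrite indicE; have [xC|xC] := boolP (x \in C).
      by rewrite mul1e UC//; move: xC; rewrite inE.
    by rewrite mul0e UNC ?measure0//; move: xC; rewrite notin_setE.
  rewrite ge0_integralZr ?integral_indic ?setIT//; exact: measurableT_comp.
transitivity (\int[lam]_x lam (xsection S x))%E.
  apply/esym/int_sec => // [x Ax|x nAx].
    rewrite -(lebesgue_rV_shift (x *m Q) mBP); congr (lam _).
    apply/seteqP; split => y; rewrite /xsection /S /= inE/= mulmxDl QPK addrC.
      by case.
    by split.
  by apply/seteqP; split => y; rewrite /xsection /S /= ?inE//= => -[].
(* The shear taking [(x, y)] to [(x + y *m P, y)] carries [S] onto [T]; for fixed [y] it is a
   translation. *)
transitivity (\int[lam]_x lam (xsection T x))%E.
  have FS := indic_fubini_tonelli lam lam mS.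
  have FT := indic_fubini_tonelli lam lam mT.
  rewrite !indic_fubini_tonelli_FE// !indic_fubini_tonelli_GE// in FS FT.
  rewrite [LHS]FS [RHS]FT; apply: eq_integral => y _ /=.
  rewrite -(lebesgue_rV_shift (y *m P) (measurable_ysection y mT)); congr (lam _).
  apply/seteqP; split => x; rewrite /ysection /S /T /= !inE/= mulmxN addrK => -[]//.
apply: int_sec => // [x Bx|x nBx].
  rewrite -(lebesgue_rV_shift (- (x *m Q)) mAP); congr (lam _).
  apply/seteqP; split => y; rewrite /xsection /T /= inE/=;
    rewrite mulmxDl mulNmx QPK mulmxN opprD opprK addrC.
    by case.
  by split.
by apply/seteqP; split => y; rewrite /xsection /T /= ?inE//= => -[].
Qed.

End lebesgue_invariance.

Section lebesgue_linear.
Context {R : realType} {n : nat}.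
Implicit Types (A B E : set 'rV[R]_n).

Lemma lebesgue_box01 : lebesgue_rV (@box R n 0 1) = 1%E.
Proof. by rewrite lebesgue_box ?ler01// subr0 expr1n. Qed.

(** Exchanging with the unit cube leaves one unknown factor, the volume of an image of the cube,
    which here is again a cube. *)
Lemma lebesgue_rV_scale (t : R) B : 0 < t -> measurable B ->
  lebesgue_rV [set y | B (t^-1 *: y)] = ((t ^+ n)%:E * lebesgue_rV B)%E.
Proof.
move=> t0 mB; have PQ : t%:M *m (t^-1)%:M = 1%:M :> 'M[R]_n.
  by rewrite -scalar_mxM divff ?gt_eqF.
have := lebesgue_rV_mulmx_exchange PQ (@measurable_box R n 0 1) mB.
rewrite lebesgue_box01 mul1e.
have -> : [set y : 'rV[R]_n | B (y *m t^-1%:M)] = [set y | B (t^-1 *: y)].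
  by apply/seteqP; split => y /=; rewrite mul_mx_scalar.
rewrite muleC => ->; congr (_ * _)%E.
rewrite (_ : [set y | _] = box (- t) 0).
  by rewrite lebesgue_box ?sub0r ?opprK// oppr_le0 ltW.
apply/seteqP; split => y /= yb i; have := yb i; rewrite mul_mx_scalar !mxE.
  rewrite oppr_ge0 lerNl pmulr_rle0 ?invr_gt0// => /andP[-> H]; rewrite andbT.
  by move: H; rewrite ler_pdivlMl// mulrN1.
move=> /andP[H1 H2]; rewrite oppr_ge0 lerNl pmulr_rle0 ?invr_gt0// H2/=.
by rewrite ler_pdivlMl// mulrN1.
Qed.

Lemma box_sub_ball : @box R n 0 n.+1%:R^-1 `<=` unit_ball.
Proof.
move=> x xb; rewrite /unit_ball/= [x]row_sum_delta.
rewrite (le_trans (ler_enorm_sum _ _))//.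
apply: (@le_trans _ _ (n%:R * n.+1%:R^-1)).
  apply: ler_sum_cst => i; rewrite enormZ enorm_delta mulr1.
  by have /andP[x0 x1] := xb i; rewrite ger0_norm.
by rewrite ler_pdivrMr ?ltr0Sn// mul1r ler_nat.
Qed.

Lemma ball_sub_box : unit_ball `<=` @box R n (-1) 1.
Proof.
move=> x x1 i; rewrite -ler_norml (le_trans (normr_coord_le_enorm _ _))//.
Qed.

Lemma lebesgue_ball_lty : (lebesgue_rV (@unit_ball R n) < +oo)%E.
Proof.
apply: (@le_lt_trans _ _ (lebesgue_rV (@box R n (-1) 1))).
  apply: le_measure; rewrite ?inE; [exact: measurable_unit_ball|exact: measurable_box|].
  exact: ball_sub_box.
by rewrite lebesgue_box ?ltry//; lra.
Qed.

Lemma lebesgue_ball_gt0 : (0 < lebesgue_rV (@unit_ball R n))%E.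
Proof.
apply: (@lt_le_trans _ _ (lebesgue_rV (@box R n 0 n.+1%:R^-1))).
  by rewrite lebesgue_box ?invr_ge0// subr0 lte_fin exprn_gt0// invr_gt0.
apply: le_measure; rewrite ?inE; [exact: measurable_box|exact: measurable_unit_ball|].
exact: box_sub_ball.
Qed.

Definition ball_volume : R := fine (lebesgue_rV (@unit_ball R n)).

Lemma ball_volumeE : lebesgue_rV (@unit_ball R n) = ball_volume%:E.
Proof. by rewrite fineK// ge0_fin_numE ?measure_ge0// lebesgue_ball_lty. Qed.

Lemma ball_volume_gt0 : 0 < ball_volume.
Proof. by rewrite -lte_fin -ball_volumeE lebesgue_ball_gt0. Qed.

(** Exchanging with the unit cube gives a factor [k] independent of [B]; the unit ball, invariant
    and of positive finite volume, forces [k = 1]. *)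
Lemma lebesgue_rV_rotate (Q : 'M[R]_n) B : Q *m Q^T = 1%:M -> measurable B ->
  lebesgue_rV [set y : 'rV[R]_n | B (y *m Q)] = lebesgue_rV B.
Proof.
move=> QQ; have QTQ := mulmx1C QQ.
pose k := lebesgue_rV [set y : 'rV[R]_n | box 0 1 (- (y *m Q))].
have key C : measurable C ->
    lebesgue_rV [set y : 'rV[R]_n | C (y *m Q)] = (lebesgue_rV C * k)%E.
  move=> mC; have := lebesgue_rV_mulmx_exchange QTQ (@measurable_box R n 0 1) mC.
  by rewrite lebesgue_box01 mul1e.
have := key _ measurable_unit_ball.
rewrite (_ : [set y | unit_ball (y *m Q)] = unit_ball); last first.
  by apply/seteqP; split => y; rewrite /unit_ball /= enorm_isometry.
move=> H mB; rewrite key//.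
suff -> : k = 1%E by rewrite mule1.
move: H; rewrite ball_volumeE; clearbody k; case: k {key} => [k| |].
- rewrite -EFinM => -[H']; congr EFin.
  by apply: (mulfI (lt0r_neq0 ball_volume_gt0)); rewrite mulr1 -H'.
- by rewrite gt0_muley ?lte_fin ?ball_volume_gt0.
- by rewrite gt0_muleNy ?lte_fin ?ball_volume_gt0.
Qed.

(** Links the topology to the sigma-algebra generated by the coordinates: an open set is the union
    of the countably many cubes inside it with rational centre and radius [k.+1%:R^-1]. *)
Lemma open_measurable_rV A : open A -> measurable A.
Proof.
move=> oA; pose cube (p : {ffun 'I_n -> rat} * nat) : set 'rV[R]_n :=
  [set x | forall i, `|x ord0 i - ratr (p.1 i)| < p.2.+1%:R^-1].
have mcube p : measurable (cube p).
  rewrite (_ : cube p = \bigcap_(i in [set: 'I_n]) (fun x : 'rV[R]_n => x ord0 i) @^-1`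
      `](ratr (p.1 i) - p.2.+1%:R^-1), (ratr (p.1 i) + p.2.+1%:R^-1)[%classic).
    apply: fin_bigcap_measurable => // i _.
    by apply: measurable_preimage => //; exact: measurable_coord.
  apply/seteqP; split => [x xp i _|x xp i]; have := xp i; rewrite /= in_itv/= -ltr_distl//.
  exact.
rewrite (_ : A = \bigcup_(p in [set: {ffun 'I_n -> rat} * nat])
    (if `[< cube p `<=` A >] then cube p else set0)).
  apply: countable_bigcupT_measurable => [|p]; first exact: countableP.
  by case: ifP.
apply/seteqP; split => [x Ax|x [p _]]; last by case: asboolP => // pA /pA.
have /nbhs_ballP[e /= e0 xeA] : nbhs x A by exact: open_nbhs_nbhs.
pose k := Num.truncn (2 / e).
have ke : k.+1%:R^-1 + k.+1%:R^-1 < e.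
  have : 2 / e < k.+1%:R by exact: Num.Theory.truncnS_gt.
  rewrite ltr_pdivrMr// => H; rewrite (_ : _ + _ = 2 / k.+1%:R); last by ring.
  by rewrite ltr_pdivrMr ?ltr0Sn// mulrC.
have /choice[q qx] : forall i, exists q : rat, `|x ord0 i - ratr q| < k.+1%:R^-1.
  move=> i; have [//|q] := @rat_in_itvoo R (x ord0 i - k.+1%:R^-1) (x ord0 i + k.+1%:R^-1).
    by rewrite ltrD2l -subr_gt0 opprK addr_gt0// invr_gt0.
  by rewrite in_itv/= -ltr_distl distrC; exists q.
exists (finfun q, k) => //; case: asboolP => [_ i|[]]; first by rewrite /= ffunE.
move=> y yc; apply: xeA; split => // i j; rewrite /ball/= (ord1 i).
have := yc j; have := qx j; rewrite /= ffunE => h1 h2.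
rewrite (le_lt_trans _ ke)// -(subrKA (ratr (q j))).
by rewrite (le_trans (ler_normD _ _))// lerD// ltW// distrC.
Qed.

Lemma continuous_measurable_rV (f : 'rV[R]_n -> R) : continuous f ->
  measurable_fun setT f.
Proof.
move=> cf; apply: (measurability _ (RGenOpens.measurableE R)) => //.
move=> _ [_ [a [b ->]] <-]; rewrite setTI.
by apply: open_measurable_rV; move/continuousP : cf; apply; exact: interval_open.
Qed.

End lebesgue_linear.
Arguments ball_volume R n : clear implicits.

(** * Integration over the sphere *)

Lemma measure_bigcupT d (T : measurableType d) (R : realType)
    (mu : {measure set T -> \bar R}) (F : nat -> set T) :
  (forall i, measurable (F i)) -> trivIset setT F ->
  mu (\bigcup_i F i) = (\sum_(0 <= i <oo) mu (F i))%E.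
Proof.
by move=> mF tF; apply: measure_semi_bigcup => //; exact: bigcupT_measurable.
Qed.

Section spherical.
Context {R : realType} {n : nat}.
Implicit Types (x u : 'rV[R]_n) (E : set 'rV[R]_n).

Local Notation sigma := (@spherical_measure R n).
Local Notation lam := (@lebesgue_rV R n).

Definition direction x : 'rV[R]_n := (enorm x)^-1 *: x.

Lemma measurable_direction : measurable_fun [set: 'rV[R]_n] direction.
Proof.
apply: measurable_fun_rVP => i.
rewrite (_ : (fun _ => _) = fun x => enorm x `^ (-1) * x ord0 i).
  apply: measurable_funM; last exact: measurable_coord.
  apply: (@measurableT_comp _ _ _ _ _ _ (@powR R ^~ (-1))) => //.
  exact: measurable_enorm.
by apply/funext => x; rewrite mxE powR_inv1 ?enorm_ge0.
Qed.

Lemma directionZ (t : R) x : 0 < t -> direction (t *: x) = direction x.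
Proof.
move=> t0; rewrite /direction enormZ gtr0_norm// scalerA invfM mulrAC.
by rewrite mulVf ?gt_eqF// mul1r.
Qed.

Lemma enorm_direction x : x != 0 -> enorm (direction x) = 1.
Proof.
move=> x0; have e0 : enorm x != 0 by apply: contra_neq x0; exact: enorm_eq0.
by rewrite enormZ ger0_norm ?invr_ge0 ?enorm_ge0// mulVf.
Qed.

Lemma enorm_gt0 x : (0 < enorm x) = (x != 0).
Proof.
rewrite lt_neqAle enorm_ge0 andbT eq_sym; congr (~~ _); apply/eqP/eqP => [|->].
  exact: enorm_eq0.
by rewrite enorm0.
Qed.

Lemma measurable_sphere : measurable (@unit_sphere R n).
Proof.
rewrite (_ : unit_sphere = @enorm R n @^-1` [set 1]).
  by apply: measurable_preimage => //; exact: measurable_enorm.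
by [].
Qed.

Lemma measurable_cone (t : R) E : measurable E ->
  measurable [set y | enorm y <= t /\ E (direction y)].
Proof.
move=> mE; rewrite (_ : [set y | _] =
    (@enorm R n @^-1` `]-oo, t]%classic) `&` (direction @^-1` E)).
  apply: measurableI; last exact: (measurable_preimage measurable_direction mE).
  by apply: measurable_preimage => //; exact: measurable_enorm.
by apply/seteqP; split => y /=; rewrite in_itv.
Qed.

Lemma lebesgue_cone (t : R) E : 0 < t -> measurable E ->
  (n%:R%:E * lam [set y | (enorm y <= t)%R /\ E (direction y)] = (t ^+ n)%:E * sigma E)%E.
Proof.
move=> t0 mE; have mC := measurable_cone 1 mE.
have -> : [set y | enorm y <= t /\ E (direction y)] =
    [set y | [set y | enorm y <= 1 /\ E (direction y)] (t^-1 *: y)].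
  apply/seteqP; split => y /=; rewrite directionZ ?invr_gt0// enormZ gtr0_norm ?invr_gt0//;
    by rewrite ler_pdivrMl// mulr1.
by rewrite lebesgue_rV_scale// muleCA.
Qed.

Lemma lebesgue_origin : (0 < n)%N -> lam [set 0] = 0%E.
Proof.
move=> n0; rewrite (_ : [set 0] = @box R n 0 0).
  by rewrite lebesgue_box// subr0 expr0n; case: n n0.
apply/seteqP; split => [x -> i|x x0]; first by rewrite mxE lexx.
by apply/rowP => i; rewrite mxE; apply/le_anti; rewrite andbC x0.
Qed.

Lemma measurable_origin : measurable [set (0 : 'rV[R]_n)].
Proof.
rewrite (_ : [set 0] = @box R n 0 0); first exact: measurable_box.
apply/seteqP; split => [x -> i|x x0]; first by rewrite mxE lexx.
by apply/rowP => i; rewrite mxE; apply/le_anti; rewrite andbC x0.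
Qed.

(** Since [0^-1 = 0], [direction 0] is 0 and lies off the sphere: polar coordinates miss exactly the
    origin, which is a null set. *)
Lemma lebesgue_punctured (A : set 'rV[R]_n) : (0 < n)%N -> measurable A ->
  lam (A `&` [set x | unit_sphere (direction x)]) = lam A.
Proof.
move=> n0 mA.
have mU := measurable_preimage measurable_direction measurable_sphere.
rewrite [RHS](measureDI _ mA mU) [X in (_ = X + _)%E](_ : _ = 0%E) ?add0e//.
apply: (@subset_measure0 _ _ R (@lebesgue_rV R n) _ [set 0]).
- exact: measurableD.
- exact: measurable_origin.
- move=> x [_ /=]; rewrite /unit_sphere/=; have [->//|x0] := eqVneq x 0.
  by rewrite enorm_direction.
- exact: lebesgue_origin.
Qed.

Lemma spherical_measure_sphere : (0 < n)%N ->
  sigma unit_sphere = (n%:R * ball_volume R n)%:E.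
Proof.
move=> n0; rewrite EFinM -ball_volumeE /spherical_measure; congr (_ * _)%E.
exact: lebesgue_punctured n0 measurable_unit_ball.
Qed.

Lemma spherical_measure_lty : (0 < n)%N -> (sigma unit_sphere < +oo)%E.
Proof. by move=> n0; rewrite spherical_measure_sphere// ltry. Qed.

Lemma exists_root (a : R) : (0 < n)%N -> 0 < a -> exists2 t, 0 < t & t ^+ n = a.
Proof.
move=> n0 a0; exists (a `^ n%:R^-1); first exact: powR_gt0.
rewrite -powR_mulrn ?powR_ge0// -powRrM mulVf ?powRr1 ?(ltW a0)//.
by rewrite pnatr_eq0 -lt0n.
Qed.

(* Cut the sphere into the level pieces i e <= f^-n < (i+1) e; over each piece the
   star body {f <= 1} lies between two cones of radii (i e)^(1/n), ((i+1) e)^(1/n). *)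
Lemma star_body_volume (f : 'rV[R]_n -> R) : (0 < n)%N ->
  measurable_fun setT f -> (forall t x, 0 <= t -> f (t *: x) = t * f x) ->
  (forall u, enorm u = 1 -> 0 < f u) ->
  (n%:R%:E * lam [set x | (f x <= 1)%R] =
   \int[sigma]_(u in unit_sphere) (f u ^- n)%:E)%E.
Proof.
move=> n0 mf fZ f0.
pose g u := f u ^- n.
have mg : measurable_fun unit_sphere g.
  apply: (eq_measurable_fun (fun u => f u `^ (- n%:R))).
    by move=> u; rewrite inE => u1; rewrite /g powR_invn// ltW// f0.
  apply: measurable_funS (measurableT) _ _ => //.
  by apply: (@measurableT_comp _ _ _ _ _ _ (@powR R ^~ (- n%:R))).
have g0 u : unit_sphere u -> 0 < g u by move=> u1; rewrite invr_gt0 exprn_gt0// f0.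
pose V := [set x | f x <= 1].
have mV : measurable V.
  rewrite (_ : V = f @^-1` `]-oo, 1%R]%classic); first exact: measurable_preimage.
  by apply/seteqP; split => x /=; rewrite in_itv.
(* Levels of width [e] cause an error of at most [e] times the area of the sphere, which is finite,
   in either direction. *)
have sub (e : R) : 0 < e ->
  (n%:R%:E * lam V <= \int[sigma]_(u in unit_sphere) (g u)%:E + e%:E * sigma unit_sphere
  /\ \int[sigma]_(u in unit_sphere) (g u)%:E <= n%:R%:E * lam V + e%:E * sigma unit_sphere)%E.
  move=> e0.
  pose E i : set 'rV[R]_n := unit_sphere `&` g @^-1` `[(i%:R * e), (i.+1%:R * e)[%classic.
  have mE i : measurable (E i) by apply: mg => //; exact: measurable_sphere.
  have Edisj : trivIset setT E.
    move=> i j _ _ [u [[_ ui] [_ uj]]]; move: ui uj.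
    rewrite /= !in_itv/= => /andP[i1 i2] /andP[j1 j2].
    have := le_lt_trans i1 j2; have := le_lt_trans j1 i2.
    rewrite !ltr_pM2r// !ltr_nat !ltnS => h1 h2.
    by apply/eqP; rewrite eqn_leq h1 h2.
  have Ecov : \bigcup_i E i = unit_sphere.
    apply/seteqP; split => [u [i _ []]//|u u1].
    exists (Num.truncn (g u / e)) => //; split => //=; rewrite in_itv/=.
    have /andP[] := @Num.Theory.truncn_itv R (g u / e) (divr_ge0 (ltW (g0 _ u1)) (ltW e0)).
    by rewrite ler_pdivlMr// ltr_pdivrMr// => -> ->.
  pose F i := V `&` direction @^-1` E i.
  have mF i : measurable (F i).
    by apply: measurableI => //; exact: measurable_preimage measurable_direction (mE i).
  have lamV : (n%:R%:E * lam V = \sum_(0 <= i <oo) n%:R%:E * lam (F i))%E.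
    rewrite nneseriesZl//; congr (_ * _)%E.
    rewrite -(lebesgue_punctured n0 mV) -(measure_bigcupT lam mF); last first.
      move=> i j _ _ [x [[_ xi] [_ xj]]]; apply: Edisj => //.
      by exists (direction x).
    by rewrite -setI_bigcupr -preimage_bigcup Ecov.
  have sigS : (sigma unit_sphere = \sum_(0 <= i <oo) sigma (E i))%E.
    by rewrite -(measure_bigcupT sigma mE Edisj) Ecov.
  have intS : (\int[sigma]_(u in unit_sphere) (g u)%:E =
      \sum_(0 <= i <oo) \int[sigma]_(u in E i) (g u)%:E)%E.
    rewrite -Ecov ge0_integral_bigcup// ?Ecov//; first exact/measurable_EFinP.
    by move=> u u1; rewrite lee_fin ltW// g0.
  have int_ge0 i : (0 <= \int[sigma]_(u in E i) (g u)%:E)%E.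
    by apply: integral_ge0 => u [u1 _]; rewrite lee_fin ltW// g0.
  have mgE i : measurable_fun (E i) (EFin \o g).
    apply/measurable_EFinP; apply: measurable_funS mg => //; first exact: measurable_sphere.
    by move=> u [].
  have int_lo i : ((i%:R * e)%:E * sigma (E i) <= \int[sigma]_(u in E i) (g u)%:E)%E.
    rewrite -integral_cst//; apply: ge0_le_integral => //.
    - by move=> u _; rewrite lee_fin mulr_ge0// ltW.
    - by move=> u [_ /=]; rewrite in_itv/= lee_fin => /andP[].
  have int_hi i : (\int[sigma]_(u in E i) (g u)%:E <= (i.+1%:R * e)%:E * sigma (E i))%E.
    rewrite -integral_cst//; apply: ge0_le_integral => //.
    - by move=> u [u1 _]; rewrite lee_fin ltW// g0.
    - by move=> u [_ /=]; rewrite in_itv/= lee_fin => /andP[_ /ltW].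
  have fdir x : f x = enorm x * f (direction x).
    have [->|x0] := eqVneq x 0.
      by rewrite enorm0 mul0r -[0 : 'rV__](scale0r 0) fZ// mul0r.
    rewrite -fZ ?enorm_ge0// scalerA divff ?scale1r//.
    by apply: contra_neq x0; exact: enorm_eq0.
  have Vdir x (t : R) : 0 <= t -> unit_sphere (direction x) ->
      (t * f (direction x) <= 1) = (t ^+ n <= g (direction x)).
    move=> t0 x1; rewrite /g -exprVn ler_pXn2r// ?nnegrE ?invr_ge0 ?(ltW (f0 _ x1))//.
    by rewrite -ler_pdivlMr ?f0// div1r.
  have F_hi i : (n%:R%:E * lam (F i) <= (i.+1%:R * e)%:E * sigma (E i))%E.
    have [//|t t0 tn] := @exists_root (i.+1%:R * e) n0; first by rewrite mulr_gt0.
    rewrite -tn -lebesgue_cone//; apply: lee_wpmul2l; first by rewrite lee_fin.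
    apply: le_measure; rewrite ?inE//; first exact: measurable_cone.
    move=> x [Vx Ex]; split => //; have [x1 /=] := Ex.
    rewrite in_itv/= => /andP[_ /ltW xt].
    move: Vx; rewrite /V/= fdir Vdir ?enorm_ge0// => /le_trans/(_ xt).
    by rewrite -tn ler_pXn2r ?nnegrE ?enorm_ge0 ?(ltW t0).
  have F_lo i : ((i%:R * e)%:E * sigma (E i) <= n%:R%:E * lam (F i))%E.
    (* The lowest level would need a cone of radius 0, but its lower bound is 0 anyway. *)
    have [->|i0] := eqVneq i 0%N.
      by rewrite mul0r mul0e mule_ge0// lee_fin.
    have [|t t0 tn] := @exists_root (i%:R * e) n0.
      by rewrite mulr_gt0// ltr0n lt0n.
    rewrite -tn -lebesgue_cone//; apply: lee_wpmul2l; first by rewrite lee_fin.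
    apply: le_measure; rewrite ?inE//; first exact: measurable_cone.
    move=> x [xt Ex]; split => //; have [x1 /=] := Ex.
    rewrite in_itv/= => /andP[gx _].
    rewrite /V/= fdir Vdir ?enorm_ge0// (le_trans _ gx)// -tn.
    by rewrite lerXn2r ?nnegrE ?enorm_ge0 ?(ltW t0).
  have split_i i : ((i.+1%:R * e)%:E * sigma (E i) =
      (i%:R * e)%:E * sigma (E i) + e%:E * sigma (E i))%E.
    rewrite -natr1 mulrDl mul1r EFinD ge0_muleDl//.
      by rewrite lee_fin mulr_ge0// ltW.
    by rewrite lee_fin ltW.
  have ge0s i : (0 <= e%:E * sigma (E i))%E by rewrite mule_ge0// lee_fin ltW.
  rewrite lamV intS sigS -nneseriesZl// -!nneseriesD//; last first.
    by move=> i _ _; rewrite mule_ge0// lee_fin.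
  split; apply: lee_nneseries => //.
  - by move=> i _ _; rewrite mule_ge0// lee_fin.
  - by move=> i _; rewrite (le_trans (F_hi i))// split_i leeD2r.
  - by move=> i _; rewrite (le_trans (int_hi i))// split_i leeD2r.
have sE e : (e%:E * sigma unit_sphere = (e * (n%:R * ball_volume R n))%:E)%E.
  by rewrite spherical_measure_sphere// EFinM.
have c0 : 0 < n%:R * ball_volume R n by rewrite mulr_gt0 ?ltr0n ?ball_volume_gt0.
apply/le_anti/andP; split; apply/lee_addgt0Pr => e e0;
  have [|H1 H2] := sub (e / (n%:R * ball_volume R n)); rewrite ?divr_gt0//;
  by rewrite sE divfK ?gt_eqF// in H1 H2.
Qed.

End spherical.

Section sphere_integral.
Context {R : realType} {n : nat}.
Implicit Types (x u : 'rV[R]_n) (g f : 'rV[R]_n -> R) (K : convex_body R n).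

Local Notation sigma := (@spherical_measure R n).

Definition sphere_integral g : R := \int[sigma]_(u in unit_sphere) g u.

Lemma open_enorm_ball x (e : R) : open [set u | enorm (u - x) < e].
Proof.
apply: (@open_comp _ _ (fun u => enorm (u - x)) [set r | r < e]); last exact: open_lt.
move=> u _; apply: (@continuous_comp _ _ _ (fun u => u - x) enorm).
  exact: translate_continuous.
exact: enorm_continuous.
Qed.

Lemma nbhs_enorm_ball x (e : R) : 0 < e -> nbhs x [set u | enorm (u - x) < e].
Proof.
move=> e0; apply: open_nbhs_nbhs; split; first exact: open_enorm_ball.
by rewrite /= subrr enorm0.
Qed.

Lemma enorm_lipschitz_continuous g (r : R) :
  (forall u v, `|g u - g v| <= r * enorm (u - v)) -> continuous g.
Proof.
move=> gr x A /nbhs_ballP[e /= e0 eA].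
have d0 : 0 < e / (`|r| + 1) by rewrite divr_gt0// ltr_wpDl.
apply: (@filterS _ (nbhs x) (nbhs_filter x) _ _ _ (nbhs_enorm_ball x d0)) => u /=.
rewrite enormB ltr_pdivlMr ?ltr_wpDl// => ux; apply: eA; rewrite /ball/=.
apply: (le_lt_trans (gr _ _)); apply: le_lt_trans ux.
by rewrite mulrC ler_wpM2l ?enorm_ge0//; have := ler_norm r; lra.
Qed.

Lemma support_continuous K : continuous (h K).
Proof. by have [r _ /enorm_lipschitz_continuous] := support_lipschitz K. Qed.

Lemma measurable_support K : measurable_fun setT (h K).
Proof. by apply: continuous_measurable_rV; exact: support_continuous. Qed.

Lemma measurable_support_diff g : support_diff g -> measurable_fun unit_sphere g.
Proof.
move=> [A [B AB]]; apply: (eq_measurable_fun (fun u => h A u - h B u)).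
  by move=> u; rewrite inE => u1; rewrite AB.
apply: measurable_funS (measurableT) _ _ => //.
by apply: measurable_funB; exact: measurable_support.
Qed.

Lemma support_diff_bounded g : support_diff g -> exists2 r : R, 0 <= r &
  forall u, enorm u = 1 -> `|g u| <= r.
Proof.
move=> [A [B AB]]; have [r r0 rP] := support_lipschitz A.
have [s s0 sP] := support_lipschitz B; exists (r + s); first exact: addr_ge0.
move=> u u1; rewrite AB// (le_trans (ler_normB _ _))//.
have := rP u 0; have := sP u 0; rewrite !support0 !subr0 u1 !mulr1 => *.
exact: lerD.
Qed.

Lemma integrable_support_diff g : (0 < n)%N -> support_diff g ->
  sigma.-integrable unit_sphere (EFin \o g).
Proof.
move=> n0 gd; have [r _ gr] := support_diff_bounded gd.
apply: measurable_bounded_integrable.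
- exact: measurable_sphere.
- exact: spherical_measure_lty.
- exact: measurable_support_diff.
exists r; split; first exact: num_real.
by move=> M rM u u1; rewrite /= (le_trans (gr _ u1))// ltW.
Qed.

Lemma sphere_integralD g f : (0 < n)%N -> support_diff g -> support_diff f ->
  sphere_integral (fun u => g u + f u) = sphere_integral g + sphere_integral f.
Proof.
by move=> n0 gd fd; apply: RintegralD;
  [exact: measurable_sphere|exact: integrable_support_diff..].
Qed.

Lemma sphere_integralB g f : (0 < n)%N -> support_diff g -> support_diff f ->
  sphere_integral (fun u => g u - f u) = sphere_integral g - sphere_integral f.
Proof.
by move=> n0 gd fd; apply: RintegralB;
  [exact: measurable_sphere|exact: integrable_support_diff..].
Qed.

Lemma sphere_integralZ a g : (0 < n)%N -> support_diff g ->
  sphere_integral (fun u => a * g u) = a * sphere_integral g.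
Proof.
by move=> n0 gd; apply: RintegralZl;
  [exact: measurable_sphere|exact: integrable_support_diff].
Qed.

Lemma le_sphere_integral g f : (0 < n)%N -> support_diff g -> support_diff f ->
  (forall u, enorm u = 1 -> g u <= f u) -> sphere_integral g <= sphere_integral f.
Proof.
by move=> n0 gd fd gf; apply: le_Rintegral;
  [exact: measurable_sphere|exact: integrable_support_diff..|].
Qed.

Lemma eq_sphere_integral g f : (forall u, enorm u = 1 -> g u = f u) ->
  sphere_integral g = sphere_integral f.
Proof. by move=> gf; apply: eq_Rintegral => u; rewrite inE => /gf. Qed.

Lemma sphere_integral_cst (c : R) : (0 < n)%N ->
  sphere_integral (fun=> c) = c * (n%:R * ball_volume R n).
Proof.
move=> n0; rewrite /sphere_integral Rintegral_cst; last exact: measurable_sphere.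
by congr (_ * _); exact: (congr1 fine (spherical_measure_sphere n0)).
Qed.

Lemma sphere_area_gt0 : (0 < n)%N -> 0 < n%:R * ball_volume R n.
Proof. by move=> n0; rewrite mulr_gt0 ?ltr0n ?ball_volume_gt0. Qed.

Lemma sphere_integral_sum (I : Type) (s : seq I) (G : I -> 'rV[R]_n -> R) :
  (0 < n)%N -> (forall i, support_diff (G i)) ->
  sphere_integral (fun u => \sum_(i <- s) G i u) = \sum_(i <- s) sphere_integral (G i).
Proof.
move=> n0 Gd; elim: s => [|i s IH].
  rewrite big_nil -[RHS](mul0r (n%:R * ball_volume R n)) -sphere_integral_cst//.
  by apply: eq_sphere_integral => u _; rewrite big_nil.
rewrite big_cons -IH -sphere_integralD//; last exact: support_diff_sum.
by apply: eq_sphere_integral => u _; rewrite big_cons.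
Qed.

Lemma spherical_measure_rotate (Q : 'M[R]_n) (E : set 'rV[R]_n) :
  Q *m Q^T = 1%:M -> measurable E ->
  sigma ((fun u => u *m Q) @^-1` E) = sigma E.
Proof.
move=> QQ mE; rewrite /spherical_measure; congr (_ * _)%E.
have mBE : measurable (unit_ball `&` @direction R n @^-1` E).
  apply: measurableI; first exact: measurable_unit_ball.
  exact: (measurable_preimage measurable_direction mE).
rewrite -[RHS](lebesgue_rV_rotate QQ mBE); congr (lebesgue_rV _).
apply/seteqP; split => x /=; rewrite /unit_ball /direction /= enorm_isometry// -scalemxAl//.
Qed.

Lemma sphere_integral_rotate_support (Q : 'M[R]_n) K : (0 < n)%N -> Q *m Q^T = 1%:M ->
  sphere_integral (fun u => h K (u *m Q)) = sphere_integral (h K).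
Proof.
move=> n0 QQ; rewrite /sphere_integral /Rintegral; congr fine.
pose phi (u : 'rV[R]_n) := u *m Q.
have mphi : measurable_fun [set: 'rV[R]_n] phi by exact: measurable_mulmx_rV.
have phiS : phi @^-1` unit_sphere = unit_sphere.
  by apply/seteqP; split => u; rewrite /unit_sphere /phi /= enorm_isometry.
have int : sigma.-integrable (phi @^-1` unit_sphere) ((EFin \o h K) \o phi).
  rewrite phiS; apply: (integrable_support_diff n0).
  by apply: support_diff_rot => //; exact: support_diff_support.
have mK : measurable_fun [set: 'rV[R]_n] (EFin \o h K).
  by apply/measurable_EFinP; exact: measurable_support.
have := integral_pushforward mphi mK int measurable_sphere.
rewrite phiS => <-.
pose nu : {measure set 'rV[R]_n -> \bar R} :=
  measure_function_pushforward__canonical__measure_function_Measure sigma mphi.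
apply: (@eq_measure_integral _ _ _ unit_sphere sigma nu) => E mE _.
exact: spherical_measure_rotate.
Qed.

Lemma sphere_integral_rotate (Q : 'M[R]_n) g : (0 < n)%N -> Q *m Q^T = 1%:M ->
  support_diff g ->
  sphere_integral (fun u => g (u *m Q)) = sphere_integral g.
Proof.
move=> n0 QQ [A [B AB]].
rewrite (@eq_sphere_integral g (fun u => h A u - h B u))//.
rewrite (@eq_sphere_integral _ (fun u => h A (u *m Q) - h B (u *m Q))); last first.
  by move=> u u1; rewrite AB// enorm_isometry.
rewrite !sphere_integralB//; try exact: support_diff_support;
  try by apply: support_diff_rot => //; exact: support_diff_support.
by rewrite !sphere_integral_rotate_support.
Qed.

(* Finitely many rotated copies of the set where g > g u / 2 cover the sphere. *)
Lemma sphere_integral_eq0 g u : (3 <= n)%N -> support_diff g ->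
  (forall v, enorm v = 1 -> 0 <= g v) -> sphere_integral g = 0 ->
  enorm u = 1 -> g u = 0.
Proof.
move=> n3 gd g0 Ig u1; have n0 : (0 < n)%N by rewrite (leq_trans _ n3).
apply/eqP; rewrite eq_le g0// andbT leNgt; apply/negP => gu.
have [r r0 gr] := support_diff_lipschitz gd.
(* Within this distance the Lipschitz bound lets [g] drop by at most [g u / 2]. *)
have d0 : 0 < g u / (2 * (r + 1)) by rewrite divr_gt0// mulr_gt0//; lra.
have [F [F0 FS Fnet]] := @rotation_net R n _ d0.
(* Replacing matrices outside the net by the identity makes [G P] a difference of support functions
   for every index, as the lemmas on sums require. *)
pose G (P : 'M[R]_n) v := g (v *m (if P \in F then P else 1%:M)).
have FO (P : 'M[R]_n) : P \in F -> P *m P^T = 1%:M by move=> /FS[].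
have IO (P : 'M[R]_n) : (if P \in F then P else 1%:M) *m
    (if P \in F then P else 1%:M)^T = 1%:M :> 'M[R]_n.
  by case: ifP => [/FO//|_]; rewrite trmx1 mulmx1.
have Gd P : support_diff (G P) by apply: support_diff_rot.
have IS : sphere_integral (fun v => \sum_(P <- F) G P v) = 0.
  rewrite sphere_integral_sum// big1// => P _.
  by rewrite /G sphere_integral_rotate.
suff : g u / 2 * (n%:R * ball_volume R n) <= 0.
  by apply/negP; rewrite -ltNge mulr_gt0 ?sphere_area_gt0// divr_gt0.
rewrite -IS -sphere_integral_cst//; apply: le_sphere_integral => //.
- exact: support_diff_cst.
- exact: support_diff_sum.
move=> v v1; have [Q SQ vQ] := rotation_transitive n3 (etrans v1 (esym u1)).
have [P PF PQ] := Fnet _ SQ.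
rewrite (perm_big _ (perm_to_rem PF)) big_cons ler_wpDr//.
  by apply: sumr_ge0 => T _; rewrite /G g0// enorm_isometry.
rewrite /G PF; have vP : enorm (v *m P) = 1 by rewrite enorm_isometry// FO.
have := gr _ _ vP u1; rewrite -[in enorm _]vQ -mulmxBr ler_distl => /andP[+ _].
have : r * enorm (v *m (P - Q)) <= g u / 2.
  apply: (@le_trans _ _ (r * (g u / (2 * (r + 1))))).
    by rewrite ler_wpM2l// (le_trans (enorm_mulmx _ _))// v1 mul1r.
  rewrite (_ : r * _ = r / (r + 1) * (g u / 2)); last by field; rewrite gt_eqF//; lra.
  by rewrite ler_piMl ?divr_ge0 ?(ltW gu)// ler_pdivrMr; lra.
lra.
Qed.

Lemma polar_body_volume K : (0 < n)%N -> support_diff (fun u => h K u ^- n) ->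
  (forall u, enorm u = 1 -> 0 < h K u) ->
  lebesgue_rV (polar K) = (sphere_integral (fun u => h K u ^- n) / n%:R)%:E.
Proof.
move=> n0 gd K0; have nn : (n%:R : R) != 0 by rewrite pnatr_eq0 -lt0n.
rewrite polarE.
have := @star_body_volume R n (h K) n0 (@measurable_support K)
  (fun t x t0 => supportZ K x t0) K0.
rewrite -[RHS]fineK; last first.
  exact: (integrable_fin_num measurable_sphere (integrable_support_diff n0 gd)).
rewrite -/(Rintegral _ _ _) -/(sphere_integral _).
set V := lebesgue_rV _ => HV.
have -> : V = ((n%:R^-1)%:E * (n%:R%:E * V))%E.
  by rewrite muleA -EFinM mulVf// mul1e.
by rewrite HV -EFinM mulrC.
Qed.

End sphere_integral.

(** * Lipschitz functions of a rotation and weighted sums of rotated functions *)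

Section lipschitz_on_rotations.
Context {R : realType} {n : nat}.
Implicit Types (x u v c : 'rV[R]_n) (Q P : 'M[R]_n) (K : convex_body R n).
Implicit Types (G H : 'M[R]_n -> R) (g : 'rV[R]_n -> R).

Lemma rotation_lipschitzM G H : rotation_lipschitz G -> rotation_lipschitz H ->
  rotation_lipschitz (fun Q => G Q * H Q).
Proof.
move=> Gl Hl; have [a a0 Ga] := rotation_lipschitz_bounded Gl.
have [b b0 Hb] := rotation_lipschitz_bounded Hl.
have [c c0 Gc] := Gl; have [d d0 Hd] := Hl.
exists (c * b + a * d); first by rewrite addr_ge0 ?mulr_ge0.
move=> Q P SQ SP.
have -> : G Q * H Q - G P * H P = (G Q - G P) * H Q + G P * (H Q - H P) by ring.
rewrite (le_trans (ler_normD _ _))// !normrM mulrDl lerD//.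
  by rewrite mulrAC ler_pM// ?Gc ?Hb.
by rewrite -mulrA ler_pM// ?Ga ?Hd.
Qed.

Lemma rotation_lipschitz_support K x : rotation_lipschitz (fun Q => h K (x *m Q)).
Proof.
have [r r0 rP] := support_lipschitz K; exists (r * enorm x).
  by rewrite mulr_ge0 ?enorm_ge0.
move=> Q P _ _; rewrite (le_trans (rP _ _))// -mulrA ler_wpM2l//.
by rewrite -mulmxBr enorm_mulmx.
Qed.

Lemma support_dot c u : h (translate origin_body c) u = dot u c.
Proof. by rewrite support_translate support_origin add0r. Qed.

Lemma rotation_lipschitz_dot c x : rotation_lipschitz (fun Q => dot (x *m Q) c).
Proof.
have [r r0 rP] := rotation_lipschitz_support (translate origin_body c) x.
by exists r => // Q P SQ SP; have := rP Q P SQ SP; rewrite !support_dot.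
Qed.

Lemma support_diff_rotation_sum (s : seq 'M[R]_n) (w : 'M[R]_n -> R) g :
  (forall Q, Q \in s -> special_orthogonal Q) -> support_diff g ->
  support_diff (fun u => \sum_(Q <- s) w Q * g (u *m Q)).
Proof.
move=> + gd; elim: s => [|Q s IH] sS.
  by apply: support_diff_ext (support_diff_cst 0) => u _; rewrite big_nil.
have gQ : support_diff (fun u => w Q * g (u *m Q)).
  apply: support_diffZ; apply: support_diff_rot => //.
  by have [] := sS Q (mem_head _ _).
apply: support_diff_ext (support_diffD gQ (IH _)) => [u _|P Ps].
  by rewrite big_cons.
by apply: sS; rewrite inE Ps orbT.
Qed.

Lemma sphere_integral_rotation_sum (s : seq 'M[R]_n) (w : 'M[R]_n -> R) g :
  (0 < n)%N -> (forall Q, Q \in s -> special_orthogonal Q) -> support_diff g ->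
  sphere_integral (fun u => \sum_(Q <- s) w Q * g (u *m Q)) =
  (\sum_(Q <- s) w Q) * sphere_integral g.
Proof.
move=> n0 + gd; elim: s => [|Q s IH] sS.
  rewrite big_nil mul0r -[RHS](mul0r (n%:R * ball_volume R n)) -sphere_integral_cst//.
  by apply: eq_sphere_integral => u _; rewrite big_nil.
have sS' P : P \in s -> special_orthogonal P.
  by move=> Ps; apply: sS; rewrite inE Ps orbT.
have [QQ _] := sS Q (mem_head _ _).
rewrite big_cons mulrDl -IH// -(sphere_integral_rotate n0 QQ gd).
rewrite -sphere_integralZ//; last exact: support_diff_rot.
rewrite -sphere_integralD//.
- by apply: eq_sphere_integral => u _; rewrite big_cons.
- by apply: support_diffZ; exact: support_diff_rot.
- exact: support_diff_rotation_sum.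
Qed.

End lipschitz_on_rotations.

(** * Preservation of mean width and centering *)

Section endomorphism_averages.
Context {R : realType} {n : nat} (Phi : convex_body R n -> convex_body R n).
Implicit Types (g : 'rV[R]_n -> R) (K : convex_body R n).
Context (n3 : (3 <= n)%N).
Context (PhiD : forall K L,
  Phi (minkowski_add K L) = minkowski_add (Phi K) (Phi L)).
Context (PhiT : forall K v, Phi (translate K v) = Phi K).
Context (PhiR : forall Q K,
  special_orthogonal Q -> Phi (rotate Q K) = rotate Q (Phi K)).
Context (Phi_mono : monotone_endomorphism Phi).
Context (PhiB : Phi unit_ball_body = unit_ball_body).

Local Notation T := (endo_fun Phi).

Let n0 : (0 < n)%N. Proof. by rewrite (leq_trans _ n3). Qed.

Lemma endo_fun_rotation_sum (s : seq 'M[R]_n) (w : 'M[R]_n -> R) g u :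
  (forall Q, Q \in s -> special_orthogonal Q) -> support_diff g ->
  T (fun v => \sum_(Q <- s) w Q * g (v *m Q)) u = \sum_(Q <- s) w Q * T g (u *m Q).
Proof.
move=> + gd; elim: s => [|Q s IH] sS.
  rewrite big_nil -[RHS](mul0r (enorm u)) -(endo_fun_cst PhiD PhiT Phi_mono PhiB).
  apply: (eq_endo_fun PhiD Phi_mono); first exact: support_diff_rotation_sum.
  by move=> v _; rewrite big_nil.
have sS' P : P \in s -> special_orthogonal P.
  by move=> Ps; apply: sS; rewrite inE Ps orbT.
have SQ := sS Q (mem_head _ _); have [QQ _] := SQ.
rewrite big_cons -IH// -(endo_fun_rot PhiD PhiR _ SQ gd).
rewrite -(endo_funZ PhiD PhiT Phi_mono); last exact: support_diff_rot.
rewrite -(endo_funD PhiD).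
- apply: (eq_endo_fun PhiD Phi_mono); first exact: support_diff_rotation_sum.
  by move=> v _; rewrite big_cons.
- by apply: support_diffZ; exact: support_diff_rot.
- exact: support_diff_rotation_sum.
Qed.

(* A rotation mean of K is uniformly close to a ball m B, and both integrals are
   unchanged by rotation means. *)
Lemma sphere_integral_endo K :
  sphere_integral (h (Phi K)) = sphere_integral (h K).
Proof.
pose i0 : 'I_n := Ordinal n0; pose e1 : 'rV[R]_n := delta_mx ord0 i0.
have e11 : enorm e1 = 1 by exact: enorm_delta.
pose area := n%:R * ball_volume R n.
apply/eqP; rewrite -subr_eq0 -normr_le0; apply/eqP/eqP.
apply: (@le_of_forall_scaled_eps _ _ (2 * area)) => e e0.
have [s [rs [m sm]]] := rotation_mean_almost_constant (rotation_lipschitz_support K e1) e0.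
have N0 := rotations_size_gt0 rs; set N : R := (size s)%:R in N0.
pose g u := \sum_(Q <- s) N^-1 * h K (u *m Q).
have Kd := support_diff_support K.
have gd : support_diff g by exact: support_diff_rotation_sum rs.2 Kd.
have gm u : enorm u = 1 -> `|g u - m| <= e.
  move=> u1; have [Q SQ <-] := rotation_transitive n3 (etrans e11 (esym u1)).
  have := sm Q SQ; rewrite /rotation_mean -/N /g -mulr_sumr mulrC.
  by under eq_bigr do rewrite mulmxA.
have wsum : \sum_(Q <- s) N^-1 = 1 by rewrite sumr_const_seq mulVf// gt_eqF.
have Ig : sphere_integral g = sphere_integral (h K).
  by rewrite sphere_integral_rotation_sum ?wsum ?mul1r//; exact: rs.2.
have ITg : sphere_integral (T g) = sphere_integral (h (Phi K)).
  rewrite (@eq_sphere_integral _ _ _ (fun u => \sum_(Q <- s) N^-1 * h (Phi K) (u *m Q))).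
    rewrite sphere_integral_rotation_sum ?wsum ?mul1r//; first exact: rs.2.
    exact: support_diff_support.
  move=> u _; rewrite (endo_fun_rotation_sum _ _ rs.2 Kd).
  by apply: eq_bigr => Q _; rewrite (endo_fun_support PhiD PhiT Phi_mono).
have Tgd : support_diff (T g) := support_diff_endo PhiD gd.
have Tgm u : enorm u = 1 -> `|T g u - m| <= e.
  move=> u1; rewrite ler_distl; apply/andP; split.
    rewrite -[m - e]mulr1 -u1 -(endo_fun_cst PhiD PhiT Phi_mono PhiB).
    apply: (le_endo_fun PhiD Phi_mono) => //; first exact: support_diff_cst.
    by move=> v /gm; rewrite ler_distl => /andP[].
  rewrite -[m + e]mulr1 -u1 -(endo_fun_cst PhiD PhiT Phi_mono PhiB).
  apply: (le_endo_fun PhiD Phi_mono) => //; first exact: support_diff_cst.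
  by move=> v /gm; rewrite ler_distl => /andP[].
have bnd (f : 'rV[R]_n -> R) : support_diff f -> (forall u, enorm u = 1 -> `|f u - m| <= e) ->
    (m - e) * area <= sphere_integral f <= (m + e) * area.
  move=> fd fm; rewrite /area; apply/andP; split; rewrite -sphere_integral_cst//;
    apply: le_sphere_integral => //; try exact: support_diff_cst;
    by move=> u /fm; rewrite ler_distl => /andP[].
have /andP[h1 h2] := bnd _ gd gm; have /andP[h3 h4] := bnd _ Tgd Tgm.
by rewrite -Ig -ITg ler_norml; apply/andP; split; lra.
Qed.

Lemma sphere_integral_endo_fun g : support_diff g ->
  sphere_integral (T g) = sphere_integral g.
Proof.
move=> [A [B AB]].
rewrite (eq_sphere_integral AB).
rewrite (@eq_sphere_integral _ _ (T g) (fun u => h (Phi A) u - h (Phi B) u)); last first.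
  by move=> u _; exact: endo_funE.
by rewrite !sphere_integralB//; try exact: support_diff_support; rewrite !sphere_integral_endo.
Qed.

End endomorphism_averages.

Section centering.
Context {R : realType} {n : nat} (Phi : convex_body R n -> convex_body R n).
Implicit Types (g : 'rV[R]_n -> R) (K : convex_body R n).
Context (n3 : (3 <= n)%N).
Context (PhiD : forall K L,
  Phi (minkowski_add K L) = minkowski_add (Phi K) (Phi L)).
Context (PhiT : forall K v, Phi (translate K v) = Phi K).
Context (PhiR : forall Q K,
  special_orthogonal Q -> Phi (rotate Q K) = rotate Q (Phi K)).
Context (Phi_mono : monotone_endomorphism Phi).
Context (PhiB : Phi unit_ball_body = unit_ball_body).

Local Notation T := (endo_fun Phi).

Let n0 : (0 < n)%N. Proof. by rewrite (leq_trans _ n3). Qed.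

Lemma sum_dot_orthogonal (Q : 'M[R]_n) (c : 'rV[R]_n) : Q *m Q^T = 1%:M ->
  \sum_i dot (delta_mx ord0 i *m Q) c ^+ 2 = enorm c ^+ 2.
Proof.
move=> QQ; rewrite sqr_enorm.
have <- : dot (c *m Q^T) (c *m Q^T) = dot c c.
  by apply: dot_isometry; rewrite trmxK; exact: mulmx1C.
by apply: eq_bigr => i _; rewrite dot_mulmx dot_delta.
Qed.

(* Averaged over rotations Q, the function v |-> (e Q . c) h_K(v Q) becomes linear
   in v: a half-turn about v preserves the average and turns e into 2 (e.v) v - e.
   Phi kills linear functions, so the average of (e Q . c) h_{Phi K}(e Q) is 0. *)
Lemma endo_ball_centered K (r : R) (c : 'rV[R]_n) :
  (forall u, enorm u = 1 -> h (Phi K) u = r + dot u c) -> c = 0.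
Proof.
move=> PhiK; pose e : 'rV[R]_n := delta_mx ord0 (Ordinal n0).
have e1 : enorm e = 1 by exact: enorm_delta.
have [b b0 bP] := support_lipschitz K.
have Kb (u : 'rV[R]_n) : enorm u = 1 -> `|h K u| <= b.
  by move=> u1; have := bP u 0; rewrite support0 !subr0 u1 mulr1.
suff : enorm c ^+ 2 <= 0.
  by move=> c0; apply: enorm_eq0; apply/eqP; rewrite -sqrf_eq0 eq_le c0 sqr_ge0.
(* The second moment [a2] will be at most [(4 + |r|) * eps], and [enorm c ^+ 2] at most
   [n * (a2 + 2 * eps)]. *)
apply: (@le_of_forall_scaled_eps _ _ (n%:R * (6 + `|r|))) => eps eps0.
have Cb : 0 < 2 * (enorm c * b) + 1.
  by rewrite ltr_wpDl// !mulr_ge0// enorm_ge0.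
(* Both functions of [v] compared in [qv] have Lipschitz constant [enorm c * b], so passing from the
   net to the sphere costs at most [eps]. *)
have d0 : 0 < eps / (2 * (enorm c * b) + 1) by rewrite divr_gt0.
have [F [F0 FS Fnet]] := @rotation_net R n _ d0.
pose dc x (Q : 'M[R]_n) := dot (x *m Q) c.
pose hh x (Q : 'M[R]_n) := h K (x *m Q).
pose prod x y (Q : 'M[R]_n) := dc x Q * hh y Q.
(* Only finitely many means can be made almost constant at once; for [prod e v] these are the [v]
   coming from the net. *)
pose Gs := [:: dc e, (fun Q => dc e Q * dc e Q), prod e e
  & [seq prod e (e *m P) | P <- F]].
have dc_lip x : rotation_lipschitz (dc x) by exact: rotation_lipschitz_dot.
have prod_lip x y : rotation_lipschitz (prod x y).
  apply: rotation_lipschitzM; first exact: rotation_lipschitz_dot.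
  exact: rotation_lipschitz_support.
have Glip G : G \in Gs -> rotation_lipschitz G.
  rewrite !inE => /or4P[/eqP ->|/eqP ->|/eqP ->|/mapP[P _ ->]] //.
  exact: rotation_lipschitzM.
have [s [rs sG]] := rotation_means_almost_constant Glip eps0.
have N0 := rotations_size_gt0 rs.
pose av (f : 'M[R]_n -> R) := (\sum_(Q <- s) f Q) / (size s)%:R.
have avE (f G : 'M[R]_n -> R) (Q : 'M[R]_n) :
    (forall P, f P = G (Q *m P)) -> rotation_mean s G Q = av f.
  by move=> fG; rewrite /rotation_mean /av; congr (_ / _); apply: eq_bigr => P _.
have avD (f g : 'M[R]_n -> R) : av (fun Q => f Q + g Q) = av f + av g.
  by rewrite /av big_split mulrDl.
have avZ (a : R) (f : 'M[R]_n -> R) : av (fun Q => a * f Q) = a * av f.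
  by rewrite /av -mulr_sumr mulrA.
have avB (f g : 'M[R]_n -> R) : av (fun Q => f Q - g Q) = av f - av g.
  rewrite -[- av g]mulN1r -avZ -avD; congr (av _); apply/funext => Q.
  by rewrite mulN1r.
have av_norm f (M : R) : (forall Q, Q \in s -> `|f Q| <= M) -> `|av f| <= M.
  move=> fM; rewrite /av normrM [X in _ * X]ger0_norm ?invr_ge0// ler_pdivrMr//.
  rewrite (le_trans (ler_norm_sum _ _ _))// -sumr_const_seq !big_seq.
  by apply: ler_sum.
have sO (Q : 'M[R]_n) : Q \in s -> Q *m Q^T = 1%:M by move=> /rs.2[].
have eN : enorm (- e) = 1 by rewrite enormN.
pose a1 := av (dc e); pose a2 := av (fun Q => dc e Q * dc e Q).
(* A rotation taking [e] to [- e] changes the sign of this mean, which is almost invariant. *)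
have a1e : `|a1| <= eps.
  have [|m mP] := sG (dc e); first by rewrite !inE eqxx.
  have [Q SQ eQ] := rotation_transitive n3 (etrans e1 (esym eN)).
  have H1 := mP _ special_orthogonal1; have H2 := mP _ SQ.
  rewrite (avE (dc e)) in H1; last by move=> P; rewrite mul1mx.
  rewrite (avE (fun P => -1 * dc e P)) ?avZ in H2; last first.
    by move=> P; rewrite /dc mulmxA eQ mulNmx dotNl mulN1r.
  move: H1 H2; rewrite -/a1 !ler_distl ler_norml => /andP[x1 x2] /andP[x3 x4].
  by apply/andP; split; lra.
(* Rotating [e] to a basis vector changes the second moment by at most [2 * eps]; summed over the
   basis, the squares give [enorm c ^+ 2] for every rotation. *)
have a2c : enorm c ^+ 2 <= n%:R * (a2 + 2 * eps).
  have [|m mP] := sG (fun Q => dc e Q * dc e Q); first by rewrite !inE eqxx orbT.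
  have Hi i : av (fun Q => dc (delta_mx ord0 i) Q ^+ 2) <= a2 + 2 * eps.
    have [Q SQ eQ] := rotation_transitive n3 (etrans e1 (esym (@enorm_delta R n i))).
    have H1 := mP _ special_orthogonal1; have H2 := mP _ SQ.
    rewrite (avE (fun Q => dc e Q * dc e Q)) in H1; last by move=> P; rewrite mul1mx.
    rewrite (avE (fun Q => dc (delta_mx ord0 i) Q ^+ 2)) in H2; last first.
      by move=> P; rewrite /dc mulmxA eQ expr2.
    by move: H1 H2; rewrite -/a2 !ler_distl => /andP[x1 x2] /andP[x3 x4]; lra.
  apply: le_trans (ler_sum_cst Hi).
  rewrite -mulr_suml exchange_big /= ler_pdivlMr// -sumr_const_seq !big_seq.
  by apply: ler_sum => Q Qs; rewrite sum_dot_orthogonal// sO.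
(* The mean of (e Q . c) h_K(v Q) is (e.v) b1, up to 3 eps for v in the net. *)
pose q v := av (prod e v); pose b1 := av (prod e e).
have qnet (P : 'M[R]_n) : P \in F -> `|q (e *m P) - dot e (e *m P) * b1| <= 3 * eps.
  move=> PF; have SP := FS _ PF; set v := e *m P.
  have v1 : enorm v = 1 by rewrite enorm_isometry//; case: SP.
  have [|m1 m1P] := sG (prod e v).
    by rewrite !inE; apply/or4P; apply: Or44; apply: map_f.
  have [|m2 m2P] := sG (prod e e); first by rewrite !inE eqxx !orbT.
  (* The image of [e] under the half-turn about [v]; some rotation fixes [v] and takes [e] to [w],
     whatever the determinant of the half-turn. Almost invariance makes [q v] and
     [2 * dot e v * bv - q v] agree up to [2 * eps], and a rotation from [e] to [v] compares [bv]
     with [b1]. *)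
  pose w := (2 * dot e v) *: v - e.
  have ew : enorm e = enorm w.
    rewrite /enorm; congr Num.sqrt.
    rewrite /w !(dotBl, dotBr) !dotZl !dotZr (dotC v e) !dot_enorm v1 e1; ring.
  have evw : dot e v = dot w v.
    by rewrite /w dotBl dotZl dot_enorm v1; ring.
  have [Q [SQ eQ vQ]] := rotation_pair n3 ew (erefl (enorm v)) evw.
  pose bv := av (prod v v).
  have qm1 := m1P _ special_orthogonal1; have qm2 := m1P _ SQ.
  rewrite (avE (prod e v)) in qm1; last by move=> S; rewrite mul1mx.
  rewrite (avE (fun S => 2 * dot e v * prod v v S - prod e v S)) in qm2; last first.
    move=> S; rewrite /prod /dc /hh !mulmxA eQ vQ /w mulmxBl -scalemxAl dotBl dotZl.
    by ring.
  rewrite avB avZ -/bv -/(q v) in qm1 qm2.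
  have bm1 := m2P _ special_orthogonal1; have bm2 := m2P _ SP.
  rewrite (avE (prod e e)) in bm1; last by move=> S; rewrite mul1mx.
  rewrite (avE (prod v v)) in bm2; last by move=> S; rewrite /prod /dc /hh !mulmxA.
  rewrite -/b1 -/bv in bm1 bm2.
  have q1 : `|q v - dot e v * bv| <= eps.
    move: qm1 qm2; rewrite !ler_distl => /andP[x1 x2] /andP[x3 x4].
    by apply/andP; split; lra.
  have q2 : `|dot e v * bv - dot e v * b1| <= 2 * eps.
    rewrite -mulrBr normrM; have ev : `|dot e v| <= 1.
      rewrite ler_norml lerNl -dotNl.
      by rewrite !(le_trans (dot_le_enorm _ _))// ?enormN e1 v1 mulr1.
    apply: (@le_trans _ _ `|bv - b1|); first by rewrite ler_piMl.
    move: bm1 bm2; rewrite !ler_distl => /andP[x1 x2] /andP[x3 x4].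
    by apply/andP; split; lra.
  move: q1 q2; rewrite !ler_distl => /andP[x1 x2] /andP[x3 x4].
  by apply/andP; split; lra.
have dc_le (x : 'rV[R]_n) Q : enorm x = 1 -> Q \in s -> `|dc x Q| <= enorm c.
  move=> x1 Qs; rewrite ler_norml lerNl /dc -dotNl.
  rewrite !(le_trans (dot_le_enorm _ _))// ?enormN enorm_isometry ?sO//.
    by rewrite x1 mul1r.
  by rewrite x1 mul1r.
have b1c : `|b1| <= enorm c * b.
  apply: av_norm => Q Qs; rewrite /prod normrM ler_pM ?dc_le//.
  by rewrite Kb// enorm_isometry// sO.
have qv (v : 'rV[R]_n) : enorm v = 1 -> `|q v - b1 * dot e v| <= 4 * eps.
  move=> v1; have [Q SQ eQ] := rotation_transitive n3 (etrans e1 (esym v1)).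
  have [P PF PQ] := Fnet _ SQ; have Hq := qnet _ PF; set v' := e *m P in Hq.
  have v'v : enorm (v' - v) <= eps / (2 * (enorm c * b) + 1).
    rewrite /v' -eQ -mulmxBr (le_trans (enorm_mulmx _ _))// e1 mul1r//.
  have q1 : `|q v' - q v| <= enorm c * b * enorm (v' - v).
    rewrite -avB; apply: av_norm => Q' Qs; rewrite /prod -mulrBr normrM -mulrA.
    rewrite ler_pM ?dc_le// (le_trans (bP _ _))// -mulmxBl enorm_isometry//.
    exact: sO.
  have q2 : `|dot e v' * b1 - dot e v * b1| <= enorm c * b * enorm (v' - v).
    rewrite -mulrBl normrM mulrC ler_pM// -dotBr.
    rewrite ler_norml lerNl -dotNl.
    by rewrite !(le_trans (dot_le_enorm _ _))// ?enormN e1 mul1r.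
  have q3 : 2 * (enorm c * b * enorm (v' - v)) <= eps.
    apply: (@le_trans _ _ ((2 * (enorm c * b) + 1) * enorm (v' - v))).
      by have := enorm_ge0 (v' - v); lra.
    by rewrite mulrC -ler_pdivlMr.
  move: Hq q1 q2; rewrite !ler_distl => /andP[x1 x2] /andP[x3 x4] /andP[x5 x6].
  by apply/andP; split; lra.
have Kd := support_diff_support K.
pose w (Q : 'M[R]_n) := (size s)%:R^-1 * dc e Q.
pose q' v := \sum_(Q <- s) w Q * h K (v *m Q).
have q'E v : q' v = q v.
  rewrite /q' /q /av mulrC mulr_sumr; apply: eq_bigr => Q _.
  by rewrite /w /prod /hh mulrA.
have qd : support_diff q' by exact: support_diff_rotation_sum rs.2 Kd.
have bd : support_diff (fun v => b1 * dot e v).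
  by apply: support_diffZ; exact: support_diff_dot.
have Tb : T (fun v => b1 * dot e v) e = 0.
  rewrite (endo_funZ PhiD PhiT Phi_mono _ _ (support_diff_dot e)).
  by rewrite (endo_fun_dot PhiD PhiT Phi_mono) mulr0.
have Tcst (a : R) : T (fun=> a) e = a.
  by rewrite (endo_fun_cst PhiD PhiT Phi_mono PhiB) e1 mulr1.
(* [q'] is within [4 * eps] of a linear function, which [T] kills. The exact value [r * a1 + a2]
   found next then bounds [a2]. *)
have Tq : `|T q' e| <= 4 * eps.
  rewrite -[T q' e]subr0 -Tb -(endo_funB PhiD)// ler_norml; apply/andP; split.
    rewrite -(Tcst (- (4 * eps))); apply: (le_endo_fun PhiD Phi_mono).
    - exact: support_diff_cst.
    - exact: support_diffB.
    - by move=> v /qv; rewrite q'E ler_norml => /andP[].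
  rewrite -(Tcst (4 * eps)); apply: (le_endo_fun PhiD Phi_mono).
  - exact: support_diffB.
  - exact: support_diff_cst.
  - by move=> v /qv; rewrite q'E ler_norml => /andP[].
have TqE : T q' e = r * a1 + a2.
  rewrite (endo_fun_rotation_sum PhiD PhiT PhiR Phi_mono PhiB _ _ rs.2 Kd).
  rewrite -avZ -avD /av mulrC mulr_sumr !big_seq; apply: eq_bigr => Q Qs.
  rewrite (endo_fun_support PhiD PhiT Phi_mono) PhiK; last first.
    by rewrite enorm_isometry// sO.
  by rewrite /w /dc; ring.
have a2e : a2 <= (4 + `|r|) * eps.
  have : `|r * a1| <= `|r| * eps by rewrite normrM ler_wpM2l.
  by move: Tq; rewrite TqE !ler_norml => /andP[x1 x2] /andP[x3 x4]; lra.
rewrite (le_trans a2c)// mulrCA ler_wpM2l//; lra.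
Qed.

End centering.

(** * Polar bodies and powers of support functions *)

Section tangent.
Context {R : realType}.

(** Bernoulli's inequality sharpened by a square; the square is what makes equality in Jensen's
    inequality informative. *)
Lemma expr_ge_quadratic (z : R) n : 0 <= z ->
  n.+2%:R * z - n.+1%:R + (1 - z) ^+ 2 <= z ^+ n.+2.
Proof.
move=> z0; elim: n => [|n IH]; first by rewrite (natrD _ 1 1); nra.
rewrite exprS; apply: le_trans (ler_wpM2l z0 IH).
rewrite -subr_ge0 -(natr1 n.+2) -(natr1 n.+1).
have -> : z * ((n.+1%:R + 1) * z - n.+1%:R + (1 - z) ^+ 2) -
  ((n.+1%:R + 1 + 1) * z - (n.+1%:R + 1) + (1 - z) ^+ 2) =
  (1 - z) ^+ 2 * (n.+1%:R + z) :> R by ring.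
by rewrite mulr_ge0 ?sqr_ge0// addr_ge0.
Qed.

(** The quadratic form of Bernoulli's inequality at [z = a / x], multiplied by [a ^- n * (x / a)].
    The last summand on the left bounds from below the gap between [x ^- n] and its tangent at
    [a]. *)
Lemma invXn_ge_tangent (n : nat) (x a : R) : (0 < n)%N -> 0 < x -> 0 < a ->
  n.+1%:R * a ^- n - n%:R * a ^- n.+1 * x + a ^- n.+1 * ((x - a) ^+ 2 / x) <= x ^- n.
Proof.
case: n => // n _ x0 a0; have z0 : 0 <= a / x by rewrite divr_ge0 ?ltW.
have xa0 : 0 <= a ^- n.+1 * (x / a).
  by rewrite mulr_ge0 ?divr_ge0 ?invr_ge0 ?exprn_ge0 ?ltW.
have := ler_wpM2l xa0 (expr_ge_quadratic n z0).
have -> : a ^- n.+1 * (x / a) * (a / x) ^+ n.+2 = x ^- n.+1.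
  rewrite expr_div_n !exprS; field.
  by rewrite ?expf_neq0 ?gt_eqF//= gt_eqF.
apply: le_trans; rewrite le_eqVlt; apply/orP; left; apply/eqP.
rewrite !exprS -(natr1 n.+1); field.
by rewrite ?expf_neq0 ?gt_eqF//= gt_eqF.
Qed.

Lemma invXn_ge_tangent_line (n : nat) (x a : R) : (0 < n)%N -> 0 < x -> 0 < a ->
  n.+1%:R * a ^- n - n%:R * a ^- n.+1 * x <= x ^- n.
Proof.
move=> n0 x0 a0; apply: le_trans (invXn_ge_tangent n0 x0 a0).
by rewrite lerDl mulr_ge0 ?divr_ge0 ?sqr_ge0 ?invr_ge0 ?exprn_ge0 ?(ltW a0) ?(ltW x0).
Qed.

Lemma tangent_lineE (n : nat) (a : R) : 0 < a ->
  n.+1%:R * a ^- n - n%:R * a ^- n.+1 * a = a ^- n.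
Proof.
move=> a0; rewrite exprS -(natr1 n); field.
by rewrite expf_neq0 gt_eqF.
Qed.

Lemma invXn_eq_tangent_line (n : nat) (x a : R) : (0 < n)%N -> 0 < x -> 0 < a ->
  x ^- n = n.+1%:R * a ^- n - n%:R * a ^- n.+1 * x -> x = a.
Proof.
move=> n0 x0 a0 xa; have := invXn_ge_tangent n0 x0 a0; rewrite -xa gerDl.
rewrite pmulr_rle0 ?invr_gt0 ?exprn_gt0// ler_pdivrMr// mul0r => H.
by apply/eqP; rewrite -subr_eq0 -sqrf_eq0 eq_le H sqr_ge0.
Qed.

End tangent.

Section interior.
Context {R : realType} {n : nat}.
Implicit Types (K L : convex_body R n) (x u z : 'rV[R]_n).

Lemma compact_unit_sphere : compact (@unit_sphere R n).
Proof.
apply: (subclosed_compact _ compact_unit_ball); last first.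
  by move=> u; rewrite /unit_sphere /unit_ball /= => ->.
rewrite (_ : unit_sphere = enorm @^-1` [set 1])//.
by apply: closed_comp => [x _|]; [exact: enorm_continuous|exact: closed_eq].
Qed.

Lemma support_interior K z : (body_set K)° z -> exists2 m : R, 0 < m &
  forall u, enorm u = 1 -> m <= h (translate K (- z)) u.
Proof.
move=> /nbhs_ballP[e /= e0 eK]; exists (e / 2); first by rewrite divr_gt0.
move=> u u1; rewrite support_translate dotNr lerBrDr.
have -> : e / 2 + dot u z = dot u (z + (e / 2) *: u).
  by rewrite dotDr dotZr dot_enorm u1; ring.
apply: support_ge; apply: eK; split => // i j; rewrite /ball/= (ord1 i).
rewrite !mxE opprD addrA subrr sub0r normrN normrM.
have := normr_coord_le_enorm u j; rewrite u1 => uj.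
rewrite ger0_norm ?divr_ge0 ?(ltW e0)//.
apply: (@le_lt_trans _ _ (e / 2)); first by rewrite ler_piMr// divr_ge0 ?(ltW e0).
by rewrite ltr_pdivrMr// mulr_natr mulr2n ltrDl.
Qed.

Lemma interior_support K z (m : R) : 0 < m ->
  (forall u, enorm u = 1 -> m <= h (translate K (- z)) u) -> (body_set K)° z.
Proof.
move=> m0 mK; apply: (@filterS _ (nbhs z) (nbhs_filter z) _ _ _ (nbhs_enorm_ball z m0)).
move=> x /= /ltW xz; apply/body_set_support => u u1.
have := mK _ u1; rewrite support_translate dotNr; have := dot_le_enorm u (x - z).
rewrite u1 mul1r dotBr; lra.
Qed.

Lemma support_not_interior K z : (0 < n)%N -> ~ (body_set K)° z ->
  exists2 u, enorm u = 1 & h (translate K (- z)) u <= 0.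
Proof.
move=> n0 nKz; apply: contrapT => H; apply: nKz.
have S0 : (@unit_sphere R n) !=set0.
  by exists (delta_mx ord0 (Ordinal n0)); exact: enorm_delta.
have [u + umin] := EVT_min_rV S0 compact_unit_sphere
  (continuous_subspaceT (@support_continuous R n (translate K (- z)))).
rewrite inE => u1; apply: (@interior_support _ _ (h (translate K (- z)) u)).
  by rewrite ltNge; apply/negP => hu; apply: H; exists u.
by move=> v v1; apply: umin; rewrite inE.
Qed.

Lemma polar_about_translate K z : polar_about K z = polar (translate K (- z)).
Proof. by []. Qed.

Lemma measurable_polar K : measurable (polar K).
Proof.
rewrite polarE (_ : [set x | _] = h K @^-1` `]-oo, 1]%classic).
  by apply: measurable_preimage => //; exact: measurable_support.
by apply/seteqP; split => x /=; rewrite in_itv.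
Qed.

(* The part V of the polar body in the half-space u.x >= -1 is mapped into itself
   by the translation by 2u, and misses a ball: its volume cannot be finite. *)
Lemma polar_volume_infinite K u : enorm u = 1 -> h K u <= 0 ->
  lebesgue_rV (polar K) = +oo%E.
Proof.
move=> u1 Ku; have [b b0 bP] := support_lipschitz K.
pose V := polar K `&` [set x | -1 <= dot u x].
have mV : measurable V.
  apply: measurableI; first exact: measurable_polar.
  rewrite (_ : [set x | _] = dot u @^-1` `[-1, +oo[%classic).
    apply: measurable_preimage => //; apply: continuous_measurable_rV.
    exact: dot_linear_continuous.
  by apply/seteqP; split => x /=; rewrite in_itv/= andbT.
pose W := (fun x => x - 2 *: u) @^-1` V.
have mW : measurable W.
  by apply: measurable_preimage mV; exact: measurable_add_rV.
(* [b * rho <= 1] puts [D] into the polar body; [rho < 1] puts it into the half-space and keeps it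
   away from [W], where [dot u x >= 1]. *)
pose rho := (2 * (b + 1))^-1; have rho0 : 0 < rho by rewrite invr_gt0; lra.
have rho1 : rho < 1 by rewrite invf_lt1; lra.
pose D := [set x | @unit_ball R n (rho^-1 *: x)].
have mD : measurable D.
  rewrite (_ : D = (fun x => x *m (rho^-1)%:M) @^-1` unit_ball).
    by apply: measurable_preimage measurable_unit_ball; exact: measurable_mulmx_rV.
  by apply/seteqP; split => x; rewrite /D /= mul_mx_scalar.
have DE x : D x -> enorm x <= rho.
  rewrite /D /unit_ball /= enormZ gtr0_norm; last by rewrite invr_gt0.
  by rewrite ler_pdivrMl// mulr1.
have VWD : W `|` D `<=` V.
  move=> y [Wy|/DE yr].
    have [Ky /= uy] := Wy; move: Ky; rewrite /V polarE /= => Ky; split => /=.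
      have -> : y = (y - 2 *: u) + 2 *: u by rewrite subrK.
      rewrite (le_trans (support_subadd _ _ _))// supportZ//; lra.
    by move: uy; rewrite dotBr dotZr dot_enorm u1; lra.
  rewrite /V polarE; split => /=.
    have := bP y 0; rewrite support0 !subr0 => /(le_trans (ler_norm _)) H.
    rewrite (le_trans H)// (le_trans (ler_wpM2l b0 yr))//.
    by rewrite /rho ler_pdivrMr; lra.
  have := dot_le_enorm (- u) y; rewrite enormN u1 mul1r dotNl; lra.
have WD : W `&` D = set0.
  apply/seteqP; split => // x [[_ /=]]; rewrite dotBr dotZr dot_enorm u1 => ux /DE xr.
  have := dot_le_enorm u x; rewrite u1 mul1r; lra.
have lW : lebesgue_rV W = lebesgue_rV V by rewrite lebesgue_rV_shift.
have lD : (0 < lebesgue_rV D)%E.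
  rewrite lebesgue_rV_scale//; last exact: measurable_unit_ball.
  by rewrite mule_gt0 ?lebesgue_ball_gt0// lte_fin exprn_gt0.
have VW : (lebesgue_rV V + lebesgue_rV D <= lebesgue_rV V)%E.
  rewrite -{1}lW -measureU//; apply: le_measure; rewrite ?inE//.
  exact: measurableU.
have VK : (lebesgue_rV V <= lebesgue_rV (polar K))%E.
  by apply: le_measure; rewrite ?inE//; [exact: measurable_polar|move=> x []].
apply/eqP; rewrite -leye_eq (le_trans _ VK)//.
have V0 : (0 <= lebesgue_rV V)%E by exact: measure_ge0.
move: VW lD V0; case: (lebesgue_rV V) => // v; case: (lebesgue_rV D) => [d| |]//.
move=> vd d0 _; exfalso; move: vd d0; rewrite -EFinD lee_fin lte_fin; lra.
Qed.

Lemma euclidean_ballE (c : 'rV[R]_n) (r : R) : 0 < r ->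
  body_set (translate (dilate r unit_ball_body) c) = [set x | enorm (x - c) <= r].
Proof.
move=> r0; apply/seteqP; split => [_ [_ [x x1 <-] <-]|x /= xc].
  by rewrite /= addrK enormZ gtr0_norm// ler_piMr// ltW.
exists (x - c); last by rewrite subrK.
exists (r^-1 *: (x - c)); last by rewrite scalerA divff ?scale1r// gt_eqF.
by rewrite /= /unit_ball/= enormZ gtr0_norm ?invr_gt0// ler_pdivrMl// mulr1.
Qed.

Lemma euclidean_ball_support K : euclidean_ball K <->
  exists c r, 0 < r /\ forall u, enorm u = 1 -> h K u = r + dot u c.
Proof.
have ballK (c : 'rV[R]_n) (r : R) u : 0 < r -> enorm u = 1 ->
    h (translate (dilate r unit_ball_body) c) u = r + dot u c.
  move=> r0 u1; rewrite support_translate support_dilate_ge0 ?ltW//.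
  by rewrite support_ball u1 mulr1.
split=> [[c [r [r0 KE]]]|[c [r [r0 KE]]]]; exists c, r; split => //.
  move=> u u1; rewrite -ballK//; congr (h _ u).
  by apply: convex_body_inj; rewrite euclidean_ballE.
rewrite -euclidean_ballE//; congr body_set; apply: support_inj => u u1.
by rewrite KE// ballK.
Qed.

End interior.

Section powers_of_support_functions.
Context {R : realType} {n : nat}.
Implicit Types (K L : convex_body R n) (x u z : 'rV[R]_n).

(* h^-n + beta h is the supremum of its tangents in h, which for beta large are
   support functions of bodies s B + t K. *)
Lemma support_diff_invXn K (m : R) : (0 < n)%N -> 0 < m ->
  (forall u, enorm u = 1 -> m <= h K u) -> support_diff (fun u => h K u ^- n).
Proof.
(* The largest slope in absolute value of [x ^- n] for [x >= m], so that every tangent acquires a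
   nonnegative coefficient of [h K]. *)
move=> n0 m0 mK; pose beta := n%:R * m ^- n.+1.
have [u u1|M ME] := @body_of_support R n (fun u => h K u ^- n + beta * h K u) n0.
  have a0 : 0 < h K u by rewrite (lt_le_trans m0) ?mK.
  have c1 : 0 <= n.+1%:R * h K u ^- n by rewrite mulr_ge0 ?invr_ge0 ?exprn_ge0 ?ltW.
  have c2 : 0 <= beta - n%:R * h K u ^- n.+1.
    rewrite subr_ge0 ler_wpM2l// lef_pV2 ?posrE ?exprn_gt0//.
    by rewrite lerXn2r ?nnegrE ?(ltW m0) ?(ltW a0) ?mK.
  exists (minkowski_add (dilate (n.+1%:R * h K u ^- n) unit_ball_body)
    (dilate (beta - n%:R * h K u ^- n.+1) K)).
  have E v : enorm v = 1 -> h (minkowski_add (dilate (n.+1%:R * h K u ^- n) unit_ball_body)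
      (dilate (beta - n%:R * h K u ^- n.+1) K)) v =
      n.+1%:R * h K u ^- n - n%:R * h K u ^- n.+1 * h K v + beta * h K v.
    by move=> v1; rewrite support_add !support_dilate_ge0// support_ball v1; ring.
  split=> [v v1|]; rewrite E//; last by rewrite tangent_lineE.
  rewrite lerD2r; apply: invXn_ge_tangent_line => //.
  by rewrite (lt_le_trans m0) ?mK.
exists M, (dilate beta K) => u u1; rewrite ME// support_dilate_ge0.
  by rewrite addrK.
by rewrite mulr_ge0// invr_ge0 exprn_ge0// ltW.
Qed.

End powers_of_support_functions.

(** * The equality case *)

Section constant_on_sphere.
Context {R : realType} {n : nat}.
Implicit Types (u v w x y : 'rV[R]_n).

(** [x] is the midpoint of the arc from [v] to [w], and [k] is the cosine of half the angle. *)
Lemma midpoint_on_sphere v w : enorm v = 1 -> enorm w = 1 -> v + w != 0 ->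
  exists x k, [/\ enorm x = 1, 0 < k, k ^+ 2 = (1 + dot v w) / 2,
    dot x v = k & dot x w = k /\
      forall z, dot z v = 0 -> dot z w = 0 -> dot z x = 0].
Proof.
move=> v1 w1 vw0; have s0 : 0 < enorm (v + w) by rewrite enorm_gt0.
have s2 : enorm (v + w) ^+ 2 = 2 + 2 * dot v w.
  by rewrite sqr_enorm dotDl !dotDr !dot_enorm v1 w1 (dotC w v); ring.
set s := enorm (v + w) in s0 s2.
have dvw : 1 + dot v w = s ^+ 2 / 2 by rewrite s2; field.
exists (s^-1 *: (v + w)), (s / 2); split.
- by rewrite enormZ gtr0_norm ?invr_gt0// -/s mulVf ?gt_eqF.
- by rewrite divr_gt0.
- by rewrite dvw; field.
- rewrite dotZl dotDl dot_enorm v1 (dotC w) expr1n dvw; field; exact: lt0r_neq0.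
- split=> [|z zv zw]; last by rewrite dotZr dotDr zv zw addr0 mulr0.
  by rewrite dotZl dotDl dot_enorm w1 expr1n addrC dvw; field; exact: lt0r_neq0.
Qed.

(* Two points at a small distance lie on a common latitude u.v = t; longer
   distances are halved by passing to midpoints. *)
Lemma constant_on_sphere (t : R) (g f : 'rV[R]_n -> R) : (3 <= n)%N -> -1 < t < 1 ->
  (forall u v, enorm u = 1 -> enorm v = 1 -> dot u v = t -> g v = f u) ->
  forall v w, enorm v = 1 -> enorm w = 1 -> g v = g w.
Proof.
move=> n3 /andP[t1 t2] gf; have t3 : 0 < 1 - t ^+ 2 by nra.
have sum_neq0 v w : enorm v = 1 -> 0 <= dot v w -> v + w != 0.
  move=> v1 vw; apply/eqP => /eqP; rewrite addr_eq0 => /eqP vE.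
  move: vw; rewrite -[w]opprK -vE dotNr dot_enorm v1 expr1n; lra.
have near v w : enorm v = 1 -> enorm w = 1 -> 0 <= dot v w ->
    2 * t ^+ 2 - 1 <= dot v w -> g v = g w.
  move=> v1 w1 vw vwt.
  have [x [k [x1 k0 k2 xv [xw xz]]]] := midpoint_on_sphere v1 w1 (sum_neq0 _ _ v1 vw).
  have [z z1 [zv zw]] := exists_orthogonal v w n3.
  have zx := xz _ zv zw.
  have tk : 0 <= 1 - (t / k) ^+ 2.
    rewrite expr_div_n subr_ge0 ler_pdivrMr ?exprn_gt0// mul1r k2; lra.
  (* Both [v] and [w] have inner product [k] with [x] and 0 with [z], hence [t] with [u]. The square
     root needs [|t| <= k], which is the assumption [2 * t ^+ 2 - 1 <= dot v w]. *)
  pose u := (t / k) *: x + Num.sqrt (1 - (t / k) ^+ 2) *: z.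
  have u1 : enorm u = 1.
    rewrite /enorm /u dotDl !dotDr !dotZl !dotZr (dotC x z) zx !dot_enorm x1 z1.
    rewrite -[RHS]sqrtr1; congr Num.sqrt.
    set q := Num.sqrt _; have : q ^+ 2 = 1 - (t / k) ^+ 2 by rewrite sqr_sqrtr.
    lra.
  have uE y : dot x y = k -> dot z y = 0 -> dot u y = t.
    by move=> xy zy; rewrite /u dotDl !dotZl xy zy mulr0 addr0 divfK// gt_eqF.
  by rewrite (gf u v)// ?(gf u w)// uE.
pose d := Num.min 1 (2 * (1 - t ^+ 2)).
have d0 : 0 < d by rewrite lt_min ltr01 mulr_gt0.
have step j v w : enorm v = 1 -> enorm w = 1 -> 0 <= dot v w ->
    1 - dot v w <= 2 ^+ j * d -> g v = g w.
  elim: j v w => [|j IH] v w v1 w1 vw.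
    rewrite expr0 mul1r /d le_min => /andP[h1 h2].
    by apply: near => //; lra.
  rewrite exprS => vwd.
  have [x [k [x1 k0 k2 xv [xw _]]]] := midpoint_on_sphere v1 w1 (sum_neq0 _ _ v1 vw).
  have dvw : dot v w <= 1 by have := dot_le_enorm v w; rewrite v1 w1 mulr1.
  (* Passing to the midpoint at least halves the defect: [1 - k <= 1 - k ^+ 2 = (1 - dot v w) / 2],
     as [k <= 1]. *)
  have kd : 1 - k <= 2 ^+ j * d by nra.
  by rewrite (IH v x) ?(IH w x)// dotC ?xv ?xw// ltW.
have half v w : enorm v = 1 -> enorm w = 1 -> 0 <= dot v w -> g v = g w.
  move=> v1 w1 vw; pose j := Num.truncn d^-1.
  apply: (step j.+1) => //.
  have dj : d^-1 < 2 ^+ j.+1.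
    apply: (@lt_trans _ _ j.+1%:R); first exact: Num.Theory.truncnS_gt.
    by rewrite -natrX ltr_nat ltn_expl.
  have : 1 < 2 ^+ j.+1 * d by rewrite -ltr_pdivrMr// div1r.
  lra.
move=> v w v1 w1; have [vw|vw] := eqVneq (v + w) 0.
  have [z z1 [zv zw]] := exists_orthogonal v w n3.
  by rewrite (half v z) ?(half z w)// ?zw// dotC zv.
have [x [k [x1 k0 k2 xv [xw _]]]] := midpoint_on_sphere v1 w1 vw.
by rewrite (half v x) ?(half w x)// dotC ?xv ?xw// ltW.
Qed.

Lemma dot_eq1 u v : enorm u = 1 -> enorm v = 1 -> dot u v = 1 -> v = u.
Proof.
move=> u1 v1 uv; apply/eqP; rewrite eq_sym -subr_eq0 -dot_eq0.
by rewrite dotBl !dotBr !dot_enorm (dotC v u) uv u1 v1; apply/eqP; ring.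
Qed.

End constant_on_sphere.

Section rigidity.
Context {R : realType} {n : nat} (Phi : convex_body R n -> convex_body R n).
Implicit Types (g G : 'rV[R]_n -> R) (K N : convex_body R n) (u v w e : 'rV[R]_n).
Context (n3 : (3 <= n)%N).
Context (PhiD : forall K L,
  Phi (minkowski_add K L) = minkowski_add (Phi K) (Phi L)).
Context (PhiT : forall K v, Phi (translate K v) = Phi K).
Context (PhiR : forall Q K,
  special_orthogonal Q -> Phi (rotate Q K) = rotate Q (Phi K)).
Context (Phi_mono : monotone_endomorphism Phi).
Context (PhiB : Phi unit_ball_body = unit_ball_body).

Local Notation T := (endo_fun Phi).

Let n0 : (0 < n)%N. Proof. by rewrite (leq_trans _ n3). Qed.

Let TD := endo_funD PhiD.
Let TB := endo_funB PhiD.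
Let TZ := endo_funZ PhiD PhiT Phi_mono.
Let T_support := endo_fun_support PhiD PhiT Phi_mono.
Let T_le := le_endo_fun PhiD Phi_mono.

Let Tcst (c : R) u : enorm u = 1 -> T (fun=> c) u = c.
Proof. by move=> u1; rewrite (endo_fun_cst PhiD PhiT Phi_mono PhiB) u1 mulr1. Qed.

Lemma endo_support_ge K (m : R) : (forall u, enorm u = 1 -> m <= h K u) ->
  forall u, enorm u = 1 -> m <= h (Phi K) u.
Proof.
move=> mK u u1; rewrite -(Tcst m u1) -T_support; apply: T_le => //.
  exact: support_diff_cst.
exact: support_diff_support.
Qed.

(** With [a = h (Phi K) u], the functional [g |-> T g u] is positive, fixes constants and sends
    [h K] to [a]; it therefore sends the tangent of [x ^- n] at [a], taken along [h K], to
    [a ^- n]. *)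
Lemma endo_fun_invXn_ge K (m : R) u : 0 < m ->
  (forall v, enorm v = 1 -> m <= h K v) -> enorm u = 1 ->
  h (Phi K) u ^- n <= T (fun v => h K v ^- n) u.
Proof.
move=> m0 mK u1; have Kd := support_diff_support K.
have a0 : 0 < h (Phi K) u by rewrite (lt_le_trans m0)// endo_support_ge.
rewrite -(tangent_lineE n a0); set a := h (Phi K) u in a0 *.
have aT : a = T (h K) u by rewrite T_support.
rewrite -[X in X - _](Tcst _ u1) [X in _ - _ * X]aT -TZ// -TB//; last 2 first.
- exact: support_diff_cst.
- exact: support_diffZ.
apply: T_le; first by apply: support_diffB; [exact: support_diff_cst|exact: support_diffZ].
  exact: support_diff_invXn n0 m0 mK.
by move=> v v1; apply: invXn_ge_tangent_line => //; rewrite (lt_le_trans m0)// mK.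
Qed.

(* Equality in Jensen's inequality at u: h_K takes the value h_{Phi K}(u) almost
   everywhere for the functional g |-> T g u. *)
Lemma endo_fun_dist_eq0 K (m : R) u : 0 < m ->
  (forall v, enorm v = 1 -> m <= h K v) -> enorm u = 1 ->
  T (fun v => h K v ^- n) u = h (Phi K) u ^- n ->
  T (fun v => `|h K v - h (Phi K) u|) u = 0.
Proof.
move=> m0 mK u1 TE; have Kd := support_diff_support K.
have a0 : 0 < h (Phi K) u by rewrite (lt_le_trans m0)// endo_support_ge.
set a := h (Phi K) u in a0 TE *.
have Xd : support_diff (fun v => `|h K v - a|).
  by apply: support_diff_norm => //; apply: support_diffB => //; exact: support_diff_cst.
set X := T _ u; apply/eqP; rewrite eq_le; apply/andP; split; last first.
  rewrite -(Tcst 0 u1); apply: T_le => //; exact: support_diff_cst.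
have [b b0 bP] := support_lipschitz K.
have Kb v : enorm v = 1 -> h K v <= b.
  by move=> v1; have := bP v 0; rewrite support0 !subr0 v1 mulr1 => /(le_trans (ler_norm _)).
have bpos : 0 < b by rewrite (lt_le_trans m0)// (le_trans (mK _ u1))// Kb.
(* A lower bound for the coefficient [a ^- n.+1 / h K v] of the quadratic gap, as [h K v <= b]. *)
pose k := a ^- n.+1 / b.
have k0 : 0 < k by rewrite divr_gt0// invr_gt0 exprn_gt0.
apply: (@le_of_forall_scaled_eps _ X 1) => tau tau0; rewrite mulr1.
pose c1 := n.+1%:R * a ^- n - k * tau ^+ 2; pose c2 := n%:R * a ^- n.+1.
(* The square [(x - a) ^+ 2] is replaced by its minorant [2 * tau * |x - a| - tau ^+ 2], which
   yields a difference of support functions; applying [T] at [u] leaves [2 * X <= tau] for every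
   [tau > 0]. *)
pose G v := c1 - c2 * h K v + 2 * k * tau * `|h K v - a|.
have d1 : support_diff (fun v => c1 - c2 * h K v).
  by apply: support_diffB; [exact: support_diff_cst|exact: support_diffZ].
have d2 : support_diff (fun v => 2 * k * tau * `|h K v - a|) by exact: support_diffZ.
have TG : T G u = a ^- n - k * tau ^+ 2 + 2 * k * tau * X.
  rewrite TD// TB//; [|exact: support_diff_cst|exact: support_diffZ].
  rewrite !TZ// Tcst// T_support -/a -/X -(tangent_lineE n a0) /c1 /c2; ring.
have GT : T G u <= a ^- n.
  rewrite -TE; apply: T_le; [exact: support_diffD|exact: support_diff_invXn m0 mK|].
  move=> v v1; set x := h K v; have x0 : 0 < x by rewrite (lt_le_trans m0)// mK.
  apply: le_trans (invXn_ge_tangent n0 x0 a0).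
  have H1 : k * (x - a) ^+ 2 <= a ^- n.+1 * ((x - a) ^+ 2 / x).
    rewrite /k -mulrA ler_pM2l ?invr_gt0 ?exprn_gt0// mulrC ler_wpM2l ?sqr_ge0//.
    by rewrite lef_pV2 ?posrE// Kb.
  have H2 : k * (2 * tau * `|x - a| - tau ^+ 2) <= k * (x - a) ^+ 2.
    rewrite ler_pM2l// -[(x - a) ^+ 2]real_normK ?num_real//.
    by have := sqr_ge0 (`|x - a| - tau); rewrite sqrrB -mulr_natl; lra.
  rewrite /G /c1 /c2 -/x; lra.
have H : k * tau * (2 * X) <= k * tau * tau.
  have -> : k * tau * (2 * X) = 2 * k * tau * X by ring.
  have -> : k * tau * tau = k * tau ^+ 2 by ring.
  by move: GT; rewrite TG -addrA gerDl addrC subr_le0.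
move: H; rewrite (ler_pM2l (mulr_gt0 k0 tau0)); lra.
Qed.

Section extremal_body.
Context (K : convex_body R n) (m : R) (m0 : 0 < m).
Context (mK : forall v, enorm v = 1 -> m <= h K v).
Context (TK : forall u, enorm u = 1 ->
  T (fun v => h K v ^- n) u = h (Phi K) u ^- n).

Let dist_support_diff (c : R) : support_diff (fun v => `|h K v - c|).
Proof.
apply: support_diff_norm => //; apply: support_diffB; first exact: support_diff_support.
exact: support_diff_cst.
Qed.

(* Rotating the points where h_K differs from h_{Phi K}(u) onto v gives a function
   that is positive at v although the functional g |-> T g e kills it. *)
Lemma exists_endo_null_function e v : ~ (forall u w, enorm u = 1 -> enorm w = 1 ->
    h K u = h K w) ->
  enorm e = 1 -> enorm v = 1 -> -1 < dot e v < 1 ->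
  exists G, [/\ support_diff G, forall w, 0 <= G w, T G e = 0 & 0 < G v].
Proof.
move=> nconst e1 v1 evt.
have [u [w [u1 w1 uw uwK]]] : exists u w,
    [/\ enorm u = 1, enorm w = 1, dot u w = dot e v & h K w <> h (Phi K) u].
  apply: contrapT => H; apply: nconst.
  apply: (constant_on_sphere n3 evt (f := h (Phi K))) => u w u1 w1 uw.
  by apply: contrapT => uwK; apply: H; exists u, w.
have [Q [SQ eQ vQ]] := rotation_pair n3 (etrans e1 (esym u1)) (etrans v1 (esym w1)) (esym uw).
exists (fun x => `|h K (x *m Q) - h (Phi K) u|); split => //.
- have [QQ _] := SQ.
  exact: (support_diff_rot QQ (dist_support_diff (h (Phi K) u))).
- rewrite (endo_fun_rot PhiD PhiR e SQ (dist_support_diff (h (Phi K) u))) eQ.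
  exact: endo_fun_dist_eq0 m0 mK u1 (TK u1).
- by rewrite vQ normr_gt0 subr_eq0; apply/eqP.
Qed.

(* By compactness of the sphere, a function vanishing at e and -e is dominated by
   eps plus a function killed by the functional g |-> T g e. *)
Lemma endo_fun_poles e g : ~ (forall u w, enorm u = 1 -> enorm w = 1 ->
    h K u = h K w) ->
  enorm e = 1 -> support_diff g -> g e = 0 -> g (- e) = 0 -> T g e = 0.
Proof.
move=> nconst e1 gd ge gNe; apply/eqP; rewrite -normr_le0.
apply: (@le_of_forall_scaled_eps _ _ 1) => eps eps0; rewrite mulr1.
have [r r0 rP] := support_diff_lipschitz gd.
have [b b0 bP] := support_diff_bounded gd.
have eN1 : enorm (- e) = 1 by rewrite enormN.
(* Each [v] gets a killed function and a radius within which that function plus [eps] dominates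
   [|g|]. At the poles the zero function suffices, by Lipschitz continuity. Elsewhere a null
   function is scaled by [2 * b / G v], so that it reaches the bound [b] of [g] wherever [G] is at
   least [G v / 2]. Points off the sphere get a dummy. *)
have /choice[Gd GdP] : forall v, exists Gd : ('rV[R]_n -> R) * R,
    [/\ support_diff Gd.1, forall w, 0 <= Gd.1 w, T Gd.1 e = 0, 0 < Gd.2 &
      enorm v = 1 -> forall w, enorm w = 1 -> enorm (w - v) < Gd.2 ->
        `|g w| <= eps + Gd.1 w].
  move=> v; have [v1|v1] := pselect (enorm v = 1); last first.
    by exists (fun=> 0, 1); split => //=; [exact: support_diff_cst|rewrite Tcst].
  have pole w : enorm w = 1 -> g w = 0 -> exists2 d : R, 0 < d &
      forall x, enorm x = 1 -> enorm (x - w) < d -> `|g x| <= eps.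
    move=> w1 gw; exists (eps / (r + 1)); first by rewrite divr_gt0// ltr_wpDl.
    move=> x x1; rewrite ltr_pdivlMr ?ltr_wpDl// => /ltW xw.
    have := rP x w x1 w1; rewrite gw subr0 => /le_trans; apply.
    by rewrite (le_trans _ xw)// mulrC ler_wpM2l ?enorm_ge0//; lra.
  have [ev|ev] := eqVneq (dot e v) 1.
    have [d d0 dP] := pole _ e1 ge; exists (fun=> 0, d); split => //=.
    - exact: support_diff_cst.
    - by rewrite Tcst.
    - by move=> _ w w1; rewrite (dot_eq1 e1 v1 ev) addr0; exact: dP.
  have [ev'|ev'] := eqVneq (dot e v) (-1).
    have [d d0 dP] := pole _ eN1 gNe; exists (fun=> 0, d); split => //=.
    - exact: support_diff_cst.
    - by rewrite Tcst.
    - move=> _ w w1; rewrite addr0 (_ : v = - e); first exact: dP.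
      by apply: dot_eq1 => //; rewrite dotNl ev' opprK.
  have evt : -1 < dot e v < 1.
    rewrite !lt_neqAle eq_sym ev' ev /=; have := dot_le_enorm e v.
    by have := dot_le_enorm (- e) v; rewrite dotNl eN1 e1 v1 mulr1; lra.
  have [G [Gd G0 TG Gv]] := exists_endo_null_function nconst e1 v1 evt.
  have [s s0 sP] := support_diff_lipschitz Gd.
  exists (fun w => (2 * b / G v) * G w, G v / (2 * (s + 1))); split => //=.
  - exact: support_diffZ.
  - by move=> w; rewrite mulr_ge0// divr_ge0 ?mulr_ge0// ltW.
  - by rewrite TZ// TG mulr0.
  - by rewrite divr_gt0// mulr_gt0// ltr_wpDl.
  move=> _ w w1; rewrite ltr_pdivlMr ?mulr_gt0 ?ltr_wpDl// => wv.
  have Gw : G v / 2 <= G w.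
    have := sP w v w1 v1; rewrite ler_distl => /andP[+ _].
    have : s * enorm (w - v) <= (s + 1) * enorm (w - v).
      by rewrite ler_wpM2r ?enorm_ge0//; lra.
    lra.
  apply: (le_trans (bP w w1)); apply: (@le_trans _ _ (2 * b / G v * G w)).
    rewrite mulrAC ler_pdivlMr// -mulrA mulrCA ler_wpM2l//; lra.
  by rewrite lerDr ltW.
pose U v := [set w | enorm (w - v) < (Gd v).2].
have := @compact_unit_sphere R n; rewrite compact_cover => /(_ _ unit_sphere U).
case=> [v _|v v1|D' D'S D'P]; first exact: open_enorm_ball.
  by exists v => //; rewrite /U /= subrr enorm0; case: (GdP v).
pose s := finmap.enum_fset D'.
pose G w := \sum_(v <- s) (Gd v).1 w.
have Gsd : support_diff G by apply: support_diff_sum => v; case: (GdP v).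
have TG : T G e = 0.
  rewrite (endo_fun_sum PhiD PhiT Phi_mono PhiB); last by move=> v; case: (GdP v).
  by rewrite big1// => v _; case: (GdP v).
have gG w : enorm w = 1 -> `|g w| <= eps + G w.
  move=> w1; have [v /= vD wv] := D'P w w1.
  have v1 : enorm v = 1 by have := D'S v vD; rewrite inE.
  have [_ _ _ _ /(_ v1 w w1 wv) gv] := GdP v; apply: (le_trans gv).
  have vs : v \in s by [].
  rewrite /G (perm_big _ (perm_to_rem vs)) big_cons lerD2l lerDl.
  by apply: sumr_ge0 => x _; case: (GdP x).
have epsd : @support_diff R n (fun=> eps) by exact: support_diff_cst.
have Te : T (fun w => eps + G w) e = eps by rewrite TD// TG addr0 Tcst.
have eGd := support_diffD epsd Gsd.
rewrite -Te ler_norml -(endo_funN PhiD)//; apply/andP; split; apply: T_le => //.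
- exact: support_diffN.
- by move=> w /gG; rewrite ler_norml => /andP[].
- by move=> w /gG; rewrite ler_norml => /andP[].
Qed.

(* The values at e and -e of a support function are matched by an affine function. *)
Lemma support_endo_poles N e : ~ (forall u w, enorm u = 1 -> enorm w = 1 ->
    h K u = h K w) ->
  enorm e = 1 -> h (Phi N) e = (h N e + h N (- e)) / 2.
Proof.
move=> nconst e1; pose p := (h N e + h N (- e)) / 2; pose q := (h N e - h N (- e)) / 2.
have Nd := support_diff_support N; have ed := support_diff_dot e.
have pd : @support_diff R n (fun=> p) by exact: support_diff_cst.
have qd : support_diff (fun w => q * dot e w) by exact: support_diffZ.
have Npd := support_diffB Nd pd.
have := @endo_fun_poles e (fun w => h N w - p - q * dot e w) nconst e1
  (support_diffB Npd qd).
rewrite !TB// TZ// T_support Tcst// (endo_fun_dot PhiD PhiT Phi_mono) mulr0 subr0.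
rewrite dotNr dot_enorm e1 /p /q => H; apply/eqP; rewrite -subr_eq0; apply/eqP.
by apply: H; field.
Qed.

Lemma extremal_endomorphism : ~ (forall u w, enorm u = 1 -> enorm w = 1 ->
    h K u = h K w) ->
  Phi = difference_body /\ forall u, enorm u = 1 -> h K (- u) = h K u.
Proof.
move=> nconst; split.
  apply/funext => N; apply: support_inj => u u1; rewrite support_endo_poles//.
  rewrite support_dilate_ge0 ?invr_ge0// support_add support_dilate scaleN1r.
  by rewrite mulrC.
(* At [u] the functional is now the mean of the values at [u] and [- u]. It kills the nonnegative
   function [|h K - h (Phi K) u|], so both values vanish. *)
move=> u u1; have [A [B AB]] := dist_support_diff (h (Phi K) u).
have := endo_fun_dist_eq0 m0 mK u1 (TK u1).
have uN1 : enorm (- u) = 1 by rewrite enormN.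
rewrite (endo_funE PhiD u AB) !support_endo_poles// => H.
have := AB u u1; have := AB _ uN1.
have := normr_ge0 (h K u - h (Phi K) u); have := normr_ge0 (h K (- u) - h (Phi K) u).
move=> p1 p2 e1 e2.
have z1 : `|h K u - h (Phi K) u| = 0 by lra.
have z2 : `|h K (- u) - h (Phi K) u| = 0 by lra.
by move/normr0_eq0 : z1; move/normr0_eq0 : z2; lra.
Qed.

End extremal_body.

End rigidity.

(** * The two volume inequalities and their equality cases *)

Section polar_endomorphism.
Context {R : realType} {n : nat} (Phi : convex_body R n -> convex_body R n).
Implicit Types (K L : convex_body R n) (u v z c : 'rV[R]_n).
Context (n3 : (3 <= n)%N).
Context (PhiD : forall K L,
  Phi (minkowski_add K L) = minkowski_add (Phi K) (Phi L)).
Context (PhiT : forall K v, Phi (translate K v) = Phi K).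
Context (PhiR : forall Q K,
  special_orthogonal Q -> Phi (rotate Q K) = rotate Q (Phi K)).
Context (Phi_mono : monotone_endomorphism Phi).
Context (PhiB : Phi unit_ball_body = unit_ball_body).

Local Notation T := (endo_fun Phi).

Let n0 : (0 < n)%N. Proof. by rewrite (leq_trans _ n3). Qed.

Let nR : 0 < n%:R :> R. Proof. by rewrite ltr0n. Qed.

Lemma half_mean_width K :
  mean_width K / 2 * (n%:R * ball_volume R n) = sphere_integral (h K).
Proof.
rewrite /mean_width -/(ball_volume R n) -/(sphere_integral (h K)).
by field; rewrite !gt_eqF ?ball_volume_gt0.
Qed.

Section interior_point.
Context (K : convex_body R n) (z : 'rV[R]_n) (Kz : (body_set K)° z).

Let L := translate K (- z).
Let PhiL : Phi L = Phi K. Proof. exact: PhiT. Qed.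

Lemma endo_support_gt0 : exists2 m : R, 0 < m &
  (forall u, enorm u = 1 -> m <= h L u) /\
  (forall u, enorm u = 1 -> m <= h (Phi K) u).
Proof.
have [m m0 mL] := support_interior Kz; exists m => //; split=> //.
by rewrite -PhiL; exact: (endo_support_ge PhiD PhiT Phi_mono PhiB mL).
Qed.

Lemma polar_endo_volume :
  lebesgue_rV (polar (Phi K)) = (sphere_integral (fun u => h (Phi K) u ^- n) / n%:R)%:E.
Proof.
have [m m0 [_ mP]] := endo_support_gt0; apply: polar_body_volume => //.
  exact: support_diff_invXn n0 m0 mP.
by move=> u u1; rewrite (lt_le_trans m0)// mP.
Qed.

Lemma polar_endo_le : (lebesgue_rV (polar (Phi K)) <= lebesgue_rV (polar_about K z))%E.
Proof.
have [m m0 [mL mP]] := endo_support_gt0.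
have hd := support_diff_invXn n0 m0 mL; have fd := support_diff_invXn n0 m0 mP.
rewrite polar_endo_volume polar_about_translate -/L polar_body_volume//; last first.
  by move=> u u1; rewrite (lt_le_trans m0)// mL.
rewrite lee_fin ler_pM2r ?invr_gt0//.
rewrite -(sphere_integral_endo_fun n3 PhiD PhiT PhiR Phi_mono PhiB hd).
apply: le_sphere_integral => //; first exact: support_diff_endo.
move=> u u1; rewrite -PhiL.
exact: (endo_fun_invXn_ge n3 PhiD PhiT Phi_mono PhiB m0 mL u1).
Qed.

Lemma polar_endo_eq : lebesgue_rV (polar (Phi K)) = lebesgue_rV (polar_about K z) ->
  (centrally_symmetric K /\ Phi = difference_body) \/ euclidean_ball K.
Proof.
have [m m0 [mL mP]] := endo_support_gt0.
have hd := support_diff_invXn n0 m0 mL; have fd := support_diff_invXn n0 m0 mP.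
rewrite polar_endo_volume polar_about_translate -/L polar_body_volume//; last first.
  by move=> u u1; rewrite (lt_le_trans m0)// mL.
move=> [/(mulIf (invr_neq0 (lt0r_neq0 nR)))].
rewrite -(sphere_integral_endo_fun n3 PhiD PhiT PhiR Phi_mono PhiB hd) => E.
have Td := support_diff_endo PhiD hd.
(* Jensen's inequality orders the two sides pointwise and their integrals agree, so the nonnegative
   difference vanishes everywhere on the sphere. *)
have TL u : enorm u = 1 -> T (fun v => h L v ^- n) u = h (Phi L) u ^- n.
  move=> u1; apply/eqP; rewrite PhiL -subr_eq0; apply/eqP.
  apply: (sphere_integral_eq0 n3 (support_diffB Td fd)) => //.
    move=> v v1; rewrite subr_ge0 -PhiL.
    exact: (endo_fun_invXn_ge n3 PhiD PhiT Phi_mono PhiB m0 mL v1).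
  by rewrite sphere_integralB// E subrr.
have [Lcst|nLcst] := pselect (forall u w, enorm u = 1 -> enorm w = 1 -> h L u = h L w).
  right; apply/euclidean_ball_support.
  have e1 := @enorm_delta R n (Ordinal n0); set e := delta_mx _ _ in e1.
  exists z, (h L e); split; first by rewrite (lt_le_trans m0)// mL.
  by move=> u u1; rewrite (Lcst e u e1 u1) support_translate dotNr subrK.
left; have [PhiE LN] := extremal_endomorphism n3 PhiD PhiT PhiR Phi_mono PhiB m0 mL TL nLcst.
split => //; exists (- z); apply: support_inj => u u1.
by rewrite support_dilate scaleN1r -/L LN.
Qed.

(** [a] is the mean of [h (Phi K)] over the sphere, so the tangent of [x ^- n] at [a] integrates to
    [a ^- n] times the area. It touches the curve only at [a], which settles equality. *)
Lemma polar_endo_volume_ge : let a := mean_width K / 2 in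
  (lebesgue_rV (@unit_ball R n) * (a ^- n)%:E <= lebesgue_rV (polar (Phi K)))%E /\
  ((lebesgue_rV (@unit_ball R n) * (a ^- n)%:E)%E = lebesgue_rV (polar (Phi K)) <->
   forall u, enorm u = 1 -> h (Phi K) u = a).
Proof.
move=> a; have [m m0 [mL mP]] := endo_support_gt0.
have Pd := support_diff_support (Phi K); have fd := support_diff_invXn n0 m0 mP.
have area0 := @sphere_area_gt0 R n n0; set area := n%:R * ball_volume R n in area0.
have IP : sphere_integral (h (Phi K)) = a * area.
  by rewrite (sphere_integral_endo n3 PhiD PhiT PhiR Phi_mono PhiB) -half_mean_width.
have a0 : 0 < a.
  rewrite -(pmulr_lgt0 _ area0) -IP (lt_le_trans (mulr_gt0 m0 area0))//.
  rewrite -sphere_integral_cst//; apply: le_sphere_integral => //.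
  exact: support_diff_cst.
pose g u := n.+1%:R * a ^- n - n%:R * a ^- n.+1 * h (Phi K) u.
have gd : support_diff g.
  by apply: support_diffB; [exact: support_diff_cst|exact: support_diffZ].
have Ig : sphere_integral g = a ^- n * area.
  rewrite sphere_integralB//; [|exact: support_diff_cst|exact: support_diffZ].
  rewrite sphere_integral_cst// sphere_integralZ// -/area IP.
  by rewrite -[in RHS](tangent_lineE n a0); ring.
have gf u : enorm u = 1 -> g u <= h (Phi K) u ^- n.
  by move=> u1; apply: invXn_ge_tangent_line => //; rewrite (lt_le_trans m0)// mP.
have -> : (lebesgue_rV (@unit_ball R n) * (a ^- n)%:E)%E = (sphere_integral g / n%:R)%:E.
  rewrite ball_volumeE Ig -EFinM; congr EFin; rewrite /area; field.
  by rewrite expf_neq0 ?lt0r_neq0.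
rewrite polar_endo_volume lee_fin ler_pM2r ?invr_gt0//; split.
  exact: le_sphere_integral.
split=> [[/(mulIf (invr_neq0 (lt0r_neq0 nR))) E] u u1|Pa].
  have : h (Phi K) u ^- n - g u = 0.
    apply: (sphere_integral_eq0 n3 (support_diffB fd gd)) => //.
      by move=> v v1; rewrite subr_ge0 gf.
    by rewrite sphere_integralB// E subrr.
  move=> /eqP; rewrite subr_eq0 => /eqP; apply: invXn_eq_tangent_line => //.
  by rewrite (lt_le_trans m0)// mP.
congr (_ / _)%:E; apply: eq_sphere_integral => u u1.
by rewrite /g Pa// tangent_lineE.
Qed.

End interior_point.

(** Here [polar_endo_le] says that no interior point has a smaller polar volume than [c]; the
    selected minimiser need not be [c] a priori, but attains the same volume. *)
Lemma polar_endo_santalo K c : (body_set K)° c -> Phi K = translate K (- c) ->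
  lebesgue_rV (polar (Phi K)) = lebesgue_rV (polar_about K (santalo_point K)).
Proof.
move=> Kc PhiK; rewrite PhiK -polar_about_translate.
have sc : is_santalo_point K c.
  by split=> // z Kz; rewrite polar_about_translate -PhiK; exact: polar_endo_le.
rewrite /santalo_point; case: xgetP => [s _ [Ks sP]|/(_ c)//].
by apply/le_anti/andP; split; [exact: sc.2|exact: sP].
Qed.

(** Takes care of a selected point outside the interior, which the default value of [santalo_point]
    could be. *)
Lemma polar_about_not_interior K z : ~ (body_set K)° z ->
  lebesgue_rV (polar_about K z) = +oo%E.
Proof.
move=> nKz; have [u u1 uK] := support_not_interior n0 nKz.
exact: (polar_volume_infinite u1 uK).
Qed.

(** Bridges the constant support function required by equality on the left and an arbitrary ball:
    [endo_ball_centered] puts the centre at the origin, and preservation of integrals fixes the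
    radius. *)
Lemma endo_ball_center K : (body_set K)° !=set0 -> euclidean_ball (Phi K) <->
  forall u, enorm u = 1 -> h (Phi K) u = mean_width K / 2.
Proof.
move=> [z Kz]; have [m m0 [_ mP]] := endo_support_gt0 Kz.
have area0 := @sphere_area_gt0 R n n0.
have e1 := @enorm_delta R n (Ordinal n0); set e := delta_mx _ _ in e1.
split=> [/euclidean_ball_support[c [r [r0 PK]]] u u1|PK]; last first.
  apply/euclidean_ball_support; exists 0, (mean_width K / 2); split.
    by rewrite -(PK _ e1) (lt_le_trans m0)// mP.
  by move=> u u1; rewrite PK// dot0r addr0.
have c0 := endo_ball_centered n3 PhiD PhiT PhiR Phi_mono PhiB PK.
apply: (mulIf (lt0r_neq0 area0)); rewrite half_mean_width.
rewrite -(sphere_integral_endo n3 PhiD PhiT PhiR Phi_mono PhiB) PK//.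
rewrite -sphere_integral_cst//; apply: eq_sphere_integral => v v1.
by rewrite PK// c0 !dot0r.
Qed.

Lemma ball_polar_santalo K : euclidean_ball K ->
  lebesgue_rV (polar (Phi K)) = lebesgue_rV (polar_about K (santalo_point K)).
Proof.
move=> /euclidean_ball_support[c [r [r0 Kr]]].
have Lr u : enorm u = 1 -> h (translate K (- c)) u = r.
  by move=> u1; rewrite support_translate Kr// dotNr addrK.
apply: (@polar_endo_santalo K c).
  by apply: (interior_support r0) => u /Lr ->.
apply: support_inj => u u1; rewrite Lr// -(PhiT K (- c)).
have LB : translate K (- c) = dilate r unit_ball_body.
  apply: support_inj => v v1.
  by rewrite Lr// support_dilate_ge0 ?(ltW r0)// support_ball v1 mulr1.
rewrite LB (support_endo_dilate PhiD PhiT Phi_mono) ?(ltW r0)//.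
by rewrite PhiB support_ball u1 mulr1.
Qed.

Lemma symmetric_polar_santalo K : (body_set K)° !=set0 ->
  centrally_symmetric K -> Phi = difference_body ->
  lebesgue_rV (polar (Phi K)) = lebesgue_rV (polar_about K (santalo_point K)).
Proof.
move=> [z Kz] [v vK] PhiE.
have Ls u : h (translate K v) (- u) = h (translate K v) u.
  by rewrite -[in RHS]vK support_dilate scaleN1r.
have PK : Phi K = translate K v.
  rewrite -(PhiT K v) PhiE; apply: support_inj => u u1.
  rewrite support_dilate_ge0 ?invr_ge0// support_add support_dilate scaleN1r Ls.
  by field.
have [m m0 [_ mP]] := endo_support_gt0 Kz.
apply: (@polar_endo_santalo K (- v)); last by rewrite opprK.
by apply: (interior_support m0) => u u1; rewrite opprK -PK mP.
Qed.

End polar_endomorphism.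

Theorem theorem2 (R : realType) (n : nat)
    (Phi : convex_body R n -> convex_body R n) (K : convex_body R n) :
  (3 <= n)%N ->
  minkowski_endomorphism Phi ->
  monotone_endomorphism Phi ->
  Phi unit_ball_body = unit_ball_body ->
  (body_set K)° !=set0 ->
  [/\ (lebesgue_rV (@unit_ball R n) * ((mean_width K / 2) ^- n)%:E
         <= lebesgue_rV (polar (Phi K)))%E,
      (lebesgue_rV (polar (Phi K))
         <= lebesgue_rV (polar_about K (santalo_point K)))%E,
      (lebesgue_rV (@unit_ball R n) * ((mean_width K / 2) ^- n)%:E)%E
         = lebesgue_rV (polar (Phi K))
      <-> euclidean_ball (Phi K) &
      lebesgue_rV (polar (Phi K))
         = lebesgue_rV (polar_about K (santalo_point K))
      <-> (centrally_symmetric K /\ Phi = difference_body)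
          \/ euclidean_ball K].
Proof.
move=> n3 [_ PhiD PhiT PhiR] Phi_mono PhiB intK; have [z Kz] := intK.
have n0 : (0 < n)%N by rewrite (leq_trans _ n3).
have [lower lower_eq] := polar_endo_volume_ge n3 PhiD PhiT PhiR Phi_mono PhiB Kz.
have ball_iff := endo_ball_center n3 PhiD PhiT PhiR Phi_mono PhiB intK.
split=> //.
- have [Ks|nKs] := pselect ((body_set K)° (santalo_point K)).
    exact: (polar_endo_le n3 PhiD PhiT PhiR Phi_mono PhiB Ks).
  by rewrite (polar_about_not_interior n3 nKs) leey.
- by rewrite lower_eq ball_iff.
split=> [E|[[Ksym PhiE]|Kball]].
- have [Ks|nKs] := pselect ((body_set K)° (santalo_point K)).
    exact: (polar_endo_eq n3 PhiD PhiT PhiR Phi_mono PhiB Ks E).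
  (* The right side is infinite here, whereas the polar body of [Phi K] has finite volume. *)
  move: E; rewrite (polar_about_not_interior n3 nKs).
  by rewrite (polar_endo_volume n3 PhiD PhiT Phi_mono PhiB Kz).
- exact: (symmetric_polar_santalo n3 PhiD PhiT PhiR Phi_mono PhiB intK Ksym PhiE).
- exact: (ball_polar_santalo n3 PhiD PhiT PhiR Phi_mono PhiB Kball).
Qed.
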